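(* Let $n\ge3$, $p=n-2$, and let $(\Gamma,q)$ be a flip-invariant $n$-gon model. Then there is a finite family of models $(\Gamma^{(\alpha)},q^{(\alpha)})_{\alpha}$, each of one of the two types below, such that for every $n$-gonization $G$ of every connected compact oriented surface (without boundary), $$Z_{(\Gamma,q)}(G)=\sum_{\alpha} Z_{(\Gamma^{(\alpha)},q^{(\alpha)})}(G).$$ Type 1 (with parameters an integer $r\ge1$ and $\beta\in\mathbb C\setminus\{0\}$): the variables are pairs $(i,j)$ with $1\le i,j\le r$, and the weights are $$\Gamma_{i_1j_1\,i_2j_2\ldots i_nj_n}=p\beta\,\delta_{j_1i_2}\delta_{j_2i_3}\cdots\delta_{j_ni_1},\qquad q^{i_1j_1\,i_2j_2}=(p\beta)^{-1}\delta_{j_1i_2}\delta_{j_2i_1}.$$ Type 2 (only if $p$ is even; put $k=p/2$; with parameters integers $M,N\ge0$ with $M+N\ge1$ and $\beta\in\mathbb C\setminus\{0\}$): the variables are pairs $(i,j)$ with $1\le i,j\le M+N$ and either $i\le M<j$ or $j\le M<i$, and the weights are $$\Gamma_{i_1j_1\,i_2j_2\ldots i_nj_n}=k\beta\,\delta_{j_1i_2}\delta_{j_2i_3}\cdots\delta_{j_ni_1},\qquad q^{i_1j_1\,i_2j_2}=(k\beta)^{-1}\delta_{j_1i_2}\delta_{j_2i_1}.$$ Moreover, let $V,E,P$ denote the numbers of vertices, edges and $n$-gons of $G$ and $\chi=V-E+P$. For a model of type 1, $$Z(G)=r^V(p\beta)^{P-E}=(p\beta)^{\chi}\Big(\frac{r}{p\beta}\Big)^{V}.$$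 For a model of type 2, $Z(G)=0$ if $G$ is not chequered, and if $G$ is chequered then $$Z(G)=\big(M^{V_1}N^{V_2}+M^{V_2}N^{V_1}\big)(k\beta)^{P-E},$$ where $V_1$ and $V_2$ are the numbers of vertices in the two colour classes.
   Context: An $n$-gonization $G$ of a connected compact oriented surface without boundary is a presentation of the surface as finitely many (at least one) oriented $n$-gons whose sides are glued in pairs, compatibly with the orientation; each glued pair of sides is an edge of $G$. An $n$-gon model $(\Gamma,q)$ consists of a finite index set (the values of the variables), complex weights $\Gamma_{i_1\ldots i_n}$ that are cyclic, $\Gamma_{i_1i_2\ldots i_n}=\Gamma_{i_2\ldots i_ni_1}$, and complex symmetric weights $q^{ij}=q^{ji}$ such that the matrix $(q^{ij})$ is invertible. Its partition function $Z_{(\Gamma,q)}(G)$ is obtained by placing a variable on each side of each $n$-gon, taking the product of a factor $\Gamma_{i_1\ldots i_n}$ for every $n$-gon (with $i_1,\dots,i_n$ the variables on its sides in the cyclic order given by the orientation) and a factor $q^{ij}$ for every edge (with $i,j$ the variables on the two glued sides), and summing over all values of all variables. In types 1 and 2 each single variable is a pair $(i,j)$, written $ij$ in the indices. The model is flip-invariant if (summation over repeated indices $r,s$) $$\Gamma_{i_1\ldots i_{n-1}r}\,q^{rs}\,\Gamma_{s\,i_n\ldots i_{2n-2}}=\Gamma_{i_2\ldots i_nr}\,q^{rs}\,\Gamma_{s\,i_{n+1}\ldots i_{2n-2}i_1}=\cdots,$$ i.e. the left-hand expression is invariant under all cyclic permutations of $(i_1,\dots,i_{2n-2})$. $G$ is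 called chequered if its vertices (equivalently, the faces of its dual graph) can be coloured with two colours such that the two ends of every edge (equivalently, any two neighbouring faces of the dual graph) have different colours. *)

(* Defs.v *)
From mathcomp Require Import all_boot all_order all_algebra.
Set Implicit Arguments.
Unset Strict Implicit.
Unset Printing Implicit Defensive.

Import Order.TTheory GRing.Theory Num.Theory.
Local Open Scope ring_scope.

(* The sides of a polygon are numbered 0, ..., n-1 in the cyclic order given by
   the orientation.  Since two glued sides are identified with opposite
   directions, any fixed-point free involution of the set of all sides yields a
   closed oriented surface; two sides of one polygon may be glued together. *)
Record ngonization (n : nat) := Ngonization {
  polygon : finType;
  glue : polygon * 'I_n -> polygon * 'I_n;
  glueK : involutive glue;
  glue_neq : forall s, glue s != s;
  polygon_gt0 : (0 < #|polygon|)%N;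
  polygon_connected : forall a b : polygon,
    connect [rel x y | [exists s, (s.1 == x) && ((glue s).1 == y)]] a b }.

Section Cells.
Variables (n : nat) (G : ngonization n).

Definition side : finType := (polygon G * 'I_n)%type.

Definition next (s : side) : side := (s.1, ordS s.2).

(* An edge is represented by the one of its two glued sides that comes first in
   an arbitrary enumeration of the sides. *)
Definition edges : {set side} :=
  [set s : side | (enum_rank s < enum_rank (glue s : side))%N].

(* Each side stands for the polygon corner at its starting point.  The starting
   point of s is the end point of glue s, that is, the starting point of
   next (glue s), so the vertices are the orbits of turn. *)
Definition turn (s : side) : side := next (glue s).

Definition start (s : side) : {set side} := [set t | fconnect turn s t].

Definition vertices : {set {set side}} := [set start s | s : side].

Definition nb_vertices : nat := #|vertices|.
Definition nb_edges : nat := #|edges|.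
Definition nb_polygons : nat := #|polygon G|.

Definition euler_char : int :=
  nb_vertices%:Z - nb_edges%:Z + nb_polygons%:Z.

(* Only the values of c on vertices matter. *)
Definition chequering (c : {set side} -> bool) : Prop :=
  forall s : side, c (start s) != c (start (next s)).

Definition chequered : Prop := exists c, chequering c.

Definition nb_coloured (c : {set side} -> bool) (b : bool) : nat :=
  #|[set v in vertices | c v == b]|.

End Cells.

(* gamma [:: i_1; ...; i_n] is the weight of an n-gon; for models of n-gons only
   the values of gamma on sequences of length n are ever used. *)
Record weights (K : fieldType) := Weights {
  var : finType;
  gamma : seq var -> K;
  qweight : var -> var -> K }.

Section Models.
Variables (K : fieldType) (n : nat).
Implicit Type W : weights K.

Definition qmatrix W : 'M[K]_#|var W| :=
  \matrix_(i, j) qweight (enum_val i : var W) (enum_val j).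

Definition ngon_model W : Prop :=
  [/\ forall s : seq (var W), size s = n -> gamma (rot 1 s) = gamma s,
      forall i j : var W, qweight i j = qweight j i
    & qmatrix W \in unitmx].

(* For s = [:: i_1; ...; i_(2n-2)]. *)
Definition flip_sum W (s : seq (var W)) : K :=
  \sum_(r : var W) \sum_(t : var W)
    gamma (rcons (take n.-1 s) r) * qweight r t * gamma (t :: drop n.-1 s).

Definition flip_invariant W : Prop :=
  forall s : seq (var W), size s = (2 * n - 2)%N ->
    forall m : nat, flip_sum (rot m s) = flip_sum s.

Definition partition_function W (G : ngonization n) : K :=
  \sum_(x : {ffun side G -> var W})
    (\prod_(a : polygon G) gamma [seq x (a, i) | i <- enum 'I_n]) *
    (\prod_(s in edges G) qweight (x s) (x (glue s))).

End Models.

(* The variables T are seen as pairs of indices below m through ij; the relation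
   in cycle says that the second index of each pair is the first index of the
   next pair, cyclically. *)
Definition loop_weights (K : fieldType) (T : finType) (m : nat)
    (ij : T -> 'I_m * 'I_m) (c : K) : weights K :=
  @Weights K T
    (fun s => c * (cycle [rel x y | (ij x).2 == (ij y).1] s)%:R)
    (fun x y => c^-1 * ((ij x).2 == (ij y).1)%:R * ((ij y).2 == (ij x).1)%:R).

Definition type1_weights (K : fieldType) (n r : nat) (beta : K) : weights K :=
  @loop_weights K ('I_r * 'I_r)%type r id ((n - 2)%:R * beta).

(* Indices start at 0: the values 1, ..., M are those of i : 'I_(M + N) with
   i < M. *)
Definition type2_pair (M N : nat) (x : 'I_(M + N) * 'I_(M + N)) : bool :=
  (x.1 < M <= x.2)%N || (x.2 < M <= x.1)%N.

Definition type2_weights (K : fieldType) (n M N : nat) (beta : K) : weights K :=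
  @loop_weights K {x : 'I_(M + N) * 'I_(M + N) | type2_pair x} (M + N) val
    ((n - 2)./2%:R * beta).

Definition is_type1 (K : fieldType) (n : nat) (W : weights K) : Prop :=
  exists (r : nat) (beta : K),
    [/\ (1 <= r)%N, beta != 0 & W = type1_weights n r beta].

Definition is_type2 (K : fieldType) (n : nat) (W : weights K) : Prop :=
  exists (M N : nat) (beta : K),
    [/\ ~~ odd (n - 2), (1 <= M + N)%N, beta != 0
      & W = type2_weights n M N beta].

(* Main.v *)
From HB Require Import structures.
From mathcomp Require Import all_boot all_order all_algebra.
From mathcomp Require Import zify ring.
From mathcomp Require Import boolp reals.
From mathcomp.real_closed Require Import complex.
Require Import Defs.

Set Implicit Arguments.
Unset Strict Implicit.
Unset Printing Implicit Defensive.

Import Order.TTheory GRing.Theory Num.Theory.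
Local Open Scope ring_scope.

(** Write n = p + 2.  Contracting the last index of Gamma with q turns the space A
    spanned by the variables into an algebra with a (p + 1)-ary bracket; flip
    invariance says exactly that this bracket is totally associative, and the
    form inverse to q is invariant under it.

    An isotropic ideal J may be replaced by its subquotient J^perp / J without
    changing the partition function, and an ideal meeting its orthogonal
    trivially splits off as an orthogonal summand; so one may assume that A is
    simple with a nonzero bracket.  A should be thought of as the degree-1 part
    of a (Z/p)-graded algebra.  An element x of minimal rank satisfies
    x w x = phi(w) x for all words w of degree -1, and phi <> 0 because A is
    simple; this yields degree-0 primitive idempotents e, f with x in e A f.  The
    form pairs e A f with f A e, which gives x' in f A e, and products of x and
    x' identify the degrees k and k + 2.  If e and f are linked by an element of
    degree 0 (in particular if p is odd), there is z <> 0 in e A e, and dual bases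
    a_i of R_0 e and b_j of e R_0 give the matrix units a_i z b_j of a model of
    type 1.  Otherwise the elements a_i x b'_j and a'_j x' b_i, with dual bases
    a'_j, b'_j for f, are the off-diagonal matrix units of a model of type 2. *)

(** The graded algebra itself is never built. Its degree 0 is replaced by the pairs of adjoint
    operators [mult], and an element of degree -1 by a word of p - 1 letters followed by such an
    operator.

    The parity of p enters through the words x x' x ... of p letters, which have degree 0 and are
    nonzero. If p is odd, such a word leads from one of the idempotents e, f to the other and links
    them, which forces type 1. If p is even, it returns to its starting idempotent and acts there as
    a nonzero scalar. Dividing the letters by a p-th root of this scalar turns it into 1, so that
    the matrix units multiply without constants. This root, and the eigenvalue behind the minimal
    rank, are where algebraic closedness enters. The one constant left in a simple algebra is the
    value c of the form on z and its partner (z itself in type 1), and beta is c / p or c / k. *)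

Ltac cat_right :=
  rewrite /= -?cats1 ?cats0;
  repeat (rewrite -?catA; progress rewrite /=);
  rewrite -?catA //.

(** * Algebras with an associative (p + 1)-ary bracket *)

(* br s, for s of length p.+1, is the vector with form (br s) w = Gamma (s, w);
   the values of br on other lengths are irrelevant.  br_cyc is the cyclicity of
   Gamma. *)
Record flip_algebra (K : fieldType) (p : nat) := FlipAlgebra {
  vec :> vectType K;
  form : vec -> vec -> K;
  br : seq vec -> vec;
  arity_gt0 : (0 < p)%N;
  br_lin : forall s1 s2 a u v,
    br (s1 ++ (a *: u + v) :: s2) = a *: br (s1 ++ u :: s2) + br (s1 ++ v :: s2);
  form_lin : forall w a u v, form (a *: u + v) w = a * form u w + form v w;
  formC : forall u v, form u v = form v u;
  form_nondeg : forall v, (forall w, form v w = 0) -> v = 0;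
  form_riesz : forall f : vec -> K,
    (forall a u v, f (a *: u + v) = a * f u + f v) ->
    exists w, forall v, f v = form v w;
  br_cyc : forall u s v, size s = p ->
    form (br (u :: s)) v = form (br (rcons s v)) u;
  br_assoc : forall s1 t s2, size t = p.+1 -> (size s1 + size s2 = p)%N ->
    br (s1 ++ br t :: s2) =
    br (br (take p.+1 (s1 ++ t ++ s2)) :: drop p.+1 (s1 ++ t ++ s2)) }.

(** * Subspaces given by predicates *)

Section Subspaces.
Variables (K : fieldType) (V : vectType K).
Implicit Types (P S : V -> Prop).

(** Predicates rather than [vspace], because ideals arise from formulas and spans; [subspace_vspace]
    converts when a dimension or a basis is wanted. *)
Definition subspace P := P 0 /\ forall a u v, P u -> P v -> P (a *: u + v).

Inductive lspan S : V -> Prop :=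
| LSpan0 : lspan S 0
| LSpanD a u v : S u -> lspan S v -> lspan S (a *: u + v).

Lemma lspan_min S P v : lspan S v -> subspace P -> (forall u, S u -> P u) -> P v.
Proof. by move=> Sv [P0 PD] SP; elim: Sv=> [//|a u w /SP Pu _ Pw]; apply: PD. Qed.

Lemma lspan_gen S u : S u -> lspan S u.
Proof. by move=> Su; rewrite -[u]scale1r -[_ *: u]addr0; apply: LSpanD => //; left. Qed.

Lemma lspan_subspace S : subspace (lspan S).
Proof.
split=> [|a u v]; first by left.
elim=> [|b w z Sw _ IH] Hv; first by rewrite scaler0 add0r.
by rewrite scalerDr scalerA -addrA; apply: LSpanD => //; apply: IH.
Qed.

Lemma subspaceZ P a u : subspace P -> P u -> P (a *: u).
Proof. by move=> [P0 PD] Pu; rewrite -[_ *: _]addr0; apply: PD. Qed.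

Lemma subspaceD P u v : subspace P -> P u -> P v -> P (u + v).
Proof. by move=> [P0 PD] Pu Pv; rewrite -[u]scale1r; apply: PD. Qed.

Lemma subspace_sum P (I : finType) (r : pred I) (F : I -> V) :
  subspace P -> (forall i, r i -> P (F i)) -> P (\sum_(i | r i) F i).
Proof.
move=> sP PF; elim/big_ind: _ => //; first by case: sP.
by move=> u v Pu Pv; apply: subspaceD.
Qed.

(** A [vspace] of largest dimension inside P cannot grow when a vector of P is added to it. *)
Lemma subspace_vspace P : subspace P ->
  exists U : {vspace V}, forall v, (v \in U) <-> P v.
Proof.
move=> sP.
pose Q k := `[< exists U : {vspace V}, \dim U = k /\ forall v, v \in U -> P v >].
have exQ : exists k, Q k.
  exists 0%N; apply/asboolP; exists 0%VS; split; first exact: dimv0.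
  by move=> v; rewrite memv0 => /eqP->; case: sP.
have boundQ k : Q k -> (k <= \dim (fullv : {vspace V}))%N.
  by move=> /asboolP[U [<- _]]; apply: dimvS; apply: subvf.
case: (ex_maxnP exQ boundQ) => k /asboolP[U [dU UP]] maxk.
exists U => v; split=> [/UP//|Pv].
have H : Q (\dim (U + <[v]>)%VS).
  apply/asboolP; exists (U + <[v]>)%VS; split=> // w /memv_addP[u uU [x /vlineP[c ->] ->]].
  by apply: subspaceD => //; [apply: UP | apply: subspaceZ].
have := maxk _ H; rewrite -dU => le.
have /eqP -> : U == (U + <[v]>)%VS by rewrite eqEdim addvSl.
by rewrite memvE addvSr.
Qed.

Lemma linear_lfun (W : vectType K) (f : V -> W) : linear f ->
  exists F : 'Hom(V, W), F =1 f.
Proof.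
move=> lf; pose lm := GRing.isLinear.Build K V W *:%R f lf.
pose F : {linear V -> W} := HB.pack f lm.
by exists (linfun F) => v; rewrite lfunE.
Qed.

(** The map u - [projv U u] is linear, kills U and not v; one of its coordinates is the
    functional. *)
Lemma separating_functional (U : {vspace V}) v : v \notin U ->
  exists f : V -> K, [/\ forall a u w, f (a *: u + w) = a * f u + f w,
    forall u, u \in U -> f u = 0 & f v <> 0].
Proof.
move=> vU; pose d u := u - projv U u.
have dv : d v != 0.
  by apply: contra vU; rewrite subr_eq0 => /eqP->; apply: memv_proj.
have [i fi] : exists i, coord (vbasis fullv) i (d v) <> 0.
  apply: contrapT => H; case/negP: dv; apply/eqP.
  rewrite (coord_vbasis (memvf (d v))) big1 // => i _.
  suff -> : coord (vbasis fullv) i (d v) = 0 by rewrite scale0r.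
  by apply: contrapT => Hi; apply: H; exists i.
exists (fun u => coord (vbasis fullv) i (d u)); split=> // [a u w|u uU].
  have -> : d (a *: u + w) = a *: d u + d w.
    by rewrite /d linearP scalerBr opprD addrACA.
  by rewrite linearP.
by rewrite /d projv_id // subrr linear0.
Qed.

End Subspaces.

(** * Multipliers, and semiprimeness of simple algebras *)

Section Algebra.
Variables (K : fieldType) (p : nat) (A : flip_algebra K p).
Implicit Types (u v w x : A) (s t : seq A) (P : A -> Prop).
Local Notation br := (@br K p A).
Local Notation form := (@form K p A).
Let p_gt0 : (0 < p)%N := arity_gt0 A.

Lemma form_linr w a u v : form w (a *: u + v) = a * form w u + form w v.
Proof. by rewrite formC form_lin !(formC w). Qed.

Lemma form0l v : form 0 v = 0.
Proof. by rewrite -[0]addr0 -[X in X + _](scaler0 _ (-1)) form_lin mulN1r addNr. Qed.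

Lemma form0r v : form v 0 = 0. Proof. by rewrite formC form0l. Qed.

Lemma formZl a u v : form (a *: u) v = a * form u v.
Proof. by rewrite -[_ *: _]addr0 form_lin form0l addr0. Qed.

Lemma formZr a u v : form v (a *: u) = a * form v u.
Proof. by rewrite formC formZl formC. Qed.

Lemma formDl u v w : form (u + v) w = form u w + form v w.
Proof. by rewrite -[u in LHS]scale1r form_lin mul1r. Qed.

Lemma formDr u v w : form w (u + v) = form w u + form w v.
Proof. by rewrite formC formDl !(formC w). Qed.

Lemma form_ext u v : (forall w, form u w = form v w) -> u = v.
Proof.
move=> H; apply/eqP; rewrite -subr_eq0; apply/eqP; apply: form_nondeg => w.
by rewrite addrC -scaleN1r form_lin H mulN1r addNr.
Qed.

Lemma form_suml (I : finType) (r : pred I) (F : I -> A) w :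
  form (\sum_(i | r i) F i) w = \sum_(i | r i) form (F i) w.
Proof.
apply: (big_morph (fun u => form u w)); last exact: form0l.
by move=> u v; rewrite formDl.
Qed.

Lemma form_sumr (I : finType) (r : pred I) (F : I -> A) w :
  form w (\sum_(i | r i) F i) = \sum_(i | r i) form w (F i).
Proof. by rewrite formC form_suml; apply: eq_bigr => i _; rewrite formC. Qed.

Lemma br0 s1 s2 : br (s1 ++ 0 :: s2) = 0.
Proof.
by rewrite -[0 in LHS]addr0 -[X in X + _](scaler0 _ (-1)) br_lin scaleN1r addNr.
Qed.

Lemma brZ s1 s2 a u : br (s1 ++ a *: u :: s2) = a *: br (s1 ++ u :: s2).
Proof. by rewrite -[a *: u]addr0 br_lin br0 addr0. Qed.

Lemma subspace_br s1 s2 P :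
  subspace P -> subspace (fun v => P (br (s1 ++ v :: s2))).
Proof.
by move=> [P0 PD]; split=> [|a u v Pu Pv]; rewrite ?br0 ?br_lin //; apply: PD.
Qed.

(** The cyclic word s1, u, s2, w is cut after u instead of after w. *)
Lemma br_rot s1 u s2 w : (size s1 + size s2 = p)%N ->
  form (br (s1 ++ u :: s2)) w = form (br (s2 ++ w :: s1)) u.
Proof.
elim/last_ind: s1 u s2 w => [|s1 v IH] u s2 w /=.
  by rewrite add0n => Hs; rewrite br_cyc // -cats1.
rewrite size_rcons => Hs.
rewrite cat_rcons IH /=; last by lia.
by rewrite br_cyc ?size_cat /= ?rcons_cat //=; lia.
Qed.

(** Both sides equal the leftmost bracketing of the same word of 2p + 1 letters, which [br_assoc]
    provides as a normal form. *)
Lemma br_eq s1 t s2 s1' t' s2' : size t = p.+1 -> size t' = p.+1 ->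
  (size s1 + size s2 = p)%N -> (size s1' + size s2' = p)%N ->
  s1 ++ t ++ s2 = s1' ++ t' ++ s2' ->
  br (s1 ++ br t :: s2) = br (s1' ++ br t' :: s2').
Proof. by move=> *; rewrite !br_assoc //; congr (br (br (take _ _) :: drop _ _)). Qed.

(* The degree-0 part R_0 of the graded algebra generated by A: an element acts
   on A from the left by ml and from the right by mr.  It contains the words of
   length p (word_mult). *)
Record mult := Mult {
  ml : A -> A;
  mr : A -> A;
  mult_adj : forall u v, form (mr u) v = form u (ml v);
  ml_br : forall v s, size s = p -> ml (br (v :: s)) = br (ml v :: s) }.

Lemma ml_lin (a : mult) : linear (ml a).
Proof.
move=> c u v; apply: form_ext => w.
by rewrite form_lin !(formC _ w) -!mult_adj form_linr.
Qed.

Lemma mr_lin (a : mult) : linear (mr a).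
Proof.
move=> c u v; apply: form_ext => w.
by rewrite form_lin !mult_adj form_lin.
Qed.

Lemma ml0 a : ml a 0 = 0.
Proof. by have := ml_lin a (-1) 0 0; rewrite scaler0 addr0 scaleN1r addNr. Qed.
Lemma mr0 a : mr a 0 = 0.
Proof. by have := mr_lin a (-1) 0 0; rewrite scaler0 addr0 scaleN1r addNr. Qed.
Lemma mlZ a c u : ml a (c *: u) = c *: ml a u.
Proof. by rewrite -[_ *: u]addr0 ml_lin ml0 addr0. Qed.
Lemma mrZ a c u : mr a (c *: u) = c *: mr a u.
Proof. by rewrite -[_ *: u]addr0 mr_lin mr0 addr0. Qed.

Lemma mr_br (a : mult) v s : size s = p ->
  mr a (br (rcons s v)) = br (rcons s (mr a v)).
Proof.
move=> Hs; apply: form_ext => w.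
by rewrite mult_adj -br_cyc // -ml_br // formC -mult_adj formC br_cyc.
Qed.

(** In the graded algebra this is (u a) v = u (a v). After a rotation that puts u last, adjunction
    and [ml_br] carry a over to v. *)
Lemma mr_ml_move (a : mult) s1 u v s2 : (size s1 + size s2).+1 = p ->
  br (s1 ++ mr a u :: v :: s2) = br (s1 ++ u :: ml a v :: s2).
Proof.
move=> Hs; apply: form_ext => w.
rewrite (@br_rot s1 (mr a u)) /=; last by lia.
rewrite (@br_rot s1 u) /=; last by lia.
by rewrite -ml_br ?size_cat /= 1?formC ?mult_adj 1?formC //; lia.
Qed.

Definition idm : mult.
Proof. by exists id id. Defined.

Definition mulm (a b : mult) : mult.
Proof.
exists (ml a \o ml b) (mr b \o mr a) => [u v|v s Hs] /=.
  by rewrite !mult_adj.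
by rewrite !ml_br.
Defined.

Definition scalem (c : K) (a : mult) : mult.
Proof.
exists (fun v => c *: ml a v) (fun v => c *: mr a v) => [u v|v s Hs] /=.
  by rewrite formZl formZr mult_adj.
by rewrite ml_br // (brZ [::] s).
Defined.

Definition addm (a b : mult) : mult.
Proof.
exists (fun v => ml a v + ml b v) (fun v => mr a v + mr b v) => [u v|v s Hs] /=.
  by rewrite formDl formDr !mult_adj.
by rewrite !ml_br // -[X in _ = br (X + _ :: s)]scale1r (br_lin [::] s) scale1r.
Defined.

Lemma word_mult s : size s = p ->
  exists a : mult, (forall v, ml a v = br (rcons s v)) /\
                   (forall v, mr a v = br (v :: s)).
Proof.
move=> Hs; pose l v := br (rcons s v); pose r v := br (v :: s).
have adj u v : form (r u) v = form u (l v) by rewrite /r br_cyc // formC.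
have lbr v t : size t = p -> l (br (v :: t)) = br (l v :: t).
  move=> Ht; rewrite /l -cats1.
  have := @br_eq s (v :: t) [::] [::] (rcons s v) t.
  rewrite /= size_rcons cats0 cat_rcons Hs Ht addn0; exact.
by exists (Mult adj lbr).
Qed.

Definition lincm (I : finType) (r : pred I) (c : I -> K) (a : I -> mult) : mult.
Proof.
exists (fun v => \sum_(i | r i) c i *: ml (a i) v)
       (fun v => \sum_(i | r i) c i *: mr (a i) v) => [u v|v s Hs] /=.
  rewrite form_suml form_sumr; apply: eq_bigr => i _.
  by rewrite formZl formZr mult_adj.
rewrite (big_morph (fun u => br (u :: s)) (id1 := 0) (op1 := +%R)).
- by apply: eq_bigr => i _; rewrite ml_br // (brZ [::] s).
- by move=> u w; rewrite -[u]scale1r (br_lin [::] s) !scale1r.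
- exact: (br0 [::] s).
Defined.

(** Left actions suffice for a comparison, since the form makes the right action the adjoint of the
    left one. *)
Definition eqm (a b : mult) := forall v, ml a v = ml b v.

Lemma eqm_mr a b : eqm a b -> forall v, mr a v = mr b v.
Proof. by move=> E v; apply: form_ext => w; rewrite !mult_adj E. Qed.

Lemma mr_eqm a b : (forall v, mr a v = mr b v) -> eqm a b.
Proof. by move=> E v; apply: form_ext => w; rewrite 2!(formC _ w) -!mult_adj E. Qed.

Definition ideal P := subspace P /\
  forall s1 v s2, (size s1 + size s2 = p)%N -> P v -> P (br (s1 ++ v :: s2)).

Definition simple := forall P, ideal P -> (exists v, v <> 0 /\ P v) -> forall v, P v.

Hypothesis A_simple : simple.
Hypothesis br_neq0 : exists s, size s = p.+1 /\ br s <> 0.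

(** The brackets span a nonzero ideal. Identities on A thus need checking on brackets only. *)
Lemma br_span v : lspan (fun u => exists s, size s = p.+1 /\ u = br s) v.
Proof.
apply: A_simple.
  split; first exact: lspan_subspace.
  move=> s1 u s2 Hs _; apply: lspan_gen; exists (s1 ++ u :: s2); split=> //.
  by rewrite size_cat /=; lia.
case: br_neq0 => s [Hs nz]; exists (br s); split=> //.
by apply: lspan_gen; exists s.
Qed.

(** On a bracket one operator acts on the first letter and the other on the last; as p > 0, these
    are different letters. *)
Lemma mult_comm (a b : mult) v : ml a (mr b v) = mr b (ml a v).
Proof.
pose P u := ml a (mr b u) = mr b (ml a u); rewrite -/(P v).
apply: lspan_min (br_span v) _ _ => [|_ [s [Hs ->]]].
  split=> [|c u w Hu Hw]; rewrite /P; first by rewrite !(ml0, mr0).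
  by rewrite !(ml_lin, mr_lin) Hu Hw.
rewrite /P; case: s Hs => [//|u s]; case/lastP: s => [|s w] /= => [[Hs]|[]].
  by exfalso; move: p_gt0; case: p Hs.
rewrite size_rcons => Hs.
by rewrite ml_br ?size_rcons // -!rcons_cons !mr_br //= ?rcons_cons ?ml_br ?size_rcons.
Qed.

(** By cyclicity such a v is orthogonal to all brackets, and these span A. *)
Lemma annl0 v : (forall s, size s = p -> br (v :: s) = 0) -> v = 0.
Proof.
move=> H; apply: form_nondeg => w.
pose P u := form v u = 0; rewrite -/(P w).
apply: lspan_min (br_span w) _ _ => [|_ [s [Hs ->]]].
  split=> [|c u z Hu Hz]; rewrite /P; first by rewrite form0r.
  by rewrite form_linr Hu Hz mulr0 addr0.
case/lastP: s Hs => [//|s z]; rewrite size_rcons => -[Hs].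
by rewrite /P formC -br_cyc // (H s Hs) form0l.
Qed.

Lemma annr0 v : (forall s, size s = p -> br (rcons s v) = 0) -> v = 0.
Proof.
move=> H; apply: form_nondeg => w.
pose P u := form v u = 0; rewrite -/(P w).
apply: lspan_min (br_span w) _ _ => [|_ [s [Hs ->]]].
  split=> [|c u z Hu Hz]; rewrite /P; first by rewrite form0r.
  by rewrite form_linr Hu Hz mulr0 addr0.
case: s Hs => [//|z s] [Hs].
by rewrite /P formC br_cyc // (H s Hs) form0l.
Qed.


(* Since A is simple, it is the sum of the spaces T_m spanned by the brackets
   s1 x s2 with size s1 = m, for m <= p.  In a product of an element of T_m and
   one of T_m the word between the two occurrences of x has degree -1, so that
   the product vanishes; hence the spaces T_m can be discarded one at a time. *)
Section Semiprime.
Variable x : A.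
Hypothesis x_null : forall s a, size s = p.-1 -> br (x :: rcons s (ml a x)) = 0.

Let G m (r : A) := exists s1 s2 : seq A, [/\ (size s1 + size s2 = p)%N, (m <= size s1)%N &
  r = br (s1 ++ x :: s2)].
(** Brackets lengthen the words around x. Grouping letters brings the left word back to at most p
    letters, and the rest on the right goes into s2 and u; without u the case of p letters on each
    side would be left out. *)
Let gen m v := exists (r : A) (u : seq A), [/\ G m r, size u = p & v = br (r :: u)].

Lemma null_gen_mul (r : A) (a1 u1 : seq A) : G 0 r -> (size a1 + size u1 = p)%N ->
  G 0 (br (a1 ++ r :: u1)) \/
  exists (r' : A) (c : seq A), [/\ G 0 r', size c = p & br (a1 ++ r :: u1) = br (r' :: c)].
Proof.
move=> [s1 [s2 [Hs _ ->]]] Ha.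
case: (leqP (size a1 + size s1) p) => Hk.
  right; pose k := (p - (size a1 + size s1))%N.
  exists (br ((a1 ++ s1) ++ x :: take k s2)), (drop k s2 ++ u1).
  split.
  - exists (a1 ++ s1), (take k s2); split=> //.
    by rewrite size_cat size_takel /k; lia.
  - by rewrite size_cat size_drop /k; lia.
  - apply: (@br_eq a1 _ u1 [::]);
      rewrite /= ?size_cat /= ?size_cat ?size_takel ?size_drop /k; try lia.
    by rewrite -[s2 in LHS](cat_take_drop k) /k; cat_right.
left; exists (br (take p.+1 (a1 ++ s1)) :: drop p.+1 (a1 ++ s1)), (s2 ++ u1).
split=> //=; first by rewrite size_drop !size_cat; lia.
apply: (@br_eq a1 _ u1 [::]); rewrite /= ?size_cat /= ?size_drop ?size_takel ?size_cat /=; try lia.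
by rewrite /= [RHS]catA cat_take_drop; cat_right.
Qed.

Lemma null_gen_rmul (r : A) (c d : seq A) : size c = p -> size d = p ->
  exists u : seq A, size u = p /\ br (br (r :: c) :: d) = br (r :: u).
Proof.
move=> Hc Hd; exists (br (take p.+1 (c ++ d)) :: drop p.+1 (c ++ d)).
split; first by rewrite /= size_drop size_cat; lia.
by apply: (@br_eq [::] _ _ [:: r]);
  rewrite /= ?size_drop ?size_takel ?size_cat ?cat_take_drop ?Hc //; lia.
Qed.

Lemma null_ideal : ideal (lspan (gen 0)).
Proof.
split=> [|a1 v a2 Ha Hv]; first exact: lspan_subspace.
pose P v := lspan (gen 0) (br (a1 ++ v :: a2)); rewrite -/(P v).
apply: lspan_min Hv _ _; first by apply: subspace_br; apply: lspan_subspace.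
move=> _ [r [u [Gr Hu ->]]]; apply: lspan_gen.
have E : br (a1 ++ br (r :: u) :: a2) =
    br (br (a1 ++ r :: take (size a2) u) :: drop (size a2) u ++ a2).
  apply: (@br_eq a1 _ _ [::]);
    rewrite /= ?size_cat /= ?size_drop ?size_takel; try lia.
  by rewrite -[in LHS](cat_take_drop (size a2) u); cat_right.
rewrite E; have Hsz : size (drop (size a2) u ++ a2) = p.
  by rewrite size_cat size_drop; lia.
have [|GG|[r' [c [Gr' Hc ->]]]] := null_gen_mul (a1 := a1) (u1 := take (size a2) u) Gr.
- by rewrite size_takel; lia.
- by eexists; eexists; split; [exact: GG| exact: Hsz |].
- have [u' [Hu' ->]] := null_gen_rmul r' Hc Hsz.
  by exists r', u'.
Qed.

Lemma null_all : x <> 0 -> forall v, lspan (gen 0) v.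
Proof.
move=> x0; apply: A_simple; first exact: null_ideal.
apply: contrapT => H; apply: x0; apply: annl0 => s Hs; apply: annl0 => u Hu.
apply: contrapT => nz; apply: H; exists (br (br (x :: s) :: u)); split=> //.
by apply: lspan_gen; exists (br (x :: s)), u; split=> //; exists [::], s.
Qed.

Lemma null_step m : (forall v, lspan (gen m) v) -> forall v, lspan (gen m.+1) v.
Proof.
move=> Hm v; apply: lspan_min (Hm v) (lspan_subspace _) _.
move=> _ [r [u [[s1 [s2 [Hs Hms Er]]] Hu ->]]].
case: (ltngtP m (size s1)) Hms => // Hms _.
  apply: lspan_gen; exists r, u; split=> //; exists s1, s2; split=> //.
case/lastP: u Hu => [|u w]; first by move: p_gt0 => /= + E; rewrite -[X in (0 < X)%N]E.
rewrite size_rcons => Hu.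
(* The last letter of the right word is itself expanded in [gen m], which spans A. *)
pose P w := lspan (gen m.+1) (br (r :: rcons u w)); rewrite -/(P w).
have Esub z : br (r :: rcons u z) = br ((r :: u) ++ z :: [::]) by rewrite cats1.
apply: lspan_min (Hm w) _ _.
  have := subspace_br (r :: u) [::] (lspan_subspace (gen m.+1)).
  by move=> [P0 PD]; split; rewrite /P => *; rewrite Esub; [apply: P0|apply: PD; rewrite -Esub].
move=> {w} _ [r' [u' [[s1' [s2' [Hs' Hms' Er']]] Hu' ->]]]; rewrite /P.
have E : br (r :: rcons u (br (r' :: u'))) = br (br (r :: rcons u r') :: u').
  by rewrite Esub; apply: (@br_eq (r :: u) _ [::] [::]);
    rewrite /= ?size_rcons ?Hu ?Hu' ?cats0 ?cat_rcons //; lia.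
rewrite {}E.
(* If s1' has more than m letters, its first letter completes the bracket of r and u, and the left
   word of x keeps its length. *)
case: (ltngtP m (size s1')) Hms' => // Hms' _.
  apply: lspan_gen; exists (br (r :: rcons u r')), u'; split=> //.
  case: s1' Hs' Hms' Er' => // y s1' /= Hs' Hms' Er'.
  exists (br (r :: rcons u y) :: s1'), s2'; split=> //.
  rewrite Esub Er'; apply: (@br_eq (r :: u) _ [::] [::]);
    rewrite /= ?size_cat /= ?size_rcons ?cats0 ?cat_rcons //; lia.
(* Both copies of x now have exactly m letters on their left, so (p - m) + (p - 1) + m = 2p - 1
   letters lie between them: p of these form a multiplier, and [x_null] applies. *)
have -> : br (r :: rcons u r') = 0.
  rewrite {}Er {}Er' => {Esub P}; case: m Hms Hms' {Hm} => [|m] Hms Hms'.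
    case: s1 s1' Hs Hs' Hms Hms' => [|//] [|//] /= Hs Hs' _ _.
    case/lastP: s2 Hs => [|s2 y]; first by move: p_gt0 => /= + E; rewrite -[X in (0 < X)%N]E.
    rewrite size_rcons add0n => Hs.
    have [a [al _]] : exists a : mult, (forall v, ml a v = br (rcons (y :: u) v)) /\
        (forall v, mr a v = br (v :: (y :: u))) by apply: word_mult.
    have -> : br (br (x :: rcons s2 y) :: rcons u (br (x :: s2'))) =
        br (br (br (x :: rcons s2 y) :: rcons u x) :: s2').
      rewrite -!cats1 -!cat_cons; apply: (@br_eq (_ :: u) _ [::] [::]);
        rewrite /= ?size_cat /= ?size_cat /= ?cats0 -?catA //; lia.
    have -> : br (br (x :: rcons s2 y) :: rcons u x) = br (x :: rcons s2 (ml a x)).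
      rewrite al -!cats1 -!cat_cons; apply: (@br_eq [::] _ _ (_ :: s2) _ [::]);
        rewrite /= ?size_cat /= ?size_cat /= ?cats0 -?catA //; lia.
    by rewrite x_null ?(br0 [::]) //; lia.
  pose q1 := take m (u ++ s1'); pose q2 := drop m (u ++ s1').
  have Eq : u ++ s1' = q1 ++ q2 by rewrite cat_take_drop.
  have Hq1 : size q1 = m by rewrite size_takel // size_cat; lia.
  have Hq2 : size q2 = p by rewrite size_drop size_cat; lia.
  have [a [al _]] := word_mult Hq2.
  have -> : br (br (s1 ++ x :: s2) :: rcons u (br (s1' ++ x :: s2'))) =
     br (br (s1 ++ x :: s2) :: q1 ++ ml a x :: s2').
    rewrite al -!cats1; apply: (@br_eq (_ :: u) _ [::] (_ :: q1));
      rewrite /= ?size_cat /= ?size_cat /= ?cats0 ; try lia.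
    by rewrite (catA u) Eq; cat_right.
  have -> : br (br (s1 ++ x :: s2) :: q1 ++ ml a x :: s2') =
     br (s1 ++ br (x :: rcons (s2 ++ q1) (ml a x)) :: s2').
    apply: (@br_eq [::] _ (q1 ++ ml a x :: s2') s1);
      rewrite /= ?size_rcons ?size_cat /= ?size_cat /=; try lia.
    by cat_right.
  by rewrite x_null ?br0 // size_cat; lia.
by rewrite (br0 [::]); left.
Qed.

(** Nothing is left in [gen p.+1], whose left words would exceed the p letters available. This is
    semiprimeness of the graded algebra, tested in degree 1. *)
Lemma semiprime : x = 0.
Proof.
apply: contrapT => x0.
have H m : forall v, lspan (gen m) v.
  by elim: m => [|m IH]; [apply: null_all | apply: null_step].
have := H p.+1 x; have : forall v, ~ gen p.+1 v.
  by move=> v [r [u [[s1 [s2 [Hs]]]]]]; lia.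
by move=> no Hx; apply: x0; case: Hx => // a u v /no.
Qed.

End Semiprime.

End Algebra.


(** * Primitive idempotents of simple algebras *)

Section Eigenvector.
Variables (K : numClosedFieldType) (V : vectType K).

Lemma lfun_eigenvector (U : {vspace V}) (f : 'End(V)) :
  (f @: U <= U)%VS -> U != 0%VS ->
  exists c u, [/\ u \in U, u != 0 & f u = c *: u].
Proof.
move=> fU U0; pose X := vbasis U.
have XU i : X`_i \in U.
  have [lt|ge] := ltnP i (size X); first exact/vbasis_mem/mem_nth.
  by rewrite nth_default // mem0v.
(* Row i holds the coordinates of the image of the i-th basis vector, so a left eigenvector of M is
   a coordinate vector. *)
pose M : 'M[K]_(\dim U) := \matrix_(i, j) coord X j (f X`_i).
have [|c /eigenvalueP[v vM v0]] := @eigenvalue_closed K _ M; first by rewrite lt0n dimv_eq0.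
exists c, (\sum_i v 0 i *: X`_i); split.
- by apply: memv_suml => i _; apply: memvZ; apply: XU.
- apply: contra v0 => /eqP s0; apply/eqP/rowP => i; rewrite mxE.
  by have /freeP/(_ _ s0 i) := basis_free (vbasisP U).
- rewrite linear_sum scaler_sumr /=.
  transitivity (\sum_j (v *m M) 0 j *: X`_j).
    under [RHS]eq_bigr do rewrite mxE scaler_suml.
    rewrite exchange_big; apply: eq_bigr => i _ /=.
    rewrite linearZ /= [f _ in LHS](coord_vbasis (subvP fU _ (memv_img f (XU i)))).
    by rewrite scaler_sumr; apply: eq_bigr => j _; rewrite !mxE scalerA.
  by apply: eq_bigr => j _; rewrite vM mxE scalerA.
Qed.
End Eigenvector.

Section Primitive.
Variables (K : numClosedFieldType) (p : nat) (A : flip_algebra K p).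
Implicit Types (u v w x : A) (s t : seq A) (P : A -> Prop) (a b e f : mult A).
Local Notation br := (@br K p A).
Local Notation form := (@form K p A).
Let p_gt0 : (0 < p)%N := arity_gt0 A.
Hypothesis A_simple : simple A.
Hypothesis br_neq0 : exists s, size s = p.+1 /\ br s <> 0.
Let annl0 := annl0 A_simple br_neq0.
Let annr0 := annr0 A_simple br_neq0.
Let mult_comm := mult_comm A_simple br_neq0.
Let semiprime := semiprime A_simple br_neq0.

Let rideal x := lspan (fun v => exists s, size s = p /\ v = br (x :: s)).

(* If x s (a x) were not a multiple of x, subtracting c x from it, for an
   eigenvalue c of the left multiplication by x s a on the right ideal of x, would
   give a nonzero element with a smaller right ideal. *)
Lemma minimal_rank : exists x, x <> 0 /\ forall s a, size s = p.-1 ->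
  exists c, br (x :: rcons s (ml a x)) = c *: x.
Proof.
pose Q k := `[< exists x (U : {vspace A}), [/\ x <> 0,
  forall v, v \in U <-> rideal x v & \dim U = k] >].
have exQ : exists k, Q k.
  have [x x0] : exists x, x <> 0 by case: br_neq0 => s [_ nz]; exists (br s).
  have [U HU] := subspace_vspace
    (lspan_subspace (fun v => exists s, size s = p /\ v = br (x :: s))).
  by exists (\dim U); apply/asboolP; exists x, U.
case: (ex_minnP exQ) => k /asboolP[x [U [x0 HU dU]]] mink.
exists x; split=> // s a Hs.
pose f v := br (x :: rcons s (ml a v)).
have Hxs : size (x :: s) = p by rewrite /=; lia.
have [b [bl _]] := word_mult Hxs.
have fE v : f v = ml (mulm b a) v by rewrite /= bl.
have [F FE] : exists F : 'End(A), F =1 f.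
  by apply: linear_lfun => c u v; rewrite !fE ml_lin.
have FU v : v \in U -> F v \in U.
  move=> /HU Hv; apply: (lspan_min (P := fun v => F v \in U) Hv).
    by split=> [|c u w]; rewrite ?linear0 ?mem0v // linearP => *; apply: memvD => //; apply: memvZ.
  move=> _ [t [Ht ->]]; rewrite FE /f; apply/HU; apply: lspan_gen.
  by exists (rcons s (ml a (br (x :: t)))); split; rewrite ?size_rcons //; lia.
have U0 : U != 0%VS.
  apply: contra_notN x0 => /eqP U0; apply: annl0 => t Ht; apply/eqP.
  by rewrite -memv0 -U0; apply/HU; apply: lspan_gen; exists t.
have [|c [u [uU u0 Fu]]] := lfun_eigenvector (f := F) _ U0.
  by apply/subvP => _ /memv_imgP[v vU ->]; apply: FU.
exists c; apply: contrapT => neq; pose y := f x - c *: x.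
have y0 : y <> 0 by move/eqP; rewrite subr_eq0 => /eqP.
have [U' HU'] := subspace_vspace
  (lspan_subspace (fun v => exists s, size s = p /\ v = br (y :: s))).
have [F' F'E] : exists F' : 'End(A), forall v, F' v = F v - c *: v.
  by exists (F - c *: \1)%VF => v; rewrite !lfun_simp.
have sub : (U' <= F' @: U)%VS.
  apply/subvP => v /HU' Hv; apply: (lspan_min (P := fun v => v \in (F' @: U)%VS) Hv).
    by split=> [|d w z]; rewrite ?mem0v // => *; apply: memvD => //; apply: memvZ.
  move=> _ [t [Ht ->]]; apply/memv_imgP; exists (br (x :: t)).
    by apply/HU; apply: lspan_gen; exists t.
  rewrite F'E FE (fE (br _)) ml_br // -fE /y.
  have := br_lin [::] t (- c) x (f x); rewrite /= scaleNr addrC => ->.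
  by rewrite scaleNr addrC.
have : (k <= \dim U')%N by apply: mink; apply/asboolP; exists y, U'.
have := dimvS sub; have := limg_ker_dim F' U; rewrite dU.
have : (0 < \dim (U :&: lker F'))%N.
  rewrite lt0n dimv_eq0; apply: contraNN u0 => /eqP E; rewrite -memv0 -E memv_cap uU.
  by rewrite memv_ker F'E Fu subrr eqxx.
lia.
Qed.

(** The second condition is e R_0 e = K e. The zero operator qualifies too; in the uses below e
    fixes a nonzero vector. *)
Definition prim e := (forall v, ml e (ml e v) = ml e v) /\
  forall b, exists c, forall v, ml e (ml b (ml e v)) = c *: ml e v.

Lemma mr_idem e : prim e -> forall v, mr e (mr e v) = mr e v.
Proof. by case=> H _; apply: (@eqm_mr _ _ _ (mulm e e) e). Qed.

Lemma prim_mr e : prim e -> forall b, exists c, 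
  (forall v, ml e (ml b (ml e v)) = c *: ml e v) /\
  (forall v, mr e (mr b (mr e v)) = c *: mr e v).
Proof.
move=> [_ H] b; have [c Hc] := H b; exists c; split=> //.
exact: (@eqm_mr _ _ _ (mulm e (mulm b e)) (scalem c e)).
Qed.

(** If x s a x = phi x with phi nonzero, put e = phi^-1 x s a and f = phi^-1 s a x. Then e b e
    contains x (s a b) x and f b f contains x (b s a) x, both multiples of x by minimality. *)
Lemma prim_pair : exists e f x x', [/\ prim e, prim f, ml e x = x & mr f x = x] /\
  [/\ ml f x' = x', mr e x' = x' & form x x' != 0].
Proof.
have [x [x0 Hx]] := minimal_rank.
have [s [a [Hs nz]]] : exists s a, size s = p.-1 /\ br (x :: rcons s (ml a x)) <> 0.
  apply: contrapT => H; apply: x0; apply: semiprime => s a Hs.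
  by apply: contrapT => nz; apply: H; exists s, a.
have [phi Hphi] := Hx s a Hs.
have phi0 : phi != 0 by apply: contra_notN nz => /eqP E; rewrite Hphi E scale0r.
have Hxs : size (x :: s) = p by rewrite /=; lia.
have Hsx : size (rcons s (ml a x)) = p by rewrite size_rcons; lia.
have [L1 [L1l _]] := word_mult Hxs.
have [L2 [L2l L2r]] := word_mult Hsx.
pose e := scalem phi^-1 (mulm L1 a); pose f := scalem phi^-1 L2.
have eE v : ml e v = phi^-1 *: br (x :: rcons s (ml a v)) by rewrite /= L1l.
have exE : ml e x = x by rewrite eE Hphi scalerA mulVf // scale1r.
have xfE : mr f x = x by rewrite /= L2r Hphi scalerA mulVf // scale1r.
have ebe b c : br (x :: rcons s (ml (mulm a b) x)) = c *: x ->
    forall v, ml e (ml b (ml e v)) = (c * phi^-1) *: ml e v.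
  move=> Hc v; rewrite (eE v) mlZ !mlZ eE [c * _]mulrC scalerA -!scalerA; congr (_ *: _).
  rewrite -[ml a _]/(ml (mulm a b) _) ml_br ?size_rcons; last by lia.
  set y := ml (mulm a b) x in Hc *.
  have -> : br (x :: rcons s (br (y :: rcons s (ml a v)))) =
      br (br (x :: rcons s y) :: rcons s (ml a v)).
    rewrite -!cats1; apply: (@br_eq _ _ _ (x :: s) _ [::] [::]);
      rewrite /= ?size_cat /= ?cats0; try lia.
    by cat_right.
  by rewrite Hc (brZ [::]) !scalerA mulrC.
have Pe : prim e.
  split=> [v|b]; last first.
    by have [c Hc] := Hx s (mulm a b) Hs; exists (c * phi^-1); apply: ebe Hc.
  by have := ebe (idm A) phi Hphi v; rewrite mulfV // scale1r.
have fbf b c : br (mr b x :: rcons s (ml a x)) = c *: x ->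
    forall v, ml f (ml b (ml f v)) = (c * phi^-1) *: ml f v.
  move=> Hc v; rewrite {2}/f /= !mlZ [c * _]mulrC scalerA -!scalerA; congr (_ *: _).
  rewrite !L2l; set X := br (rcons (rcons s _) v).
  have -> : br (rcons (rcons s (ml a x)) (ml b X)) = br (s ++ mr b (ml a x) :: X :: [::]).
    by rewrite -!cats1 -catA /= mr_ml_move //=; lia.
  rewrite -mult_comm; set y := mr b x in Hc *.
  have -> : br (s ++ [:: ml a y; X]) = br (s ++ br (ml a y :: rcons s (ml a x)) :: [:: v]).
    rewrite /X -!cats1 -[s ++ [:: ml a y; _]]/(s ++ ([:: ml a y] ++ [:: _])) catA.
    apply: (@br_eq _ _ _ (s ++ [:: ml a y]) _ [::]);
      rewrite /= ?size_cat /= ?size_cat /= ?cats0; try lia.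
    by cat_right.
  rewrite -ml_br ?size_rcons; last by lia.
  by rewrite Hc mlZ brZ /X -!cats1 -catA /= !scalerA mulrC.
have Pf : prim f.
  split=> [v|b]; first by have := fbf (idm A) phi Hphi v; rewrite mulfV // scale1r.
  (* Here b stands in front of s. It is absorbed by the first letter of s or, if s is empty (p = 1),
     by a. *)
  have [c Hc] : exists c, br (mr b x :: rcons s (ml a x)) = c *: x.
    case: s Hs {nz Hphi Hxs Hsx L1l L2l L2r e f eE exE xfE ebe Pe fbf} => [|y s] /= Hs.
      have [c Hc] := Hx [::] (mulm b a) Hs; exists c; rewrite -Hc.
      by apply: (@mr_ml_move _ _ _ b [::] x (ml a x) [::]) => /=; lia.
    have [c Hc] := Hx (ml b y :: s) a Hs; exists c; rewrite -Hc.
    by apply: (@mr_ml_move _ _ _ b [::] x y (rcons s (ml a x))); rewrite /= size_rcons; lia.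
  by exists (c * phi^-1); apply: fbf Hc.
have [y xy] : exists y, form x y != 0.
  apply: contrapT => H; apply: x0; apply: form_nondeg => w; apply: contrapT => nz'.
  by apply: H; exists w; apply/eqP.
(* x' = f y e pairs with x as y does, because x = e x f and the two actions are adjoint. *)
exists e, f, x, (ml f (mr e y)); split=> //; split.
- by case: Pf.
- by rewrite -mult_comm mr_idem.
- by rewrite -mult_adj xfE formC mult_adj exE formC.
Qed.


Lemma brZ_map c r s t :
  br (r ++ map ( *:%R c) s ++ t) = c ^+ size s *: br (r ++ s ++ t).
Proof.
elim: s r => [|v s IH] r /=; first by rewrite scale1r.
by rewrite brZ -cat_rcons IH cat_rcons scalerA exprS.
Qed.

(* A f = R_0 z and e A = z R_0: multiplication by z identifies the simple modules
   attached to e and f, up to a degree shift. *)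
Lemma prim_shift e f z : prim e -> prim f -> z <> 0 -> ml e z = z -> mr f z = z ->
  (forall u, exists b, mr f u = ml b z) /\ (forall u, exists b, ml e u = mr b z).
Proof.
move=> Pe Pf z0 ez zf.
have [s [a [Hs nz]]] : exists s a, size s = p.-1 /\ br (z :: rcons s (ml a z)) <> 0.
  apply: contrapT => H; apply: z0; apply: semiprime => s a Hs.
  by apply: contrapT => nz; apply: H; exists s, a.
have Hzs : size (z :: s) = p by rewrite /=; lia.
have Hsz : size (rcons s (ml a z)) = p by rewrite size_rcons; lia.
have [T [Tl _]] := word_mult Hzs; have [S [_ Sr]] := word_mult Hsz.
have [c Hc] : exists c, br (z :: rcons s (ml a z)) = c *: z.
  case: Pe => _ /(_ (mulm T a)) [c Hc]; exists c.
  by have := Hc z; rewrite /= Tl !ez /= ml_br ?ez.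
have c0 : c != 0 by apply: contra_notN nz => /eqP E; rewrite Hc E scale0r.
have eq1 (d : K) : z = d *: z -> d = 1.
  move=> /eqP; rewrite -subr_eq0 -[X in X - _]scale1r -scalerBl scaler_eq0 subr_eq0.
  by case/orP => /eqP // z0'; case: z0.
split=> u.
  (* S is right multiplication by s a z, and c^-1 S fixes z as f does. Hence d = 1 and u f = c^-1 (u
     f s a) z. *)
  have [d [_ Hd]] := prim_mr Pf (scalem c^-1 S).
  have d1 : d = 1 by apply: eq1; have := Hd z; rewrite /= Sr !zf Hc scalerA mulVf // scale1r zf.
  have Hus : size (mr f u :: s) = p by rewrite /=; lia.
  have [B [Bl _]] := word_mult Hus.
  exists (scalem c^-1 (mulm B a)); rewrite /= Bl.
  have := Hd u; rewrite d1 scale1r /= => E; rewrite -{1}E mrZ Sr -!rcons_cons; congr (_ *: _).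
  by rewrite (mr_br _ _ Hus) -mult_comm zf.
have [d [Hd _]] := prim_mr Pe (scalem c^-1 (mulm T a)).
have d1 : d = 1.
  by apply: eq1; have := Hd z; rewrite /= Tl !ez Hc scalerA mulVf // scale1r ez.
have Hus : size (rcons s (ml a (ml e u))) = p by rewrite size_rcons; lia.
have [B [_ Br]] := word_mult Hus.
exists (scalem c^-1 B); rewrite /= Br.
have := Hd u; rewrite d1 scale1r /= => E; rewrite -{1}E mlZ Tl; congr (_ *: _).
by rewrite rcons_cons ml_br ?ez.
Qed.

(** * Alternating words *)

Section AlternatingWords.
Variables (I : Type) (tau : I -> I) (eps : I -> mult A) (z : I -> A).
Hypotheses (tauK : involutive tau) (eps_prim : forall k, prim (eps k))
  (z_neq0 : forall k, z k <> 0) (eps_z : forall k, ml (eps k) (z k) = z k)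
  (z_eps : forall k, mr (eps (tau k)) (z k) = z k).

(** With I = [unit] and tau the identity this is a power of z; with I = [bool] and tau = [negb] it
    is x x' x ... . Both types are treated at once in this way. *)
Definition alt_word k m := map z (traject tau k m).

Lemma size_alt_word k m : size (alt_word k m) = m.
Proof. by rewrite size_map size_traject. Qed.

Lemma alt_wordS k m : alt_word k m.+1 = z k :: alt_word (tau k) m.
Proof. by []. Qed.

Lemma alt_wordSr k m : alt_word k m.+1 = rcons (alt_word k m) (z (iter m tau k)).
Proof. by rewrite /alt_word trajectSr map_rcons. Qed.

Let shift k u : exists b, mr (eps k) u = ml b (z (tau k)).
Proof.
have := @prim_shift (eps (tau k)) (eps k) (z (tau k)) (eps_prim _) (eps_prim _).
by case=> [||| H _] //; have := z_eps (tau k); rewrite tauK.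
Qed.

(* The letters of t are moved to the front one by one: u (eps k) = b (z (tau k)). *)
Lemma alt_word_absorb k m t : (m < p)%N -> size t = p ->
  exists t' b, size t' = (p - m.+1)%N /\ forall v,
    br (rcons t (ml (eps k) v)) =
    br (t' ++ ml b (z (iter m.+1 tau k)) :: rcons (alt_word (iter m tau k) m) v).
Proof.
elim: m t => [|m IH] t Hm Ht.
  case/lastP: t Ht => [|t w]; first by move=> /= Ht; rewrite -[X in (_ < X)%N]Ht in Hm.
  rewrite size_rcons => Ht; have [b Hb] := shift k w.
  exists t, b; split=> [|v]; first by lia.
  rewrite -!cats1 -catA /= -Hb; symmetry.
  by apply: (@mr_ml_move _ _ _ _ t w v [::]) => /=; lia.
have [t' [b [Ht' H]]] := IH t (ltnW Hm) Ht.
case/lastP: t' Ht' H => [|t' w]; first by rewrite /=; lia.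
rewrite size_rcons => Ht' H.
set h := iter m.+1 tau k in H *.
have [b' Hb'] := shift h (mr b w).
exists t', b'; split=> [|v]; first by lia.
rewrite H cat_rcons -mr_ml_move; last by rewrite size_rcons size_alt_word; lia.
rewrite -[z h]eps_z -mr_ml_move; last by rewrite size_rcons size_alt_word; lia.
by rewrite Hb' iterS -/h [alt_word h _]/alt_word /= tauK.
Qed.

(** Absorbing all p letters of an arbitrary t turns t z_k into a multiplier applied to the
    alternating word. If that word acted as 0, every t z_k would vanish, against [annr0]. *)
Lemma alt_word_neq0 k :
  exists v, br (rcons (alt_word (iter p tau k) p) v) <> 0.
Proof.
apply: contrapT => H.
have H0 v : br (rcons (alt_word (iter p tau k) p) v) = 0.
  by apply: contrapT => nz; apply: H; exists v.
case: (@z_neq0 k); rewrite -eps_z; apply: annr0 => t Ht.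
have Hp : (p.-1 < p)%N by rewrite prednK.
have [t' [b [Ht' ->]]] := @alt_word_absorb k p.-1 t Hp Ht.
have -> : t' = [::] by apply: size0nil; lia.
have Ep : p = p.-1.+1 by rewrite prednK.
rewrite cat0s -ml_br; last by rewrite size_rcons size_alt_word prednK.
set q := p.-1 in Ep *.
suff -> : br (z (iter q.+1 tau k) :: rcons (alt_word (iter q tau k) q) (z k)) = 0 by rewrite ml0.
have := alt_wordS (iter q.+1 tau k) q; rewrite -Ep => Ew.
have Ei : iter p tau k = tau (iter q tau k) by rewrite Ep.
by have := H0 (z k); rewrite Ew Ei tauK.
Qed.

Hypothesis tau_p : forall k, iter p tau k = k.
Hypothesis tau_trans : forall k k', k' = k \/ k' = tau k.

(** A word of p letters that returns to its start lies in e R_0 e = K e. *)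
Lemma alt_word_scalar (k0 : I) : exists c : K, c != 0 /\
  forall k v, br (rcons (alt_word k p) v) = c *: ml (eps k) v.
Proof.
have scal k : exists c : K, c != 0 /\
    forall v, br (rcons (alt_word k p) v) = c *: ml (eps k) v.
  have Hw : size (alt_word k p) = p := size_alt_word _ _.
  have [T [Tl Tr]] := word_mult Hw.
  have [c Hc] := (eps_prim k).2 T.
  have E v : br (rcons (alt_word k p) v) = c *: ml (eps k) v.
    rewrite -Hc Tl.
    have Ep : p = p.-1.+1 by rewrite prednK.
    have -> : br (rcons (alt_word k p) (ml (eps k) v)) = br (rcons (alt_word k p) v).
      have := alt_wordSr k p.-1; rewrite -Ep => ->.
      rewrite -!cats1 -!catA /= -mr_ml_move; last by rewrite size_alt_word /=; lia.
      set h := iter _ _ _; have := z_eps h.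
      have -> : tau h = k by rewrite /h -iterS -Ep tau_p.
      by move=> ->.
    have := alt_wordS k p.-1; rewrite -Ep => ->.
    by rewrite rcons_cons ml_br ?eps_z // size_rcons size_alt_word; lia.
  exists c; split=> //; apply/eqP => c0.
  by have [v] := alt_word_neq0 k; rewrite tau_p E c0 scale0r.
have [c [c0 Hc]] := scal k0; exists c; split=> // k.
have [->//|->] := tau_trans k0 k.
have [d [d0 Hd]] := scal (tau k0) => v; rewrite Hd; congr (_ *: _).
have Hw : size (alt_word k0 p) = p := size_alt_word _ _.
have [T [Tl Tr]] := word_mult Hw.
have TE : eqm T (scalem c (eps k0)) by move=> w; rewrite Tl Hc.
(* The two scalars agree: the word of p + 1 letters is c z when its last p letters are grouped and d
   z when its first p letters are. *)
have : br (alt_word (tau k0) p.+1) = c *: z (tau k0).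
  rewrite alt_wordS tauK -Tr (eqm_mr TE) /=.
  by have := z_eps (tau k0); rewrite tauK => ->.
rewrite alt_wordSr tau_p Hd eps_z => /eqP.
rewrite -subr_eq0 -scalerBl scaler_eq0 subr_eq0 => /orP[/eqP //|/eqP z0].
by case: (@z_neq0 (tau k0)).
Qed.

End AlternatingWords.

(** The pairing of e R_0 with R_0 e into e R_0 e = K e is nondegenerate on both sides by
    [semiprime]. The elements of R_0 e are seen through their action on x, those of e R_0 through
    theirs on x'. *)
Lemma dual_bases e x x' : prim e -> x <> 0 -> ml e x = x -> mr e x' = x' ->
  exists (M : nat) (a b : 'I_M -> mult A), [/\ (0 < M)%N,
    forall i v, ml (a i) (ml e v) = ml (a i) v,
    forall j v, ml e (ml (b j) v) = ml (b j) v &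
    forall i j v, ml (b j) (ml (a i) v) = (i == j)%:R *: ml e v] /\
  [/\ forall c, exists k, ml c x = \sum_i k i *: ml (a i) x
    & forall d, exists k, mr d x' = \sum_j k j *: mr (b j) x'].
Proof.
move=> [ee eKe] x0 ex x'e; have Pe : prim e by [].
(* U = R_0 x stands for R_0 e: it lies in A, so it has a finite basis. *)
have [U HU] : exists U : {vspace A}, forall v, v \in U <-> exists c, v = ml c x.
  apply: subspace_vspace; split; first by exists (scalem 0 e); rewrite /= scale0r.
  by move=> c u v [d ->] [d' ->]; exists (addm (scalem c d) d').
pose X := vbasis U; pose M : nat := \dim U.
have XU (i : 'I_M) : X`_i \in U.
  by apply/vbasis_mem/mem_nth; rewrite size_tuple.
have [a' Ha'] : {a' : 'I_M -> mult A & forall i : 'I_M, X`_i = ml (a' i) x}.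
  by apply: (choice (P := fun (i : 'I_M) c => X`_i = ml c x)) => i; apply/HU.
pose a i := mulm (a' i) e.
have Ha (i : 'I_M) : X`_i = ml (a i) x by rewrite /= ex.
have span c : exists k : 'I_M -> K, ml c x = \sum_i k i *: ml (a i) x.
  exists (fun i => coord X i (ml c x)).
  rewrite {1}[ml c x](@coord_vbasis _ _ _ U); last by apply/HU; exists c.
  by apply: eq_bigr => i _; rewrite Ha.
have [R HR] : exists R : {vspace 'rV[K]_M}, forall r, r \in R <->
    exists b, forall i : 'I_M, ml e (ml b X`_i) = r 0 i *: x.
  apply: subspace_vspace; split.
    by exists (scalem 0 e) => i; rewrite /= !scale0r ml0 mxE scale0r.
  move=> c r r' [b Hb] [b' Hb']; exists (addm (scalem c b) b') => i.
  by rewrite /= ml_lin Hb Hb' !mxE scalerDl scalerA.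
(* A functional that vanishes on R but not at r has some coordinates w_i. Then e b kills y, the sum
   of the w_i X_i, for every b, so y = 0 by [semiprime], and all w_i vanish. *)
have Rfull r : r \in R.
  apply: contrapT => /negP /separating_functional[f [f_lin fR fr]].
  pose w (i : 'I_M) : K := f (delta_mx 0 i); pose y := \sum_i w i *: X`_i.
  have f0 : f 0 = 0 by rewrite fR ?mem0v.
  have fE r' : f r' = \sum_i r' 0 i * w i.
    rewrite {1}(row_sum_delta r') (big_morph f (id1 := 0) (op1 := +%R)) //.
      by apply: eq_bigr => i _; rewrite -[_ *: _]addr0 f_lin f0 addr0.
    by move=> u v; rewrite -[u]scale1r f_lin mul1r scale1r.
  have eby b : ml e (ml b y) = 0.
    have [k Hk] : {k : 'I_M -> K & forall i : 'I_M, ml e (ml b X`_i) = k i *: x}.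
      apply: (choice (P := fun (i : 'I_M) k => ml e (ml b X`_i) = k *: x)) => i.
      have [c Hc] := eKe (mulm b (a' i)); exists c.
      by have := Hc x; rewrite /= ex Ha /= ex.
    have : \row_i k i \in R by apply/HR; exists b => i; rewrite mxE.
    move=> /fR; rewrite fE => E.
    rewrite /y -[ml e _]/(ml (mulm e b) _) (big_morph (ml (mulm e b)) (id1 := 0) (op1 := +%R)).
    - transitivity ((\sum_i (\row_i k i) 0 i * w i) *: x); last by rewrite E scale0r.
      rewrite scaler_suml; apply: eq_bigr => i _.
      by rewrite mlZ /= Hk scalerA mxE mulrC.
    - by move=> u v; rewrite -[u]scale1r ml_lin !scale1r.
    - exact: ml0.
  have y0 : y = 0.
    have [c Hc] : exists c, y = ml c x.
      apply/HU; apply: memv_suml => i _; apply: memvZ; exact: XU.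
    apply: semiprime => s al Hs.
    have Hxs : size (x :: s) = p by rewrite /=; lia.
    have [T [Tl _]] := word_mult Hxs.
    rewrite {1}Hc -ml_br; last by rewrite size_rcons; lia.
    have -> : br (x :: rcons s (ml al y)) = ml e (ml (mulm T al) y).
      by rewrite /= Tl /= ml_br ?ex // size_rcons; lia.
    by rewrite eby ml0.
  have /freeP/(_ w y0) w0 := basis_free (vbasisP U).
  by apply: fr; rewrite fE big1 // => i _; rewrite w0 mulr0.
have [b' Hb'] : {b' : 'I_M -> mult A & forall j i : 'I_M,
    ml e (ml (b' j) X`_i) = (i == j)%:R *: x}.
  apply: (choice (P := fun (j : 'I_M) b => forall i : 'I_M, ml e (ml b X`_i) = (i == j)%:R *: x)) => j.
  have /HR[b Hb] := Rfull (delta_mx 0 j); exists b => i.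
  by rewrite Hb !mxE eqxx /= eq_sym.
pose b j := mulm e (b' j).
have scal_inj c d : c *: x = d *: x -> c = d.
  move/eqP; rewrite -subr_eq0 -scalerBl scaler_eq0 subr_eq0.
  by case/orP => /eqP // /x0.
exists M, a, b; split.
  split.
  - rewrite lt0n dimv_eq0; apply/negP => /eqP U0; apply: x0; apply/eqP.
    by rewrite -memv0 -U0; apply/HU; exists (idm A).
  - by move=> i v; rewrite /= ee.
  - by move=> j v; rewrite /= ee.
  - move=> i j v; have [c Hc] := eKe (mulm (b' j) (a' i)).
    rewrite /= (Hc v); congr (_ *: _); apply: scal_inj.
    by have := Hc x; rewrite /= ex -Ha' Hb' => <-.
split=> // d.
have [k Hk] : {k : 'I_M -> K & forall j : 'I_M, ml e (ml d X`_j) = k j *: x}.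
  apply: (choice (P := fun (i : 'I_M) k => ml e (ml d X`_i) = k *: x)) => i.
  have [c Hc] := eKe (mulm d (a' i)); exists c.
  by have := Hc x; rewrite /= ex Ha /= ex.
exists k.
(* D is the part of e d that kills U = R_0 x. For every C = s (al x'), D C is a scalar times e which
   vanishes at x, so x' D is null and [semiprime] removes it. *)
pose D := addm (mulm e d) (scalem (-1) (lincm xpredT k b)).
have DX (i : 'I_M) : ml D X`_i = 0.
  rewrite /= Hk (bigD1 i) //= big1 ?addr0 => [|j ji].
    by rewrite Hb' eqxx scale1r scaleN1r subrr.
  by rewrite Hb' eq_sym (negbTE ji) scale0r scaler0.
have eD v : ml e (ml D v) = ml D v.
  rewrite /= -[ml e (ml d v)]scale1r ml_lin ee mlZ scale1r; congr (_ + _ *: _).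
  rewrite (big_morph (ml e) (id1 := 0) (op1 := +%R)).
  - by apply: eq_bigr => i _; rewrite mlZ ee.
  - by move=> u w; rewrite -[u]scale1r ml_lin !scale1r.
  - exact: ml0.
have DU v : v \in U -> ml D v = 0.
  move=> /coord_vbasis ->; rewrite (big_morph (ml D) (id1 := 0) (op1 := +%R)).
  - by rewrite big1 // => i _; rewrite mlZ DX scaler0.
  - by move=> u w; rewrite -[u]scale1r ml_lin !scale1r.
  - exact: ml0.
suff : mr D x' = 0.
  by rewrite /= x'e scaleN1r => /eqP; rewrite subr_eq0 => /eqP.
apply: semiprime => s al Hs; set y := ml al x'.
have Hsy : size (rcons s y) = p by rewrite size_rcons; lia.
have [C [Cl Cr]] := word_mult Hsy.
have ye : mr e y = y by rewrite -mult_comm x'e.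
have Ce v : ml C (ml e v) = ml C v.
  rewrite !Cl -!cats1 -!catA /= -mr_ml_move ?ye //=; lia.
have DC : eqm (mulm D C) (scalem 0 e).
  move=> v; have [c Hc] := eKe (mulm D C).
  have E w : ml D (ml C w) = c *: ml e w.
    by rewrite -Hc -[ml (mulm D C) _]/(ml D (ml C (ml e w))) Ce eD.
  rewrite -[LHS]/(ml D (ml C v)) E /=; congr (_ *: _); apply: scal_inj.
  by rewrite -[in LHS]ex -E scale0r DU //; apply/HU; exists C.
have -> : br (mr D x' :: rcons s (ml al (mr D x'))) = mr D (mr (mulm D C) x').
  rewrite mult_comm -/y -rcons_cons -mr_br; last exact: etrans (esym (size_rcons s y)) Hsy.
  by rewrite /= Cr.
by rewrite (eqm_mr DC) -[mr (scalem 0 e) _]/(0 *: mr e x') scale0r mr0.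
Qed.

(** * Matrix units *)

Section MatrixUnits.
Variables (I : eqType) (tau : I -> I) (eps : I -> mult A) (z : I -> A) (c : K).
Hypotheses (tauK : involutive tau) (tau_p : forall k, iter p tau k = k)
  (z_neq0 : forall k, z k <> 0) (eps_z : forall k, ml (eps k) (z k) = z k)
  (br_z : forall k, br (alt_word tau z k p.+1) = z k)
  (form_z : forall k, form (z k) (z (tau k)) = c) (c_neq0 : c != 0).
Variables (k0 : I) (m : nat) (kap : 'I_m -> I) (a b : 'I_m -> mult A).
Hypotheses
  (b_a : forall i j v, ml (b j) (ml (a i) v) = (i == j)%:R *: ml (eps (kap i)) v)
  (span_a : forall k d, exists e : 'I_m -> K,
     ml d (z k) = \sum_(i | kap i == k) e i *: ml (a i) (z k))
  (span_b : forall k d, exists e : 'I_m -> K,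
     mr d (z k) = \sum_(j | kap j == tau k) e j *: mr (b j) (z k)).
Variables (T : finType) (ij : T -> 'I_m * 'I_m).
Hypotheses (ij_inj : injective ij)
  (ij_kind : forall t : T, kap (ij t).2 = tau (kap (ij t).1))
  (ij_surj : forall i j, kap j = tau (kap i) -> exists t : T, ij t = (i, j)).

(** [kap] tells to which idempotent the index belongs. The product a_i z b_j fits together when
    [kap j] = [tau (kap i)], which is [ij_kind] for the pairs in use. *)
Let F (i j : 'I_m) : A := ml (a i) (mr (b j) (z (kap i))).
Definition matrix_unit (t : T) : A := F (ij t).1 (ij t).2.
Local Notation E := matrix_unit.
Let R := [rel x y : T | (ij x).2 == (ij y).1].

Lemma form_unit i j k l : kap j = tau (kap i) ->
  form (F i j) (F k l) = c * (j == k)%:R * (l == i)%:R.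
Proof.
move=> Hj; rewrite /F mult_comm mult_adj b_a formZr mult_comm eps_z formC mult_adj.
rewrite b_a formZr eps_z [i == l]eq_sym [k == j]eq_sym.
case: eqP => [<-|_]; last by rewrite mulr0 !mul0r.
case: eqP => [_|_]; last by rewrite mul0r !mulr0.
by rewrite Hj formC form_z !mulr1 !mul1r.
Qed.

Lemma path_kinds (t : T) (r : seq T) : path R t r ->
  map (fun x : T => kap (ij x).1) (t :: r) = traject tau (kap (ij t).1) (size r).+1.
Proof.
elim: r t => [//|u r IH] t /= /andP[/eqP Etu pr].
by congr (_ :: _); rewrite -ij_kind Etu -[RHS]IH.
Qed.

Let path_from (j : 'I_m) (r : seq T) : bool :=
  if r is t :: r' then (j == (ij t).1) && path R t r' else true.

(** The b of one letter meets the a of the next in a Kronecker delta times an idempotent that the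
    next z absorbs. The collapse runs from left to right and only the last b survives. *)
Lemma br_unit_path s (j : 'I_m) (y : A) (r : seq T) : (size s + size r = p)%N ->
  br (s ++ mr (b j) y :: map E r) =
  (path_from j r)%:R *:
  mr (b (last j (map (fun x : T => (ij x).2) r)))
     (br (s ++ y :: map (fun x : T => z (kap (ij x).1)) r)).
Proof.
elim: r s j y => [|t r IH] s j y Hs /=.
  by rewrite scale1r !cats1 mr_br //; move: Hs => /=; lia.
move: Hs => /= Hs.
rewrite mr_ml_move; last by rewrite size_map; lia.
rewrite b_a mult_comm eps_z eq_sym; case: eqP => [_|_]; last first.
  by rewrite !scale0r -cat_rcons br0.
rewrite scale1r -cat_rcons IH ?size_rcons; last by lia.
by case: r {IH Hs} => [|u r] /=; rewrite cat_rcons.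
Qed.

(** Along a path the remaining letters form the alternating word of p + 1 letters, which is z by
    [br_z]. *)
Lemma br_units (t : T) (r : seq T) : size r = p ->
  br (map E (t :: r)) = (path R t r)%:R *: F (ij t).1 (ij (last t r)).2.
Proof.
move=> Hr; rewrite /= /E /F -ml_br ?size_map // -[_ :: _]cat0s br_unit_path //.
rewrite cat0s -(last_map (fun x : T => (ij x).2)) mlZ.
have -> : path_from (ij t).2 r = path R t r by case: r {Hr}.
case: (boolP (path R t r)) => [pr|_]; last by rewrite !scale0r.
congr (_ *: ml _ (mr _ _)); rewrite -[RHS]br_z; congr br.
by have := path_kinds pr; rewrite Hr /alt_word => <-; rewrite /= -map_comp.
Qed.

Lemma form_br_units (t u : T) (r : seq T) : size r = p ->
  form (br (map E (t :: r))) (E u) = c * (cycle R (t :: rcons r u))%:R.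
Proof.
move=> Hr; rewrite br_units // formZl /= rcons_path rcons_path last_rcons /=.
case: (boolP (path R t r)) => [pr|_]; last by rewrite mul0r mulr0.
rewrite form_unit; first by rewrite mul1r -mulrA -natrM mulnb.
rewrite ij_kind; congr tau.
have := congr1 (last k0) (path_kinds pr); rewrite /= last_map => ->.
by rewrite last_traject Hr tau_p.
Qed.

(** The elements d z_k e span a nonzero ideal, hence A. To see the ideal property, z_k is replaced
    by the alternating word of p + 1 letters: among the resulting 2p + 1 letters the middle one is
    again some z, and the p letters on either side are multipliers. *)
Lemma units_span v : lspan (fun u => exists t : T, u = E t) v.
Proof.
pose S u := exists (k : I) d e, u = ml d (mr e (z k)).
suff : lspan S v.
  move=> Sv; apply: lspan_min Sv (lspan_subspace _) _.
  move=> _ [k [d [e ->]]]; rewrite mult_comm.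
  have [x ->] := span_a k d; have [y Hy] := span_b k e.
  rewrite (big_morph (mr e) (id1 := 0) (op1 := +%R)); last exact: mr0.
    apply: subspace_sum => [|i /eqP Hi]; first exact: lspan_subspace.
    rewrite mrZ -mult_comm Hy (big_morph (ml (a i)) (id1 := 0) (op1 := +%R)); last exact: ml0.
      apply: subspaceZ (lspan_subspace _) _.
      apply: subspace_sum => [|j /eqP Hj]; first exact: lspan_subspace.
      rewrite mlZ; apply: subspaceZ (lspan_subspace _) _; apply: lspan_gen.
      by have [|t Et] := @ij_surj i j; [rewrite Hi|exists t; rewrite /E Et /F Hi].
    by move=> u w; rewrite -[u]scale1r ml_lin !scale1r.
  by move=> u w; rewrite -[u]scale1r mr_lin !scale1r.
apply: A_simple; last first.
  by exists (z k0); split=> //; apply: lspan_gen; exists k0, (idm A), (idm A).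
split=> [|s1 u s2 Hs Su]; first exact: lspan_subspace.
apply: (lspan_min (P := fun u => lspan S (br (s1 ++ u :: s2))) Su).
  by apply: subspace_br; apply: lspan_subspace.
have regroup (w r1 r2 : seq A) : size w = p.+1 -> (size r1 + size r2 = p)%N ->
    br (r1 ++ br w :: r2) = br ((r1 ++ take (size r2) w) ++
      [:: br (nth 0 w (size r2) :: drop (size r2).+1 w ++ r2)]).
  move=> Hw Hr; have lt : (size r2 < size w)%N by lia.
  apply: br_eq; rewrite /= ?size_cat ?size_drop ?size_takel ?Hw; try lia.
  rewrite cats0 -[in LHS](cat_take_drop (size r2) w) (drop_nth 0) //.
  by cat_right.
have Sz (r1 r2 : seq A) k : (size r1 + size r2 = p)%N ->
    exists (k' : I) (d e : mult A), br (r1 ++ z k :: r2) = ml d (mr e (z k')).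
  move=> Hr; set w := alt_word tau z k p.+1.
  have Hw : size w = p.+1 by rewrite size_map size_traject.
  have Er : (size r2 < p.+1)%N by lia.
  have [d [Hd _]] : exists d : mult A, (forall v, ml d v = br (rcons (r1 ++ take (size r2) w) v))
      /\ (forall v, mr d v = br (v :: r1 ++ take (size r2) w)).
    by apply: word_mult; rewrite size_cat size_takel; lia.
  have [e [_ He]] : exists e : mult A, (forall v, ml e v = br (rcons (drop (size r2).+1 w ++ r2) v))
      /\ (forall v, mr e v = br (v :: drop (size r2).+1 w ++ r2)).
    by apply: word_mult; rewrite size_cat size_drop; lia.
  exists (iter (size r2) tau k), d, e; rewrite Hd He -{1}[z k]br_z -/w -cats1.
  have <- : nth 0 w (size r2) = z (iter (size r2) tau k).
    by rewrite (nth_map k) ?size_traject // nth_traject.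
  exact: regroup.
move=> _ [k [d [e ->]]].
(* the multipliers d and e are absorbed by the neighbours, or come out in front *)
have [r1 [d' [Hr1 Ed]]] : exists (r1 : seq A) (d' : mult A), size r1 = size s1 /\
    forall y : A, br (s1 ++ ml d y :: s2) = ml d' (br (r1 ++ y :: s2)).
  case/lastP: s1 Hs => [|s1 x] Hs.
    by exists [::], d; split=> // y; rewrite /= ml_br.
  exists (rcons s1 (mr d x)), (idm A); rewrite !size_rcons; split=> // y.
  by rewrite !cat_rcons /= mr_ml_move //; move: Hs; rewrite size_rcons; lia.
rewrite Ed.
have [r2 [e' [Hr2 Ee]]] : exists (r2 : seq A) (e' : mult A), size r2 = size s2 /\
    forall y : A, br (r1 ++ mr e y :: s2) = mr e' (br (r1 ++ y :: r2)).
  case: s2 Hs {Ed} => [|x s2] /= Hs.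
    by exists [::], e; split=> // y; rewrite !cats1 mr_br //; lia.
  exists (ml e x :: s2), (idm A); split=> // y.
  by rewrite mr_ml_move //; lia.
rewrite Ee; have [|k' [d2 [e2 ->]]] := Sz r1 r2 k; first by rewrite Hr1 Hr2.
apply: lspan_gen; exists k', (mulm d' d2), (mulm e2 e').
by rewrite /= -[mr e' (ml d2 _)]mult_comm.
Qed.

(** The dual of a unit with respect to the form is c^-1 times the unit of the transposed pair. *)
Lemma units_tensor v w :
  \sum_(s : T) \sum_(t : T) c^-1 * ((ij s).2 == (ij t).1)%:R * ((ij t).2 == (ij s).1)%:R *
    (form (E s) v * form (E t) w) = form v w.
Proof.
pose Q v := \sum_(s : T) \sum_(t : T)
    c^-1 * ((ij s).2 == (ij t).1)%:R * ((ij t).2 == (ij s).1)%:R * (form (E s) v * form (E t) w) = form v w.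
rewrite -/(Q v); apply: (lspan_min (P := Q) (units_span v)).
  split=> [|d x y Hx Hy]; rewrite /Q.
    by rewrite form0l !big1 // => s _; rewrite big1 // => t _; rewrite form0r mul0r mulr0.
  rewrite form_lin -Hx -Hy mulr_sumr -big_split; apply: eq_bigr => s _ /=.
  rewrite mulr_sumr -big_split; apply: eq_bigr => t _ /=.
  by rewrite form_linr; ring.
move=> _ [r ->]; rewrite /Q {v Q}.
have [r' Er'] : exists r' : T, ij r' = ((ij r).2, (ij r).1).
  by apply: ij_surj; rewrite ij_kind tauK.
rewrite (bigD1 r') //= (bigD1 r) //= Er' !eqxx !mulr1 form_unit ?Er' ?ij_kind ?tauK //=.
rewrite !eqxx !mulr1 mulrA mulVf // mul1r !big1 ?addr0 //.
- move=> s sr; rewrite big1 // => t _; rewrite form_unit ?ij_kind //.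
  case: ((ij s).2 =P (ij r).1) => E1; last by rewrite !(mulr0, mul0r).
  case: ((ij r).2 =P (ij s).1) => E2; last by rewrite !(mulr0, mul0r).
  by case/eqP: sr; apply: ij_inj; rewrite Er' E2 -E1 -surjective_pairing.
- move=> t tr; case: eqP => E1; last by rewrite !(mulr0, mul0r).
  case: eqP => E2; last by rewrite !(mulr0, mul0r).
  by case/eqP: tr; apply: ij_inj; rewrite [LHS]surjective_pairing -E1 E2; case: (ij r).
Qed.

End MatrixUnits.

(* The family E is a basis of A in which A has the weights
   loop_weights ij c; the first condition says that the inverse of the Gram
   matrix of E is the q of these weights. *)
Definition loop_basis (T : finType) m (ij : T -> 'I_m * 'I_m) (c : K) (E : T -> A) :=
  (forall v w, \sum_(s : T) \sum_(t : T) @qweight K (loop_weights ij c) s t *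
     (form (E s) v * form (E t) w) = form v w) /\
  (forall (t u : T) (r : seq T), size r = p ->
     form (br (map E (t :: r))) (E u) = @gamma K (loop_weights ij c) (t :: rcons r u)).

(** If the words of p letters act as the scalar d, scaling each letter by a p-th root of d^-1 makes
    them act as the idempotents. *)
Lemma alt_word_normalize (I : Type) (tau : I -> I) (eps : I -> mult A) (z : I -> A) :
  involutive tau -> (forall k, prim (eps k)) -> (forall k, z k <> 0) ->
  (forall k, ml (eps k) (z k) = z k) -> (forall k, mr (eps (tau k)) (z k) = z k) ->
  (forall k, iter p tau k = k) -> (forall k k', k' = k \/ k' = tau k) -> I ->
  exists c : K, c != 0 /\
    forall k, br (alt_word tau (fun k => c *: z k) k p.+1) = c *: z k.
Proof.
move=> tauK Peps z0 epsz zeps taup taut k0.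
have [d [d0 Hd]] := alt_word_scalar tauK Peps z0 epsz zeps taup taut k0.
pose c := p.-root d^-1.
have Hc : c ^+ p = d^-1 by apply: rootCK.
have c0 : c != 0.
  apply: contra_neq d0 => c0; move: Hc; rewrite c0 expr0n gtn_eqF // => /eqP.
  by rewrite eq_sym invr_eq0 => /eqP.
exists c; split=> // k.
rewrite alt_wordSr /alt_word.
have -> : [seq c *: z i | i <- traject tau k p] = map ( *:%R c) (map z (traject tau k p)).
  by rewrite -map_comp.
rewrite -cats1 (brZ_map c [::]) size_map size_traject Hc /= cats1 taup.
by rewrite Hd mlZ epsz scalerA mulVf // scale1r.
Qed.

Lemma type1_basis e y : prim e -> y <> 0 -> ml e y = y -> mr e y = y ->
  exists r (c : K) (E : 'I_r * 'I_r -> A), [/\ (1 <= r)%N, c != 0 & loop_basis id c E].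
Proof.
move=> Pe y0 ey ye.
have all_tt (k k' : unit) : k' = k by case: k; case: k'.
have tp (k : unit) : iter p id k = k by apply: all_tt.
have [d [d0 Hd]] := @alt_word_normalize unit id (fun _ => e) (fun _ => y)
  (fun _ => erefl) (fun _ => Pe) (fun _ => y0) (fun _ => ey) (fun _ => ye)
  tp (fun k k' => or_introl (all_tt k k')) tt.
pose z := d *: y.
(* Some t has a nonzero product with y, and t may be replaced by e t e. By [prim_shift] this is b y
   for a multiplier b, and e b e is a scalar, so e t e is a multiple of y. *)
have yy : form y y <> 0.
  have [t yt] : exists t : A, form y t <> 0.
    apply: contrapT => H; apply: y0; apply: form_nondeg => w; apply: contrapT => nz.
    by apply: H; exists w.
  move=> yy; apply: yt; have [/(_ (ml e t)) [b Hb] _] := prim_shift Pe Pe y0 ey ye.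
  have [k Hk] := Pe.2 b.
  rewrite -ye mult_adj -[in LHS]ey formC -mult_adj Hb formC.
  have -> : ml b y = k *: y.
    have /= := Hk y; rewrite !ey => <-.
    by rewrite -Hb mult_comm Pe.1.
  by rewrite formZr yy mulr0.
have [M [a [b [[M0 _ _ ba] [sa sb]]]]] := dual_bases Pe y0 ey ye.
have z0 : z <> 0 by move/eqP; rewrite scaler_eq0 (negbTE d0) => /eqP.
exists M, (form z z), (fun ij => matrix_unit (fun _ : unit => z) (fun _ => tt) a b id ij).
have zz : form z z != 0.
  by rewrite formZl formZr !mulf_eq0 negb_or d0 /= negb_or d0; apply/eqP.
have sa' (k : unit) (c : mult A) : exists x : 'I_M -> K,
    ml c z = \sum_(i | tt == k) x i *: ml (a i) z.
  have [x Hx] := sa c; exists x; case: k => /=.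
  rewrite mlZ Hx scaler_sumr; apply: eq_bigr => i _.
  by rewrite mlZ !scalerA mulrC.
have sb' (k : unit) (c : mult A) : exists x : 'I_M -> K,
    mr c z = \sum_(i | tt == id k) x i *: mr (b i) z.
  have [x Hx] := sb c; exists x; case: k => /=.
  rewrite mrZ Hx scaler_sumr; apply: eq_bigr => i _.
  by rewrite mrZ !scalerA mulrC.
have ez : ml e z = z by rewrite mlZ ey.
have hs (i j : 'I_M) : tt = id tt -> exists ij : 'I_M * 'I_M, id ij = (i, j).
  by move=> _; exists (i, j).
split=> //; split.
- exact: (units_tensor (I := unit) (tau := id) (eps := fun _ => e)
    (fun _ => erefl) (fun _ => z0) (fun _ => ez) Hd (fun _ => erefl) zz tt
    ba sa' sb' (fun _ _ => id) (fun _ => erefl) hs).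
- exact: (form_br_units (I := unit) (tau := id) (eps := fun _ => e)
    tp (fun _ => ez) Hd (fun _ => erefl) zz tt
    (kap := fun _ => tt) ba (ij := id) (fun _ => erefl)).
Qed.

Lemma type2_basis e f x x' :
  prim e -> prim f -> ml e x = x -> mr f x = x -> ml f x' = x' -> mr e x' = x' ->
  form x x' != 0 -> ~~ odd p ->
  (forall (t : mult A) v, ml f (ml t (ml e v)) = 0) ->
  (forall (t : mult A) v, ml e (ml t (ml f v)) = 0) ->
  exists M N (c : K) (E : {y : 'I_(M + N) * 'I_(M + N) | type2_pair y} -> A),
    [/\ (1 <= M + N)%N, c != 0 & loop_basis val c E].
Proof.
move=> Pe Pf ex xf fx' x'e xx' evp fe0 ef0.
have x0 : x <> 0 by move=> E; rewrite E form0l eqxx in xx'.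
have x'0 : x' <> 0 by move=> E; rewrite E form0r eqxx in xx'.
pose eps k := if k then e else f; pose y k := if k then x else x'.
have tp k : iter p negb k = k.
  rewrite -[p]odd_double_half (negbTE evp) add0n.
  by elim: (p./2) => // q IH; rewrite doubleS !iterS IH negbK.
have [d [d0 Hd]] : exists d : K, d != 0 /\
    forall k, br (alt_word negb (fun k => d *: y k) k p.+1) = d *: y k.
  by apply: (@alt_word_normalize _ _ eps); rewrite /eps /y;
    [exact: negbK | case | case | case | case | | case=> [] []; by [left|right] | exact: true].
pose z k := d *: y k.
have [M [a1 [b1 [[M0 a1e eb1 ba1] [sa1 sb1]]]]] := dual_bases Pe x0 ex x'e.
have [N [a2 [b2 [[N0 a2f fb2 ba2] [sa2 sb2]]]]] := dual_bases Pf x'0 fx' xf.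
pose kap (i : 'I_(M + N)) := (i < M)%N.
pose a i := match split i with inl j => a1 j | inr j => a2 j end.
pose b i := match split i with inl j => b1 j | inr j => b2 j end.
have kl j : kap (lshift N j) = true by rewrite /kap /= ltn_ord.
have kr j : kap (rshift M j) = false by rewrite /kap /= ltnNge leq_addr.
have al j : a (lshift N j) = a1 j by rewrite /a (unsplitK (inl j)).
have ar j : a (rshift M j) = a2 j by rewrite /a (unsplitK (inr j)).
have bl j : b (lshift N j) = b1 j by rewrite /b (unsplitK (inl j)).
have br' j : b (rshift M j) = b2 j by rewrite /b (unsplitK (inr j)).
(* The mixed products vanish because e and f are not linked in degree 0. *)
have ba i j v : ml (b j) (ml (a i) v) = (i == j)%:R *: ml (eps (kap i)) v.
  rewrite -(splitK i) -(splitK j); case: (split i) => i'; case: (split j) => j' /=;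
    rewrite ?(al, ar, bl, br', kl, kr) ?eq_lshift ?eq_rshift ?eq_lrshift ?eq_rlshift.
  - exact: ba1.
  - rewrite scale0r -fb2 -a1e; exact: (fe0 (mulm (b2 j') (a1 i'))).
  - rewrite scale0r -eb1 -a2f; exact: (ef0 (mulm (b1 j') (a2 i'))).
  - exact: ba2.
have sum_kap (k : bool) (G : 'I_(M + N) -> A) : \sum_(i | kap i == k) G i =
    if k then \sum_i G (lshift N i) else \sum_i G (rshift M i).
  rewrite big_split_ord /=; case: k.
    rewrite [X in _ + X]big1 ?addr0 => [|i]; last by rewrite kr.
    by apply: eq_bigl => i; rewrite kl.
  rewrite [X in X + _]big1 ?add0r => [|i]; last by rewrite kl.
  by apply: eq_bigl => i; rewrite kr.
have sa k (c : mult A) : exists g : 'I_(M + N) -> K,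
    ml c (z k) = \sum_(i | kap i == k) g i *: ml (a i) (z k).
  have [g1 H1] := sa1 c; have [g2 H2] := sa2 c.
  exists (fun i => match split i with inl j => g1 j | inr j => g2 j end).
  rewrite sum_kap /z /y; case: k; rewrite mlZ ?H1 ?H2 scaler_sumr; apply: eq_bigr => i _.
    by rewrite (unsplitK (inl i)) al mlZ !scalerA mulrC.
  by rewrite (unsplitK (inr i)) ar mlZ !scalerA mulrC.
have sb k (c : mult A) : exists g : 'I_(M + N) -> K,
    mr c (z k) = \sum_(i | kap i == ~~ k) g i *: mr (b i) (z k).
  have [g1 H1] := sb1 c; have [g2 H2] := sb2 c.
  exists (fun i => match split i with inl j => g1 j | inr j => g2 j end).
  rewrite sum_kap /z /y; case: k => /=; rewrite mrZ ?H1 ?H2 scaler_sumr; apply: eq_bigr => i _.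
    by rewrite (unsplitK (inr i)) br' mrZ !scalerA mulrC.
  by rewrite (unsplitK (inl i)) bl mrZ !scalerA mulrC.
have ez k : ml (eps k) (z k) = z k.
  by rewrite /z mlZ /eps /y; case: k; rewrite ?ex ?fx'.
have z0 k : z k <> 0.
  by move/eqP; rewrite scaler_eq0 (negbTE d0) /= /y; case: k => /eqP.
have zz k : form (z k) (z (~~ k)) = form (z true) (z false) by case: k => //; rewrite formC.
have c0 : form (z true) (z false) != 0.
  by rewrite formZl formZr !mulf_eq0 (negbTE d0).
have hk (t : {y : 'I_(M + N) * 'I_(M + N) | type2_pair y}) :
    kap (val t).2 = ~~ kap (val t).1.
  case: t => -[i j] /=; rewrite /type2_pair /kap /= [(j < _)%N]ltnNge [(i < M)%N]ltnNge.
  by case: (M <= i)%N; case: (M <= j)%N.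
have hs i j : kap j = ~~ kap i ->
    exists t : {y : 'I_(M + N) * 'I_(M + N) | type2_pair y}, val t = (i, j).
  rewrite /kap => H; suff Hij : type2_pair (i, j) by exists (Sub (i, j) Hij).
  rewrite /type2_pair /=; move: H; rewrite [(j < _)%N]ltnNge [(i < M)%N]ltnNge.
  by case: (M <= i)%N; case: (M <= j)%N.
exists M, N, (form (z true) (z false)), (fun ij => matrix_unit z kap a b val ij).
split=> //; first by rewrite addn_gt0 M0.
split.
- exact: (units_tensor (eps := eps) negbK z0 ez Hd zz c0 true ba sa sb val_inj hk hs).
- exact: (form_br_units (eps := eps) tp ez Hd zz c0 true ba hk).
Qed.

Theorem simple_loop_basis :
  (exists r (c : K) (E : 'I_r * 'I_r -> A),
     [/\ (1 <= r)%N, c != 0 & loop_basis id c E]) \/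
  (~~ odd p /\ exists M N (c : K) (E : {y : 'I_(M + N) * 'I_(M + N) | type2_pair y} -> A),
     [/\ (1 <= M + N)%N, c != 0 & loop_basis val c E]).
Proof.
have [e [f [x [x' [[Pe Pf ex xf] [fx' x'e xx']]]]]] := prim_pair.
have x0 : x <> 0 by move=> E; rewrite E form0l eqxx in xx'.
have x'0 : x' <> 0 by move=> E; rewrite E form0r eqxx in xx'.
(* With T = f1 t e1 nonzero, x1 T lies in e1 A e1, as [type1_basis] requires. If x1 T were 0, then u
   f1 T = b x1 T = 0 for all u by [prim_shift], and T would be 0. *)
have isotypic e1 f1 x1 (t : mult A) v : prim e1 -> prim f1 -> x1 <> 0 -> ml e1 x1 = x1 ->
    mr f1 x1 = x1 -> ml f1 (ml t (ml e1 v)) <> 0 ->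
    exists r (c : K) (E : 'I_r * 'I_r -> A), [/\ (1 <= r)%N, c != 0 & loop_basis id c E].
  move=> Pe1 Pf1 x10 ex1 xf1 nz; pose T := mulm f1 (mulm t e1).
  apply: (@type1_basis e1 (mr T x1)) => //.
  - move=> T0; apply: nz; rewrite -[LHS]/(ml T v).
    suff H : eqm T (scalem 0 (idm A)) by rewrite H /= scale0r.
    apply: mr_eqm => u; rewrite [RHS]/= scale0r.
    have [/(_ u) [b Hb] _] := prim_shift Pe1 Pf1 x10 ex1 xf1.
    have -> : mr T u = mr T (mr f1 u) by rewrite /= mr_idem.
    by rewrite Hb -mult_comm T0 ml0.
  - by rewrite mult_comm ex1.
  - by rewrite /= mr_idem.
have [[t [v nz]]|no1] := EM (exists (t : mult A) v, ml f (ml t (ml e v)) <> 0).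
  by left; apply: isotypic Pe Pf x0 ex xf nz.
have [[t [v nz]]|no2] := EM (exists (t : mult A) v, ml e (ml t (ml f v)) <> 0).
  by left; apply: isotypic Pf Pe x'0 fx' x'e nz.
have fe0 (t : mult A) v : ml f (ml t (ml e v)) = 0.
  by apply: contrapT => nz; apply: no1; exists t, v.
have ef0 (t : mult A) v : ml e (ml t (ml f v)) = 0.
  by apply: contrapT => nz; apply: no2; exists t, v.
suff evp : ~~ odd p by right; split=> //; apply: (type2_basis Pe Pf) xx' evp fe0 ef0.
(* For odd p the word x' x ... x' of p letters begins and ends with x', so it lies in f R_0 e; it is
   nonzero, which contradicts [fe0]. *)
apply/negP => oddp.
pose eps k := if k then e else f; pose z k := if k then x else x'.
have [|||||v] := @alt_word_neq0 _ negb eps z _ _ _ _ _ true; rewrite /eps /z.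
- exact: negbK.
- by case.
- by case.
- by case.
- by case.
have -> : iter p negb true = false.
  rewrite -[p]odd_double_half oddp iterD /=.
  by elim: (p./2) => // q IH; rewrite doubleS !iterS negbK.
rewrite -/z; set w := alt_word _ _ _ _.
have Hw : size w = p by rewrite size_map size_traject.
have [T [Tl _]] := word_mult Hw.
case; rewrite -Tl -(fe0 T v) Tl.
have Ep : p = p.-1.+1 by rewrite prednK.
have -> : br (rcons w v) = ml f (br (rcons w v)).
  by rewrite /w; have := alt_wordS negb z false p.-1; rewrite -Ep => ->;
    rewrite rcons_cons ml_br ?fx' // size_rcons size_alt_word; lia.
congr ml; rewrite Tl /w; have := alt_wordSr negb z false p.-1; rewrite -Ep => ->.
have -> : z (iter p.-1 negb false) = x'.
  rewrite /z; have -> : p.-1 = (p./2).*2 by lia.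
  by elim: (p./2) => // q IH; rewrite doubleS !iterS negbK.
by rewrite -!cats1 -!catA /= -mr_ml_move ?x'e // size_alt_word /=; lia.
Qed.

End Primitive.

(** * Partition functions *)

Section GluedSides.
Variables (n : nat) (G : ngonization n).
Local Notation side := (side G).
Local Notation glue := (@glue n G : side -> side).

Lemma edge_glue (s : side) : (glue s \in edges G) = (s \notin edges G).
Proof.
rewrite !inE glueK -leqNgt [RHS]leq_eqVlt; case: eqP => //= E.
case/negP: (glue_neq (s : side)); apply/eqP.
by apply: (@enum_rank_inj side); apply: val_inj.
Qed.

Lemma prod_sides (K : fieldType) (F : side -> K) :
  \prod_s F s = \prod_(s in edges G) (F s * F (glue s)).
Proof.
rewrite (bigID (mem (edges G))) big_split /=; congr (_ * _).
rewrite (reindex_onto glue glue) => [|s _]; last exact: glueK.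
by apply: eq_bigl => s; rewrite edge_glue negbK glueK eqxx andbT.
Qed.

(** A labelling of the sides is a free choice of a pair of labels for every edge. *)
Lemma sum_prod_edges (K : fieldType) (T : finType) (H : side -> T -> T -> K) :
  \sum_(x : {ffun side -> T}) \prod_(s in edges G) H s (x s) (x (glue s)) =
  \prod_(s in edges G) \sum_a \sum_b H s a b.
Proof.
rewrite [RHS]big_sub; under [RHS]eq_bigr do rewrite pair_bigA.
rewrite bigA_distr_bigA /=.
pose E := {s : side | s \in edges G}.
pose h (x : {ffun side -> T}) : {ffun E -> T * T} :=
  [ffun e => (x (val e), x (glue (val e)))].
have gE (s : side) : s \notin edges G -> glue s \in edges G by rewrite edge_glue.
pose g (f : {ffun E -> T * T}) : {ffun side -> T} :=
  [ffun s => match boolP (s \in edges G) with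
             | AltTrue es => (f (Sub s es)).1
             | AltFalse ns => (f (Sub (glue s) (gE s ns))).2
             end].
rewrite (reindex h); last first.
  apply: onW_bij; exists g => [x|f]; apply/ffunP => s; rewrite !ffunE.
    by case: {-}_ / boolP => es; rewrite !ffunE //= glueK.
  rewrite [RHS]surjective_pairing; congr (_, _).
    case: {-}_ / boolP => es; last by have := es; rewrite (valP s).
    by congr (f _).1; apply: val_inj.
  case: {-}_ / boolP => es; first by have := es; rewrite edge_glue (valP s).
  by congr (f _).2; apply: val_inj; rewrite /= glueK.
apply: eq_bigr => x _; rewrite big_sub; apply: eq_bigr => e _.
by rewrite ffunE.
Qed.

End GluedSides.

Section Tensor.
Variables (K : fieldType) (n : nat).

Lemma ffun_ord_recl (T : finType) k (F : {ffun 'I_k.+1 -> T} -> K) :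
  \sum_y F y = \sum_t \sum_(y : {ffun 'I_k -> T})
    F [ffun i => oapp y t (unlift ord0 i)].
Proof.
rewrite pair_bigA (reindex (fun ty : T * {ffun 'I_k -> T} =>
  [ffun i => oapp ty.2 ty.1 (unlift ord0 i)])) //=.
apply: onW_bij; exists (fun y : {ffun 'I_k.+1 -> T} =>
  (y ord0, [ffun i => y (lift ord0 i)])) => [[t y]|y].
  congr (_, _); first by rewrite ffunE unlift_none.
  by apply/ffunP => i; rewrite !ffunE liftK.
by apply/ffunP => i; rewrite ffunE; case: unliftP => [j|] -> //=; rewrite ffunE.
Qed.

(** The prefix s holds the letters already expanded. Linearity is assumed in length N only, as
    [cyclic_form_lin] provides it for words of length p + 2. *)
Lemma multilinear_expand (V : lmodType K) (T1 T2 : finType) (Gam : seq V -> K)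
    (h : T1 -> V) (e : T2 -> V) (P : T1 -> T2 -> K) N :
  (forall s1 s2 a u v, (size s1 + size s2).+1 = N -> Gam (s1 ++ (a *: u + v) :: s2) =
     a * Gam (s1 ++ u :: s2) + Gam (s1 ++ v :: s2)) ->
  (forall t, h t = \sum_y P t y *: e y) ->
  forall k (x : 'I_k -> T1) s, (size s + k)%N = N ->
  Gam (s ++ [seq h (x i) | i <- enum 'I_k]) =
  \sum_(y : {ffun 'I_k -> T2}) (\prod_i P (x i) (y i)) *
    Gam (s ++ [seq e (y i) | i <- enum 'I_k]).
Proof.
move=> Gl hE; elim=> [|k IH] x s Hs.
  pose y0 : {ffun 'I_0 -> T2} := ffun0 (card_ord 0).
  rewrite enum_ord0 /= (big_pred1 y0) => [|y].
    by rewrite big_ord0 mul1r.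
  by symmetry; apply/eqP/ffunP => -[].
rewrite enum_ordSl /= -map_comp ffun_ord_recl hE.
have G0 s1 s2 : (size s1 + size s2).+1 = N -> Gam (s1 ++ 0 :: s2) = 0.
  by move=> /(Gl _ _ (-1) 0 0); rewrite scaler0 addr0 mulN1r addNr.
set r := [seq _ | i <- _]; have Hr : (size s + size r).+1 = N.
  by rewrite size_map size_enum_ord -Hs addnS.
rewrite (big_morph (fun u => Gam (s ++ u :: r)) (id1 := 0) (op1 := +%R)); first last.
- exact: G0.
- by move=> u v; rewrite -[u]scale1r Gl // mul1r scale1r.
apply: eq_bigr => t _; rewrite -[_ *: _]addr0 Gl // G0 // addr0 -cat_rcons /r.
rewrite [Gam _](IH (fun i => x (lift ord0 i))) ?size_rcons ?addSnnS // mulr_sumr.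
apply: eq_bigr => y _.
rewrite big_ord_recl ffunE unlift_none mulrA cat_rcons; congr (_ * _ * Gam (_ ++ _ :: _)).
- by apply: eq_bigr => i _; rewrite ffunE liftK.
- by rewrite -map_comp; apply: eq_map => i /=; rewrite ffunE liftK.
Qed.

(* The partition function depends on q only through the tensor it represents. *)
Lemma partition_function_tensor (W1 W2 : weights K) (P : var W1 -> var W2 -> K)
    (G : ngonization n) :
  (forall x : 'I_n -> var W1, gamma [seq x i | i <- enum 'I_n] =
     \sum_(y : {ffun 'I_n -> var W2})
        (\prod_i P (x i) (y i)) * gamma [seq y i | i <- enum 'I_n]) ->
  (forall y y' : var W2, qweight y y' =
     \sum_(a : var W1) \sum_(b : var W1) qweight a b * (P a y * P b y')) ->
  partition_function W1 G = partition_function W2 G.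
Proof.
move=> HG Hq; rewrite /partition_function.
(* Expanding the polygons over labels z of the second model leaves x in the edge factors only, where
   it can be summed edge by edge. *)
transitivity (\sum_(x : {ffun side G -> var W1}) \sum_(z : {ffun side G -> var W2})
    (\prod_(a : polygon G) gamma [seq z (a, i) | i <- enum 'I_n]) *
    \prod_(s in edges G) (qweight (x s) (x (glue s)) *
       (P (x s) (z s) * P (x (glue s)) (z (glue s))))).
  apply: eq_bigr => x _.
  under eq_bigr => a _ do rewrite (HG (fun i => x (a, i))).
  rewrite bigA_distr_bigA /= mulr_suml.
  rewrite (reindex (fun z : {ffun side G -> var W2} =>
    [ffun a => [ffun i => z (a, i)]])) /=; last first.
    apply: onW_bij; exists (fun Y : {ffun polygon G -> {ffun 'I_n -> var W2}} =>
      [ffun s : side G => Y s.1 s.2]) => [z|Y].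
      by apply/ffunP => -[a i]; rewrite !ffunE.
    by apply/ffunP => a; apply/ffunP => i; rewrite !ffunE.
  apply: eq_bigr => z _; rewrite big_split /= pair_bigA /=.
  rewrite (eq_bigr (fun s : side G => P (x s) (z s))) => [|s _]; last first.
    by rewrite !ffunE -surjective_pairing.
  rewrite prod_sides [in RHS]big_split /= mulrAC mulrC; congr (_ * _); last by rewrite mulrC.
  apply: eq_bigr => a _; congr gamma; apply: eq_map => i.
  by rewrite !ffunE.
rewrite exchange_big; apply: eq_bigr => z _; rewrite -mulr_sumr; congr (_ * _).
rewrite (@sum_prod_edges _ G _ _ (fun s a b => qweight a b * (P a (z s) * P b (z (glue s))))).
by apply: eq_bigr => s _; rewrite Hq.
Qed.
End Tensor.

(** * Models of types 1 and 2 *)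

Section LoopModels.

Lemma cycle_map_ord (U : eqType) (e : rel U) n (f : 'I_n -> U) :
  cycle e [seq f i | i <- enum 'I_n] = [forall i, e (f i) (f (ordS i))].
Proof.
case: n f => [|n] f; first by rewrite enum_ord0; symmetry; apply/forallP => -[].
have E : [seq f i | i <- enum 'I_n.+1] = f ord0 :: behead [seq f i | i <- enum 'I_n.+1].
  by rewrite enum_ordSl.
have Hs : size [seq f i | i <- enum 'I_n.+1] = n.+1 by rewrite size_map size_enum_ord.
have nthf (i : 'I_n.+1) : nth (f ord0) [seq f i | i <- enum 'I_n.+1] i = f i.
  by rewrite (nth_map ord0) ?size_enum_ord // nth_ord_enum.
have nth1 (i : 'I_n.+1) : nth (f ord0) (rcons [seq f i | i <- enum 'I_n.+1] (f ord0)) i = f i.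
  by rewrite nth_rcons Hs ltn_ord nthf.
have nth2 (i : 'I_n.+1) : nth (f ord0) (rcons [seq f i | i <- enum 'I_n.+1] (f ord0)) i.+1
    = f (ordS i).
  rewrite nth_rcons Hs; case: (ltnP i.+1 n.+1) => Hi.
    by rewrite -(nthf (ordS i)) /= modn_small.
  have -> : i.+1 = n.+1 by apply/eqP; rewrite eqn_leq Hi ltn_ord.
  by rewrite eqxx; congr f; apply: val_inj; rewrite /= (_ : i.+1 = n.+1) ?modnn //;
    apply/eqP; rewrite eqn_leq Hi ltn_ord.
move: nth1 nth2; rewrite E /= => nth1 nth2.
apply/(pathP (f ord0))/forallP => [H i|H i].
  rewrite -nth1 -nth2; apply: H.
  by rewrite size_rcons -[X in (_ < X)%N]/(size (f ord0 :: behead _)) -E Hs.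
rewrite size_rcons -[X in (_ < X)%N]/(size (f ord0 :: behead _)) -E Hs => Hi.
by rewrite (nth1 (Ordinal Hi)) -/(nth _ (_ :: _) i.+1) (nth2 (Ordinal Hi)).
Qed.

Lemma prod_bool (K : fieldType) (I : finType) (P B : pred I) :
  \prod_(i | P i) (B i)%:R = [forall (i | P i), B i]%:R :> K.
Proof.
case: (boolP [forall (i | P i), B i]) => [/forall_inP H|].
  by rewrite big1 // => i /H ->.
rewrite negb_forall_in => /exists_inP[i Pi nB].
by apply/eqP/prodf_eq0; exists i; rewrite ?(negbTE nB).
Qed.

Section Labellings.
Variables (n : nat) (G : ngonization n) (m : nat) (T : finType)
  (ij : T -> 'I_m * 'I_m).
Hypothesis ij_inj : injective ij.
Local Notation side := (side G).
Local Notation glue := (@glue n G : side -> side).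

Definition loop_valid (x : {ffun side -> T}) : bool :=
  [forall s : side, (ij (x s)).2 == (ij (x (next s))).1] &&
  [forall s : side, (ij (x s)).2 == (ij (x (glue s))).1].

Lemma partition_function_loop (K : fieldType) (c : K) :
  partition_function (loop_weights ij c) G =
  c ^+ nb_polygons G * c^-1 ^+ nb_edges G * #|loop_valid|%:R.
Proof.
rewrite -sum1_card natr_sum mulr_sumr [RHS]big_mkcond; apply: eq_bigr => x _.
rewrite /= big_split /= prodr_const.
under eq_bigr do rewrite cycle_map_ord.
rewrite (eq_bigr (fun s : side => c^-1 * (((ij (x s)).2 == (ij (x (glue s))).1) &&
    ((ij (x (glue s))).2 == (ij (x s)).1))%:R)); last first.
  by move=> s _; rewrite -mulnb natrM mulrA.
rewrite [in X in _ * X]big_split /= prodr_const !prod_bool.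
have -> : [forall a : polygon G, [forall i, [rel x0 y | (ij x0).2 == (ij y).1]
    (x (a, i)) (x (a, ordS i))]] = [forall s : side, (ij (x s)).2 == (ij (x (next s))).1].
  apply/forallP/forallP => [H [a i]|H a]; first exact: (forallP (H a)).
  by apply/forallP => i; have := H (a, i).
have -> : [forall (s | s \in edges G), ((ij (x s)).2 == (ij (x (glue s))).1) &&
      ((ij (x (glue s))).2 == (ij (x s)).1)] =
    [forall s : side, (ij (x s)).2 == (ij (x (glue s))).1].
  apply/forall_inP/forallP => [H s|H s _]; last first.
    by rewrite H /=; have := H (glue s); rewrite glueK.
  case: (boolP (s \in edges G)) => [/H /andP[] //|].
  by rewrite -edge_glue => /H /andP[_]; rewrite glueK.
rewrite mulrACA -!natrM mulnb -/(loop_valid x) -topredE /=.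
by case: loop_valid; rewrite ?mulr1 ?mulr0.
Qed.

(** y s is the first index of the variable on s and sits at the starting point of s; the second
    index is that of [next s]. The edge factors then say that y is constant around each vertex. *)
Definition vertex_labelling (y : {ffun side -> 'I_m}) : bool :=
  [forall s, y (turn s) == y s] &&
  [forall s, [exists t, ij t == (y s, y (next s))]].

Lemma card_loop_valid : #|loop_valid| = #|vertex_labelling|.
Proof.
pose f (x : {ffun side -> T}) : {ffun side -> 'I_m} := [ffun s => (ij (x s)).1].
have valid_ij x : loop_valid x -> forall s, ij (x s) = (f x s, f x (next s)).
  move=> /andP[/forallP H _] s; rewrite !ffunE -(eqP (H s)).
  by case: (ij _).
have inj_f : {in loop_valid &, injective f}.
  move=> x x' vx vx' E; apply/ffunP => s; apply: ij_inj.
  by rewrite !valid_ij ?E.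
rewrite -(card_in_imset inj_f); apply: eq_card => y.
apply/imsetP/idP => [[x vx ->]|].
  rewrite unfold_in; apply/andP; split; last first.
    by apply/forallP => s; apply/existsP; exists (x s); rewrite valid_ij.
  apply/forallP => s; rewrite !ffunE /turn.
  move: vx => /andP[/forallP H1 /forallP H2].
  by rewrite -(eqP (H1 (glue s))) (eqP (H2 (glue s))) glueK.
rewrite unfold_in => /andP[/forallP H1 /forallP H2].
have [x Hx] : exists x : {ffun side -> T}, forall s, ij (x s) = (y s, y (next s)).
  exists [ffun s => xchoose (existsP (H2 s))] => s; rewrite ffunE.
  by apply/eqP; apply: (xchooseP (existsP (H2 s))).
exists x; last by apply/ffunP => s; rewrite ffunE Hx.
rewrite unfold_in; apply/andP; split; apply/forallP => s; rewrite !Hx //=.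
by rewrite -(eqP (H1 (glue s))) /turn glueK.
Qed.

Lemma turn_inj : injective (@turn n G).
Proof.
move=> s t; rewrite /turn => E; apply: (inv_inj (@glueK n G)); move: E.
case: (glue s) (glue t) => [a i] [b j] /= [-> Eij].
by congr (_, _); apply: ordS_inj; apply: val_inj.
Qed.

Lemma start_turn (s : side) : start (turn s) = start s.
Proof.
apply/setP => t; rewrite !inE; apply: same_connect.
  exact: fconnect_sym turn_inj.
by rewrite fconnect_sym ?fconnect1 //; apply: turn_inj.
Qed.

Lemma start_inj_fun (U : Type) (y : side -> U) : (forall s, y (turn s) = y s) ->
  forall s t, start s = start t -> y s = y t.
Proof.
move=> yt s t E; have : t \in start s by rewrite E inE connect0.
rewrite inE => /connectP[r pr ->]; elim: r s pr {E} => //= u r IH s /andP[/eqP <- pr].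
by rewrite -(IH _ pr) yt.
Qed.

(** A labelling descends to the vertices. Off the vertices [pfamily] pins the value i0, so that each
    function is counted once. *)
Lemma card_labellings (i0 : 'I_m) (D : {set side} -> pred 'I_m) :
  #|[pred y : {ffun side -> 'I_m} | [forall s, y (turn s) == y s] &&
      [forall s, D (start s) (y s)]]| = (\prod_(v in vertices G) #|D v|)%N.
Proof.
pose h (f : {ffun {set side} -> 'I_m}) : {ffun side -> 'I_m} := [ffun s => f (start s)].
have startV s : start s \in vertices G by apply: imset_f.
have h_inj : {in pfamily i0 (mem (vertices G)) D &, injective h}.
  move=> f g /pfamilyP[sf _] /pfamilyP[sg _] E; apply/ffunP => v.
  case: (boolP (v \in vertices G)) => [/imsetP[s _ ->]|nv].
    by have := congr1 (fun z : {ffun side -> 'I_m} => z s) E; rewrite !ffunE.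
  by rewrite (supportP sf v nv) (supportP sg v nv).
transitivity #|pfamily i0 (mem (vertices G)) D|; last first.
  by rewrite card_pfamily foldrE big_map big_enum.
rewrite -(card_in_imset h_inj); apply: eq_card => y.
rewrite inE; apply/andP/imsetP => [[/forallP yt /forallP yD]|[f /pfamilyP[_ fD] ->]]; last first.
  split; apply/forallP => s; rewrite !ffunE ?start_turn //.
  by have := fD _ (startV s).
pose f : {ffun {set side} -> 'I_m} :=
  [ffun v => if [pick s | start s == v] is Some s then y s else i0].
have fE s : f (start s) = y s.
  rewrite ffunE; case: pickP => [t /eqP Et|/(_ s)]; last by rewrite eqxx.
  by apply: start_inj_fun Et => u; apply/eqP.
exists f; last by apply/ffunP => s; rewrite ffunE fE.
apply/pfamilyP; split.
  apply/supportP => v nv; rewrite ffunE; case: pickP => // s /eqP Es.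
  by rewrite -Es startV in nv.
by move=> _ /imsetP[s _ ->]; rewrite fE unfold_in; apply: yD.
Qed.

End Labellings.

Lemma partition_function_type1 (K : numFieldType) n (G : ngonization n) r (beta : K) :
  (1 <= r)%N -> (n - 2)%:R * beta != 0 ->
  partition_function (type1_weights n r beta) G =
  r%:R ^+ nb_vertices G * ((n - 2)%:R * beta) ^ ((nb_polygons G)%:Z - (nb_edges G)%:Z).
Proof.
case: r => // r _; set c := (n - 2)%:R * beta => c0.
rewrite partition_function_loop card_loop_valid; last by move=> ? ?.
rewrite -(@eq_card _ [pred y : {ffun side G -> 'I_r.+1} | [forall s, y (turn s) == y s] &&
      [forall s : side G, predT (y s)]]) => [|y]; last first.
  rewrite !inE unfold_in /vertex_labelling; congr (_ && _).
  apply/forallP/forallP => // _ s.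
  by apply/existsP; exists (y s, y (next s)).
rewrite (card_labellings ord0 (fun _ => predT)) prod_nat_const card_ord.
by rewrite natrX mulrC expfzDr // -exprnN exprVn.
Qed.

Lemma type1_euler (K : fieldType) n (G : ngonization n) r (c : K) : c != 0 ->
  r%:R ^+ nb_vertices G * c ^ ((nb_polygons G)%:Z - (nb_edges G)%:Z) =
  c ^ (euler_char G) * (r%:R / c) ^+ nb_vertices G.
Proof.
move=> c0; rewrite /euler_char addrAC -addrA [X in _ = X * _]expfzDr // -exprnP exprMn exprVn.
rewrite [X in _ = X * _]mulrC -mulrA [X in _ = _ * X]mulrCA mulfV ?expf_neq0 //.
by rewrite mulr1 mulrC.
Qed.

Lemma ordS_const (U : Type) n (d : 'I_n -> U) :
  (forall i, d (ordS i) = d i) -> forall i j, d i = d j.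
Proof.
case: n d => [|n] d H; first by case.
suff H0 i : d i = d ord0 by move=> i j; rewrite !H0.
case: i => k; elim: k => [|k IH] Hk; first by congr d; apply: val_inj.
rewrite -(IH (ltnW Hk)) -[RHS]H; congr d; apply: val_inj.
by rewrite /= modn_small.
Qed.

(** [next] runs around a polygon and [glue] crosses to a neighbour, so this expresses the
    connectedness of the surface. *)
Lemma side_const (U : Type) n (G : ngonization n) (d : side G -> U) :
  (forall s, d (next s) = d s) -> (forall s : side G, d (glue s : side G) = d s) ->
  forall s t, d s = d t.
Proof.
move=> dn dg [a i] [b j].
have dpoly a' i' j' : d (a', i') = d (a', j').
  by apply: (ordS_const (d := fun i => d (a', i))) => k; apply: (dn (a', k)).
have /connectP[r pr ->] := polygon_connected a b.
elim: r a i pr => [|a' r IH] a i /=; first by move=> _; apply: dpoly.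
move=> /andP[/existsP[[a1 i1] /andP[/= /eqP Ea /eqP Ea']] pr].
rewrite -(IH a' (glue (a1, i1) : side G).2 pr) -Ea' -surjective_pairing dg Ea.
exact: dpoly.
Qed.

Section Type2.
Variables (n : nat) (G : ngonization n) (M N : nat).
Hypothesis n_gt0 : (0 < n)%N.
Let T := {x : 'I_(M + N) * 'I_(M + N) | type2_pair x}.
Let ij : T -> 'I_(M + N) * 'I_(M + N) := val.

Lemma type2_pairE (i j : 'I_(M + N)) : type2_pair (i, j) = ((i < M)%N != (j < M)%N).
Proof.
by rewrite /type2_pair /= !(ltnNge _ M); case: (M <= i)%N; case: (M <= j)%N.
Qed.

Lemma vertex_labelling_type2 (y : {ffun side G -> 'I_(M + N)}) :
  vertex_labelling ij y = [forall s, y (turn s) == y s] &&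
    [forall s, (y s < M)%N != (y (next s) < M)%N].
Proof.
rewrite /vertex_labelling; congr (_ && _).
apply/forallP/forallP => H s; have {}H := H s.
  have /existsP[t /eqP E] := H; have := valP t.
  by rewrite -[val t]/(ij t) E type2_pairE.
apply/existsP; have Hij : type2_pair (y s, y (next s)) by rewrite type2_pairE.
by exists (Sub _ Hij); rewrite /ij SubK.
Qed.

Lemma labelling_chequering (y : {ffun side G -> 'I_(M + N)}) :
  vertex_labelling ij y -> exists c, @chequering n G c /\ forall s, c (start s) = (y s < M)%N.
Proof.
rewrite vertex_labelling_type2 => /andP[/forallP yt /forallP yn].
(* All corners at a vertex carry the same label, so the colour can be read off from any of them. *)
exists (fun v : {set side G} => [exists s in v, (y s < M)%N]).
have E s : [exists t in start s, (y t < M)%N] = (y s < M)%N.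
  apply/exists_inP/idP => [[t ts]|]; last by exists s; rewrite // inE connect0.
  suff -> : y s = y t by [].
  apply: start_inj_fun => [u|]; first by apply/eqP.
  apply/setP => u; move: ts; rewrite !inE => ts; apply: same_connect => //.
  exact/fconnect_sym/turn_inj.
by split=> [s|//]; rewrite !E.
Qed.

(** The sum modulo 2 of two chequerings is invariant under [next] and [glue], hence constant. *)
Lemma chequering_unique (c d : {set side G} -> bool) :
  chequering c -> chequering d ->
  (forall s, d (start s) = c (start s)) \/ (forall s, d (start s) = ~~ c (start s)).
Proof.
move=> Hc Hd; pose e s := d (start s) (+) c (start s).
have gl (c' : {set side G} -> bool) s : chequering c' ->
    c' (start (glue s : side G)) = ~~ c' (start s).
  move=> H; have := H s; have := start_turn (glue s : side G); rewrite /turn glueK => ->.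
  by case: (c' _); case: (c' _).
have nx (c' : {set side G} -> bool) s : chequering c' ->
    c' (start (next s)) = ~~ c' (start s).
  by move=> H; have := H s; case: (c' _); case: (c' _).
have ec s t : e s = e t.
  apply: side_const => {s t} s; rewrite /e.
    by rewrite !nx // addNb addbN negbK.
  by rewrite !gl // addNb addbN negbK.
have [a] : exists a : polygon G, true by case/card_gt0P: (polygon_gt0 G) => a; exists a.
pose s0 : side G := (a, Ordinal n_gt0).
case E0 : (e s0); [right|left] => s; have := ec s s0; rewrite E0 /e;
  by case: (d _); case: (c _).
Qed.

Let coloured (c : {set side G} -> bool) :=
  [pred y : {ffun side G -> 'I_(M + N)} | [forall s, y (turn s) == y s] &&
    [forall s, (y s < M)%N == c (start s)]].

Lemma card_coloured (i0 : 'I_(M + N)) c :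
  #|coloured c| = (M ^ nb_coloured c true * N ^ nb_coloured c false)%N.
Proof.
rewrite (card_labellings i0 (fun v i => (i < M)%N == c v)).
have cM : #|[pred i : 'I_(M + N) | (i < M)%N == true]| = M.
  rewrite -sum1_card big_split_ord /= [X in (_ + X)%N]big1 => [|i]; last first.
    by rewrite inE /= ltnNge leq_addr.
  rewrite addn0 (eq_bigl predT) => [|i]; last by rewrite inE /= ltn_ord.
  by rewrite sum1_card card_ord.
have cN : #|[pred i : 'I_(M + N) | (i < M)%N == false]| = N.
  rewrite -sum1_card big_split_ord /= big1 => [|i]; last by rewrite inE /= ltn_ord.
  rewrite add0n (eq_bigl predT) => [|i]; last by rewrite inE /= ltnNge leq_addr.
  by rewrite sum1_card card_ord.
rewrite (bigID c) /=; congr (_ * _)%N.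
  rewrite (eq_bigr (fun _ => M)) => [|v /andP[_ ->]]; last exact: cM.
  rewrite prod_nat_const; congr (_ ^ _)%N; apply: eq_card => v.
  by rewrite !inE eqb_id.
rewrite (eq_bigr (fun _ => N)) => [|v /andP[_ /negbTE ->]]; last exact: cN.
rewrite prod_nat_const; congr (_ ^ _)%N; apply: eq_card => v.
by rewrite !inE eqbF_neg.
Qed.

(** Labels below M give one colour and the others the second, so a labelling determines a
    chequering. By uniqueness it is c or its complement, whence the two summands; any side shows
    them disjoint. *)
Lemma card_type2 (i0 : 'I_(M + N)) c : @chequering n G c ->
  #|vertex_labelling (G := G) ij| =
  (M ^ nb_coloured c true * N ^ nb_coloured c false +
   M ^ nb_coloured c false * N ^ nb_coloured c true)%N.
Proof.
move=> Hc; pose c' v := ~~ c v.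
have Hc' : chequering c' by move=> s; rewrite /c' (inj_eq negb_inj).
have nbc b : nb_coloured c' b = nb_coloured c (~~ b).
  by apply: eq_card => v; rewrite !inE /c'; case: (c v); case: b.
have := card_coloured i0 c'; rewrite !nbc /= => <-; rewrite -card_coloured //.
rewrite -cardUI [X in _ = (_ + X)%N]eq_card0 ?addn0 => [|y]; last first.
  rewrite !inE; apply/negP => /andP[/andP[_ /forallP H1] /andP[_ /forallP H2]].
  have [a] : exists a : polygon G, true by case/card_gt0P: (polygon_gt0 G) => a; exists a.
  have := H1 (a, Ordinal n_gt0); have := H2 (a, Ordinal n_gt0).
  by rewrite /c' => /eqP ->; case: (c _).
apply: eq_card => y; rewrite !inE -[y \in _]/(vertex_labelling ij y).
rewrite vertex_labelling_type2 -andb_orr.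
case: (boolP [forall s, y (turn s) == y s]) => //= yt.
apply/forallP/orP => [H|H s].
  have [|d [Hd dE]] := @labelling_chequering y.
    by rewrite vertex_labelling_type2 yt /=; apply/forallP.
  case: (chequering_unique Hc Hd) => E; [left|right]; apply/forallP => s.
    by rewrite -dE E.
  by rewrite -dE E.
by case: H => /forallP H; rewrite (eqP (H s)) (eqP (H (next s))); [apply: Hc|apply: Hc'].
Qed.

Lemma partition_function_type2 (K : fieldType) (beta : K) :
  (1 <= M + N)%N -> (n - 2)./2%:R * beta != 0 ->
  (~ chequered G -> partition_function (type2_weights n M N beta) G = 0) /\
  (forall c, @chequering n G c ->
     partition_function (type2_weights n M N beta) G =
     (M%:R ^+ nb_coloured c true * N%:R ^+ nb_coloured c false +
      M%:R ^+ nb_coloured c false * N%:R ^+ nb_coloured c true) *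
     ((n - 2)./2%:R * beta) ^ ((nb_polygons G)%:Z - (nb_edges G)%:Z)).
Proof.
move=> MN; set e := _ * beta => e0.
have i0 : 'I_(M + N) by case: (M + N)%N MN => // q _; exact: ord0.
rewrite partition_function_loop card_loop_valid; last exact: val_inj.
split=> [nc|c Hc].
  rewrite (eq_card0 (A := vertex_labelling (G := G) ij)) ?mulr0 // => y.
  by apply/negP => /labelling_chequering[c [Hc _]]; apply: nc; exists c.
rewrite (card_type2 i0 Hc) natrD !natrM !natrX mulrC; congr (_ * _).
by rewrite expfzDr // -exprnN exprVn.
Qed.
End Type2.
End LoopModels.

(** * The algebra of a flip-invariant model *)

Section MultilinearExtension.
Variables (K : fieldType) (T : finType).
Local Notation V := {ffun T -> K^o}.
Implicit Types (f : seq T -> K) (s : seq V) (w : seq T).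

(** Multilinear extension of f from words in the variables to words in K^T, for all lengths at
    once. *)
Fixpoint mext f s : K :=
  if s is v :: s' then \sum_t v t * mext (fun w => f (t :: w)) s' else f [::].

Definition ebase (t : T) : V := [ffun t' => (t' == t)%:R].

Lemma mext_lin f s1 s2 (a : K) (u v : V) :
  mext f (s1 ++ (a *: u + v) :: s2) = a * mext f (s1 ++ u :: s2) + mext f (s1 ++ v :: s2).
Proof.
elim: s1 f => [|x s1 IH] f /=.
  rewrite mulr_sumr -big_split; apply: eq_bigr => t _ /=.
  by rewrite !ffunE mulrDl -mulrA.
rewrite mulr_sumr -big_split; apply: eq_bigr => t _ /=.
by rewrite IH mulrDr mulrCA.
Qed.

Lemma sum_ebase (F : T -> K) t : \sum_t' ebase t t' * F t' = F t.
Proof.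
rewrite (bigD1 t) //= ffunE eqxx mul1r big1 ?addr0 // => t' /negbTE nt.
by rewrite ffunE nt mul0r.
Qed.

Lemma mext_ebase f w : mext f (map ebase w) = f w.
Proof. by elim: w f => [|t w IH] f //=; rewrite sum_ebase IH. Qed.

Lemma ffun_ebase (v : V) : v = \sum_t v t *: ebase t.
Proof.
apply/ffunP => t; rewrite sum_ffunE (bigD1 t) //= !ffunE eqxx.
rewrite [_ *: _]mulr1 big1 ?addr0 // => t' nt.
by rewrite !ffunE eq_sym (negbTE nt) [_ *: _]mulr0.
Qed.

Lemma mext_eq f g s : (forall w, size w = size s -> f w = g w) -> mext f s = mext g s.
Proof.
elim: s f g => [|v s IH] f g H /=; first by apply: H.
by apply: eq_bigr => t _; congr (_ * _); apply: IH => w Hw; apply: H; rewrite /= Hw.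
Qed.

Lemma mext_rcons f s v :
  mext f (rcons s v) = \sum_t v t * mext (fun w => f (rcons w t)) s.
Proof.
elim: s f => [|x s IH] f //=.
under eq_bigr do rewrite IH mulr_sumr.
rewrite exchange_big; apply: eq_bigr => t _; rewrite mulr_sumr.
by apply: eq_bigr => t' _; rewrite mulrCA.
Qed.

Lemma mext_rot f s v : (forall w, size w = (size s).+1 -> f (rot 1 w) = f w) ->
  mext f (rcons s v) = mext f (v :: s).
Proof.
move=> H; rewrite mext_rcons /=; apply: eq_bigr => t _; congr (_ * _).
by apply: mext_eq => w Hw; rewrite -rot1_cons H //= Hw.
Qed.

Lemma multilinear_mext (Phi : seq V -> K) s0 s :
  (forall s1 s2 (a : K) u v, Phi (s1 ++ (a *: u + v) :: s2) =
     a * Phi (s1 ++ u :: s2) + Phi (s1 ++ v :: s2)) ->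
  Phi (s0 ++ s) = mext (fun w => Phi (s0 ++ map ebase w)) s.
Proof.
move=> lin; elim: s s0 => [|v s IH] s0 //=.
have Phi0 s1 s2 : Phi (s1 ++ 0 :: s2) = 0.
  by have := lin s1 s2 (-1) 0 0; rewrite scaler0 addr0 mulN1r addNr.
rewrite {1}(ffun_ebase v) (big_morph (fun u => Phi (s0 ++ u :: s)) (id1 := 0) (op1 := +%R)) //.
  apply: eq_bigr => t _; rewrite -[_ *: _]addr0 lin Phi0 addr0; congr (_ * _).
  by rewrite -cat_rcons IH; apply: mext_eq => w _; rewrite cat_rcons.
by move=> u w; rewrite -[u]scale1r lin mul1r scale1r.
Qed.

End MultilinearExtension.

Section ModelAlgebra.
Variables (K : fieldType) (p : nat) (W : weights K).
Hypothesis p_gt0 : (0 < p)%N.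
Hypothesis W_model : ngon_model p.+2 W.
Hypothesis W_flip : flip_invariant p.+2 W.
Local Notation T := (var W).
Local Notation V := {ffun T -> K^o}.
Local Notation e := (@ebase K T).

Let g i j : K := invmx (qmatrix W) (enum_rank (i : T)) (enum_rank (j : T)).
Let Gam := mext (@gamma K W).

Let gq i k : \sum_j g i j * qweight j k = (i == k)%:R.
Proof.
case: W_model => _ _ qu.
have := congr1 (fun M : 'M_ _ => M (enum_rank i) (enum_rank k)) (mulVmx qu).
rewrite !mxE (inj_eq enum_rank_inj) => <-.
rewrite (reindex (@enum_rank T)) /=; last by apply: onW_bij; apply: enum_rank_bij.
by apply: eq_bigr => j _; rewrite !mxE !enum_rankK.
Qed.

Let qC (i j : T) : qweight i j = qweight j i.
Proof. by case: W_model. Qed.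

Let gC i j : g i j = g j i.
Proof.
suff qT : (qmatrix W)^T = qmatrix W.
  by rewrite /g -{1}qT -trmx_inv [LHS]mxE.
by apply/matrixP => a b; rewrite !mxE qC.
Qed.

Let qg i k : \sum_j qweight (i : T) j * g j k = (i == k)%:R.
Proof.
by rewrite eq_sym -gq; apply: eq_bigr => j _; rewrite mulrC qC gC.
Qed.

Definition mform (u v : V) : K := \sum_i \sum_j u i * v j * g i j.
Definition mbr (s : seq V) : V := [ffun t => \sum_r Gam (rcons s (e r)) * qweight r t].

Lemma mformC u v : mform u v = mform v u.
Proof.
rewrite /mform exchange_big; apply: eq_bigr => i _; apply: eq_bigr => j _.
by rewrite gC [u _ * _]mulrC.
Qed.

Lemma mform_lin w (a : K) u v : mform (a *: u + v) w = a * mform u w + mform v w.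
Proof.
rewrite /mform mulr_sumr -big_split; apply: eq_bigr => i _ /=.
rewrite mulr_sumr -big_split; apply: eq_bigr => j _ /=.
by rewrite !ffunE !mulrDl -!mulrA.
Qed.

Lemma mform_dual (f : T -> K) v : mform v [ffun j => \sum_i f i * qweight i j] = \sum_i v i * f i.
Proof.
apply: eq_bigr => i _.
under eq_bigr do rewrite ffunE mulrAC -mulrA.
rewrite -mulr_sumr; congr (_ * _).
transitivity (\sum_k f k * \sum_j qweight k j * g j i).
  under [RHS]eq_bigr do rewrite mulr_sumr.
  rewrite exchange_big; apply: eq_bigr => j _; rewrite mulr_sumr.
  by apply: eq_bigr => k _; rewrite (gC j i) mulrC mulrA.
under eq_bigr do rewrite qg.
rewrite (bigD1 i) //= eqxx mulr1 big1 ?addr0 // => k /negbTE ki.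
by rewrite ki mulr0.
Qed.

Lemma mform_br s w : mform (mbr s) w = Gam (rcons s w).
Proof.
rewrite mformC mform_dual /Gam mext_rcons; apply: eq_bigr => t _; congr (_ * _).
by rewrite mext_rcons sum_ebase.
Qed.

Lemma mbr_lin s1 s2 (a : K) (u v : V) :
  mbr (s1 ++ (a *: u + v) :: s2) = a *: mbr (s1 ++ u :: s2) + mbr (s1 ++ v :: s2).
Proof.
apply/ffunP => t; rewrite !ffunE scaler_sumr -big_split; apply: eq_bigr => r _.
by rewrite !rcons_cat /= /Gam mext_lin mulrDl -mulrA.
Qed.

Lemma mform_nondeg v : (forall w, mform v w = 0) -> v = 0.
Proof.
move=> H; apply/ffunP => t; rewrite !ffunE.
have := H [ffun j => \sum_i (i == t)%:R * qweight i j]; rewrite mform_dual.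
rewrite (bigD1 t) //= eqxx mulr1 big1 ?addr0 // => i /negbTE ->.
by rewrite mulr0.
Qed.

Lemma mform_riesz (f : V -> K) : (forall (a : K) u v, f (a *: u + v) = a * f u + f v) ->
  exists w, forall v, f v = mform v w.
Proof.
move=> lin; exists [ffun j => \sum_i f (e i) * qweight i j] => v.
have f0 : f 0 = 0.
  by have := lin (-1) 0 0; rewrite scaler0 addr0 mulN1r addNr.
rewrite mform_dual {1}(ffun_ebase v) (big_morph f (id1 := 0) (op1 := +%R)) //.
  by apply: eq_bigr => i _; rewrite -[_ *: _]addr0 lin f0 addr0.
by move=> u w; rewrite -[u]scale1r lin mul1r scale1r.
Qed.

Lemma mbr_cyc u s v : size s = p -> mform (mbr (u :: s)) v = mform (mbr (rcons s v)) u.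
Proof.
move=> Hs; rewrite !mform_br /= /Gam [RHS]mext_rot //.
move=> w; rewrite size_rcons Hs => Hw.
by case: W_model => H _ _; apply: H.
Qed.

(** The weight of two n-gons glued along one side, as a function of 2p + 2 vectors. On basis words
    it is [flip_sum], so flip invariance becomes its cyclic symmetry. *)
Let Phi s := mform (mbr (take p.+1 s)) (mbr (drop p.+1 s)).

Let Phi_lin s1 s2 (a : K) u v : Phi (s1 ++ (a *: u + v) :: s2) =
  a * Phi (s1 ++ u :: s2) + Phi (s1 ++ v :: s2).
Proof.
rewrite /Phi !take_cat !drop_cat; case: ltnP => Hs.
  by rewrite mbr_lin mformC mform_lin mformC; congr (_ + _); rewrite mformC.
case E : (p.+1 - size s1)%N => [|k] /=.
  by rewrite !cats0 (mbr_lin [::]) mformC mform_lin; congr (a * _ + _); rewrite mformC.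
by rewrite mbr_lin mform_lin.
Qed.

Let Phi_flip w : size w = (2 * p.+2 - 2)%N -> Phi (map e w) = @flip_sum K p.+2 W w.
Proof.
move=> Hw; rewrite /Phi -map_take -map_drop mform_br.
rewrite /Gam mext_rcons; apply: eq_bigr => t _.
rewrite mext_ebase ffunE mulr_suml; apply: eq_bigr => r _ /=.
rewrite -map_rcons /Gam mext_ebase.
have -> : gamma (rcons (drop p.+1 w) r) = gamma (r :: drop p.+1 w).
  rewrite -rot1_cons; case: W_model => H _ _; apply: H.
  by rewrite /= size_drop Hw; lia.
by rewrite qC mulrC mulrA mulrAC.
Qed.

Let Phi_rot s1 s2 : (size s1 + size s2 = 2 * p.+2 - 2)%N -> Phi (s1 ++ s2) = Phi (s2 ++ s1).
Proof.
elim: s1 s2 => [|v s1 IH] s2 /= Hs; first by rewrite cats0.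
rewrite -cat_rcons -IH ?size_rcons; last by lia.
have E s : size s = (2 * p.+2 - 2)%N -> Phi s = mext (@flip_sum K p.+2 W) s.
  move=> Hs'; rewrite -[in LHS](cat0s s) (multilinear_mext [::] s Phi_lin).
  by apply: mext_eq => w Hw; apply: Phi_flip; rewrite Hw.
rewrite -rcons_cat !E /= ?size_rcons ?size_cat; try lia.
rewrite mext_rot // => w Hw.
by rewrite W_flip // Hw size_cat; lia.
Qed.

(** Paired with any w, both sides are values of [Phi] at rotations of the word s1, t, s2, w. *)
Lemma mbr_assoc s1 t s2 : size t = p.+1 -> (size s1 + size s2 = p)%N ->
  mbr (s1 ++ mbr t :: s2) =
  mbr (mbr (take p.+1 (s1 ++ t ++ s2)) :: drop p.+1 (s1 ++ t ++ s2)).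
Proof.
move=> Ht Hs.
suff H w : mform (mbr (s1 ++ mbr t :: s2)) w = Phi (s1 ++ t ++ rcons s2 w).
  set r := s1 ++ t ++ s2.
  have Hr : size r = (p.+1 + p)%N by rewrite !size_cat; lia.
  suff H' w : mform (mbr (mbr (take p.+1 r) :: drop p.+1 r)) w = Phi (rcons r w).
    have E w : mform (mbr (s1 ++ mbr t :: s2)) w =
        mform (mbr (mbr (take p.+1 r) :: drop p.+1 r)) w.
      by rewrite H H' /r !rcons_cat.
    apply/eqP; rewrite -subr_eq0; apply/eqP; apply: mform_nondeg => w.
    by rewrite addrC -scaleN1r mform_lin E mulN1r addNr.
  rewrite mbr_cyc; last by rewrite size_drop Hr; lia.
  have lt : (p.+1 < p.+1 + p)%N by lia.
  by rewrite mformC /Phi -!cats1 take_cat drop_cat Hr lt.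
have Hrot : mform (mbr (s1 ++ mbr t :: s2)) w = mform (mbr (s2 ++ w :: s1)) (mbr t).
  elim/last_ind: s1 s2 Hs (mbr t) w => [|s1 u IH] s2 /= Hs x w.
    by rewrite mbr_cyc // -cats1.
  move: Hs; rewrite size_rcons => Hs.
  rewrite cat_rcons IH /=; last by lia.
  by rewrite mbr_cyc ?size_cat /= ?rcons_cat //=; lia.
rewrite Hrot -cat_rcons Phi_rot ?size_cat ?size_rcons; last by lia.
rewrite -catA Phi_rot ?size_cat ?size_rcons; last by lia.
by rewrite /Phi -catA catA take_size_cat ?drop_size_cat ?size_cat ?size_rcons //; lia.
Qed.

Definition model_algebra : flip_algebra K p :=
  @FlipAlgebra K p V mform mbr p_gt0 mbr_lin mform_lin mformC mform_nondeg
    mform_riesz mbr_cyc mbr_assoc.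

Lemma model_gamma (w : seq T) r : size w = p.+1 ->
  gamma (rcons w r) = form (br (map e w : seq model_algebra)) (e r : model_algebra).
Proof. by move=> Hw; rewrite /= mform_br -map_rcons /Gam mext_ebase. Qed.

Lemma model_coord (v : model_algebra) t :
  form v ([ffun j => qweight t j] : model_algebra) = (v : V) t.
Proof.
rewrite /=.
have -> : ([ffun j => qweight t j] : V) = [ffun j => \sum_i (i == t)%:R * qweight i j].
  apply/ffunP => j; rewrite !ffunE (bigD1 t) //= eqxx mul1r big1 ?addr0 // => i /negbTE ->.
  by rewrite mul0r.
rewrite mform_dual (bigD1 t) //= eqxx mulr1 big1 ?addr0 // => i /negbTE ->.
by rewrite mulr0.
Qed.

Lemma model_tensor (t t' : T) :
  form ([ffun j => qweight t j] : model_algebra)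
       ([ffun j => qweight t' j] : model_algebra) = qweight t t'.
Proof. by rewrite model_coord ffunE. Qed.

End ModelAlgebra.

(** * Models read off from families of vectors *)

Section Families.
Variables (K : fieldType) (p : nat) (A : flip_algebra K p).
Implicit Types (u v w : A).
Let p_gt0 : (0 < p)%N := arity_gt0 A.

(* This is Gamma; only its values on sequences of length p.+2 are meaningful. *)
Definition cyclic_form (s : seq A) : K := form (br (take p.+1 s)) (nth 0 s p.+1).

Lemma cyclic_formE s v : size s = p.+1 -> cyclic_form (rcons s v) = form (br s) v.
Proof.
move=> Hs; rewrite /cyclic_form nth_rcons Hs ltnn eqxx -cats1 take_cat Hs ltnn.
by rewrite subnn cats0.
Qed.

Lemma cyclic_form_rot s : size s = p.+2 -> cyclic_form (rot 1 s) = cyclic_form s.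
Proof.
case: s => [//|u s]; case/lastP: s => [//|s v] /=; rewrite size_rcons => -[Hs].
rewrite rot1_cons -rcons_cons !cyclic_formE /= ?size_rcons ?Hs //.
by rewrite br_cyc.
Qed.

Lemma cyclic_form_rotn m s : size s = p.+2 -> cyclic_form (rot m s) = cyclic_form s.
Proof.
elim: m s => [|m IH] s Hs; first by rewrite rot0.
have [lt|ge] := ltnP m (size s); last by rewrite rot_oversize // ltnW.
by rewrite -addn1 rotD ?addn1 // IH ?size_rot // cyclic_form_rot.
Qed.

Lemma cyclic_form_lin s1 s2 (a : K) u v : (size s1 + size s2).+1 = p.+2 ->
  cyclic_form (s1 ++ (a *: u + v) :: s2) =
  a * cyclic_form (s1 ++ u :: s2) + cyclic_form (s1 ++ v :: s2).
Proof.
case/lastP: s2 => [|s2 w].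
  by rewrite !cats1 addn0 => -[Hs]; rewrite !cyclic_formE // form_linr.
rewrite size_rcons -!rcons_cons -!rcons_cat => -[Hs].
by rewrite !cyclic_formE ?size_cat //= br_lin form_lin.
Qed.

Definition family_weights (T : finType) (h : T -> A) (q : T -> T -> K) : weights K :=
  @Weights K T (fun s => cyclic_form (map h s)) q.

(** The sum of the q s t times h_s tensor h_t is the tensor inverse to the form; h may be any finite
    family with this property. *)
Definition tensor_eq (T : finType) (h : T -> A) (q : T -> T -> K) :=
  forall v w, \sum_(s : T) \sum_(t : T) q s t * (form (h s) v * form (h t) w) = form v w.

Definition double_form (s : seq A) : K := form (br (take p.+1 s)) (br (drop p.+1 s)).

(** This is the flip inside A: before and after a rotation by one letter, the value is the form of a
    bracketing of one and the same word with a fixed letter y, and [br_eq] compares the two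
    bracketings. *)
Lemma double_form_rot m s : size s = (2 * p.+2 - 2)%N ->
  double_form (rot m s) = double_form s.
Proof.
have rot1 (r : seq A) : size r = (2 * p.+2 - 2)%N -> double_form (rot 1 r) = double_form r.
  case: r => [//|x r] Hr; rewrite rot1_cons /double_form.
  move: Hr => /= Hr; have lt : (p < size r)%N by lia.
  have Et : size (take p r) = p by rewrite size_takel; lia.
  have E : rcons r x = take p r ++ nth 0 r p :: rcons (drop p.+1 r) x.
    by rewrite -rcons_cons -(drop_nth 0 lt) -rcons_cat cat_take_drop.
  have Es : size (drop p.+1 r) = p by rewrite size_drop; lia.
  have -> : take p.+1 (rcons r x) = rcons (take p r) (nth 0 r p).
    by rewrite E -cat_rcons take_size_cat // size_rcons Et.
  have -> : drop p.+1 (rcons r x) = rcons (drop p.+1 r) x.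
    by rewrite E -cat_rcons drop_size_cat // size_rcons Et.
  have -> : drop p r = nth 0 r p :: drop p.+1 r by rewrite (drop_nth 0 lt).
  set y := nth 0 r p; set a := take p r in Et *; set b := drop p.+1 r in Es *.
  rewrite -(br_cyc (br (rcons b x)) y Et) [RHS]formC (br_cyc y (br (x :: a)) Es).
  congr (form _ y); rewrite -[rcons b (br _)]cats1.
  by apply: (@br_eq _ _ _ [::] _ a b _ [::]);
    rewrite /= ?size_rcons ?cats0 ?cat_rcons ?Et ?Es ?addn0.
elim: m s => [|m IH] s Hs; first by rewrite rot0.
have [lt|ge] := ltnP m (size s); last by rewrite rot_oversize // ltnW.
by rewrite -addn1 rotD ?addn1 // IH ?size_rot // rot1.
Qed.

(** The brackets may leave the span of b by vectors of N: these are orthogonal to b and to each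
    other, so no pairing sees them. N is J for a subquotient and 0 for an orthogonal summand. *)
Lemma submodel (T : finType) (b : T -> A) (q : T -> T -> K) (N : A -> Prop) :
  (forall s t, q s t = q t s) ->
  (forall r s, \sum_t q s t * form (b r) (b t) = (r == s)%:R) ->
  (forall u t, N u -> form u (b t) = 0) ->
  (forall u v, N u -> N v -> form u v = 0) ->
  (forall s : seq T, size s = p.+1 -> exists (c : T -> K) u,
     N u /\ br (map b s) = \sum_t c t *: b t + u) ->
  ngon_model p.+2 (family_weights b q) /\ flip_invariant p.+2 (family_weights b q).
Proof.
move=> qC qG Nb NN Nbr; split.
  split=> //=.
  - by move=> s Hs; rewrite map_rot cyclic_form_rot // size_map.
  - pose G : 'M[K]_#|T| := \matrix_(i, j) form (b (enum_val i)) (b (enum_val j)).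
    suff /mulmx1_unit[] : qmatrix (family_weights b q) *m G = 1%:M by [].
    apply/matrixP => i j; rewrite !mxE.
    rewrite (reindex (@enum_rank T)) /=; last by apply: onW_bij; apply: enum_rank_bij.
    rewrite -(inj_eq enum_val_inj) eq_sym -qG; apply: eq_bigr => t _.
    by rewrite !mxE enum_rankK formC.
have E s : size s = (2 * p.+2 - 2)%N ->
    @flip_sum K p.+2 (family_weights b q) s = double_form (map b s).
  move=> Hs; rewrite /flip_sum /= /double_form -map_take -map_drop.
  have H1 : size (take p.+1 s) = p.+1 by rewrite size_takel; lia.
  have H2 : size (drop p.+1 s) = p.+1 by rewrite size_drop; lia.
  set s1 := take _ s in H1 *; set s2 := drop _ s in H2 *.
  have [c [u [Nu Eu]]] := Nbr _ H1; have [d [v [Nv Ev]]] := Nbr _ H2.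
  have -> : form (br (map b s1)) (br (map b s2)) =
      \sum_x \sum_y c x * d y * form (b x) (b y).
    have fN (f : T -> K) (w : A) : N w -> form (\sum_t f t *: b t) w = 0.
      move=> Nw; rewrite form_suml big1 // => t _.
      by rewrite formZl formC Nb ?mulr0.
    rewrite Eu Ev formDl !formDr (NN _ _ Nu Nv) (fN c v Nv) [form u _]formC (fN d u Nu) !addr0.
    rewrite form_suml; apply: eq_bigr => x _; rewrite form_sumr; apply: eq_bigr => y _.
    by rewrite formZl formZr mulrA.
  have fb (w : A) (f : T -> K) : N w -> forall t,
      form (\sum_x f x *: b x + w) (b t) = \sum_x f x * form (b x) (b t).
    move=> Nw t; rewrite formDl (Nb _ _ Nw) addr0 form_suml; apply: eq_bigr => x _.
    by rewrite formZl.
  transitivity (\sum_r \sum_t (\sum_x c x * form (b x) (b r)) * q r t *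
      (\sum_y d y * form (b y) (b t))).
    apply: eq_bigr => r _; apply: eq_bigr => t _; congr (_ * _ * _).
      by rewrite map_rcons cyclic_formE ?size_map // Eu fb.
    rewrite -cyclic_form_rot ?rot1_cons ?cyclic_formE ?size_map //= ?size_map ?H2 //.
    by rewrite Ev fb.
  transitivity (\sum_t \sum_x c x * (x == t)%:R * (\sum_y d y * form (b y) (b t))).
    rewrite exchange_big; apply: eq_bigr => t _; rewrite -!mulr_suml.
    congr (_ * _).
    under eq_bigr do rewrite mulr_suml.
    rewrite exchange_big; apply: eq_bigr => x _; rewrite -qG mulr_sumr.
    by apply: eq_bigr => r _; rewrite -mulrA [q t r]qC [q r t * _]mulrC.
  rewrite exchange_big; apply: eq_bigr => x _; rewrite (bigD1 x) //= eqxx mulr1.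
  rewrite [X in _ + X]big1 ?addr0 => [|t /negbTE tx]; last by rewrite eq_sym tx mulr0 mul0r.
  by rewrite mulr_sumr; apply: eq_bigr => y _; rewrite mulrA formC.
move=> s Hs m; rewrite !E ?size_rot // map_rot double_form_rot // size_map.
by [].
Qed.

Definition family_basis (T : finType) (h : T -> A) (U : {vspace A}) :=
  [/\ forall t, h t \in U, forall v, v \in U -> exists c, v = \sum_t c t *: h t
    & forall c, \sum_t c t *: h t = 0 -> forall t, c t = 0].

Lemma vbasis_family (U : {vspace A}) :
  family_basis (fun i : 'I_(\dim U) => (vbasis U)`_i) U.
Proof.
split=> [i|v vU|].
- by apply/vbasis_mem/mem_nth; rewrite size_tuple.
- by exists (fun i => coord (vbasis U) i v); apply: coord_vbasis.
- by apply/freeP; apply: basis_free (vbasisP U).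
Qed.

Lemma family_basis_sum (T1 T2 : finType) (h1 : T1 -> A) (h2 : T2 -> A) U1 U2 :
  family_basis h1 U1 -> family_basis h2 U2 -> (U1 :&: U2 = 0)%VS ->
  family_basis (fun t : T1 + T2 => match t with inl t => h1 t | inr t => h2 t end)
    (U1 + U2)%VS.
Proof.
move=> [m1 s1 f1] [m2 s2 f2] U0; split.
- move=> [t|t]; first exact: (subvP (addvSl _ _)).
  exact: (subvP (addvSr _ _)).
- move=> _ /memv_addP[u /s1[c1 ->] [v /s2[c2 ->] ->]].
  exists (fun t => match t with inl t => c1 t | inr t => c2 t end).
  by rewrite big_sumType.
- move=> c; rewrite big_sumType /= => /eqP; rewrite addr_eq0 => /eqP E.
  set u := \sum_t c (inl t) *: h1 t in E.
  have u0 : u = 0.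
    apply/eqP; rewrite -memv0 -U0 memv_cap; apply/andP; split.
      by apply: memv_suml => t _; apply: memvZ.
    by rewrite E memvN; apply: memv_suml => t _; apply: memvZ.
  move=> [t|t]; first exact: (f1 _ u0).
  apply: (f2 (fun t => c (inr t))).
  by move: E; rewrite u0 => /esym/eqP; rewrite oppr_eq0 => /eqP.
Qed.

Lemma dual_family (T : finType) (h : T -> A) : family_basis h fullv ->
  exists w : T -> A, (forall s t, form (h s) (w t) = (s == t)%:R) /\
    forall v, v = \sum_t form v (w t) *: h t.
Proof.
move=> [_ sp fr].
have [c Hc] : {c : A -> T -> K & forall v, v = \sum_t c v t *: h t}.
  by apply: (choice (P := fun v c => v = \sum_t c t *: h t)) => v; apply: sp; apply: memvf.
have uniq v d : v = \sum_t d t *: h t -> forall t, c v t = d t.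
  move=> Hd t; apply/eqP; rewrite -subr_eq0; apply/eqP.
  apply: (fr (fun t => c v t - d t)).
  under eq_bigr do rewrite scalerBl.
  by rewrite sumrB -Hc -Hd subrr.
have [w Hw] : {w : T -> A & forall t v, c v t = form v (w t)}.
  apply: (choice (P := fun t w => forall v, c v t = form v w)) => t.
  apply: form_riesz => a u v; apply: (uniq _ (fun t => a * c u t + c v t)).
  under eq_bigr do rewrite scalerDl -scalerA.
  by rewrite big_split /= -scaler_sumr -!Hc.
exists w; split=> [s t|v]; last by rewrite {1}(Hc v); apply: eq_bigr => t _; rewrite Hw.
rewrite -Hw; apply: (uniq _ (fun t => (s == t)%:R)).
rewrite (bigD1 s) //= eqxx scale1r big1 ?addr0 // => t' /negbTE ns.
by rewrite eq_sym ns scale0r.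
Qed.

Lemma dual_tensor (T : finType) (h w : T -> A) :
  (forall v, v = \sum_t form v (w t) *: h t) ->
  tensor_eq h (fun s t => form (w s) (w t)).
Proof.
move=> Hw u v; rewrite exchange_big /=.
transitivity (\sum_t form (w t) u * form (h t) v).
  apply: eq_bigr => t _; rewrite [in RHS](Hw (w t)) form_suml mulr_suml.
  by apply: eq_bigr => s _; rewrite formZl [form (w s) _]formC mulrA.
rewrite [RHS](_ : _ = form (\sum_t form u (w t) *: h t) v); last by rewrite -Hw.
by rewrite form_suml; apply: eq_bigr => t _; rewrite formZl formC.
Qed.

(** A functional separating v from U is represented by a vector w, which contradicts the
    hypothesis. *)
Lemma biorthogonal (U : {vspace A}) v :
  (forall w, (forall u, u \in U -> form u w = 0) -> form v w = 0) -> v \in U.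
Proof.
move=> H; apply: contrapT => /negP /separating_functional[f [f_lin fU fv]].
have [w Hw] := form_riesz f_lin.
by apply: fv; rewrite Hw H // => u /fU; rewrite Hw.
Qed.

(** Rotate v to the end: the bracket of the other letters contains u, so it lies in P and is
    orthogonal to v. *)
Lemma cyclic_form_ideal (P : A -> Prop) s1 s2 s3 u v : ideal P ->
  (size s1 + size s2 + size s3 = p)%N ->
  P u -> (forall w, P w -> form w v = 0) ->
  cyclic_form (s1 ++ u :: s2 ++ v :: s3) = 0 /\ cyclic_form (s1 ++ v :: s2 ++ u :: s3) = 0.
Proof.
move=> [_ iP] Hs Pu Pv; split.
  rewrite -(cyclic_form_rotn (size (s1 ++ u :: s2 ++ [:: v]))); last first.
    by rewrite !size_cat /= !size_cat /=; lia.
  have -> : s1 ++ u :: s2 ++ v :: s3 = (s1 ++ u :: s2 ++ [:: v]) ++ s3 by cat_right.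
  rewrite rot_size_cat.
  have -> : s3 ++ s1 ++ u :: s2 ++ [:: v] = rcons ((s3 ++ s1) ++ u :: s2) v by cat_right.
  rewrite cyclic_formE; last by rewrite !size_cat /=; lia.
  by apply: Pv; apply: iP => //; rewrite size_cat; lia.
rewrite -(cyclic_form_rotn (size (s1 ++ [:: v]))); last first.
  by rewrite !size_cat /= !size_cat /=; lia.
have -> : s1 ++ v :: s2 ++ u :: s3 = (s1 ++ [:: v]) ++ s2 ++ u :: s3 by cat_right.
rewrite rot_size_cat.
have -> : (s2 ++ u :: s3) ++ s1 ++ [:: v] = rcons (s2 ++ u :: (s3 ++ s1)) v by cat_right.
rewrite cyclic_formE; last by rewrite !size_cat /= size_cat; lia.
by apply: Pv; apply: iP => //; rewrite size_cat; lia.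
Qed.

End Families.

Lemma partition_function_family (K : fieldType) (p : nat) (W : weights K)
    (p_gt0 : (0 < p)%N) (W_model : ngon_model p.+2 W) (W_flip : flip_invariant p.+2 W)
    (T : finType) (h : T -> model_algebra p_gt0 W_model W_flip) (q : T -> T -> K)
    (G : ngonization p.+2) :
  tensor_eq h q -> partition_function (family_weights h q) G = partition_function W G.
Proof.
move=> Hq; pose A := model_algebra p_gt0 W_model W_flip.
pose P (t : T) (y : var W) : K := (h t : {ffun var W -> K^o}) y.
apply: (@partition_function_tensor K p.+2 (family_weights h q) W P) => /=.
  move=> x.
  have hE t : h t = \sum_y (h t : {ffun var W -> K^o}) y *: (ebase K y : A).
    exact: ffun_ebase.
  have E := @multilinear_expand K A T (var W) (@cyclic_form K p A) h (@ebase K (var W))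
    P p.+2
    (fun s1 s2 a u v => @cyclic_form_lin K p A s1 s2 a u v) hE p.+2 x [::] erefl.
  rewrite -map_comp; apply: etrans E _; apply: eq_bigr => y _; congr (_ * _).
  rewrite cat0s.
  have -> : [seq ebase K (y i) | i <- enum 'I_p.+2] =
      map (@ebase K (var W)) [seq y i | i <- enum 'I_p.+2].
    by rewrite -map_comp.
  have : size [seq y i | i <- enum 'I_p.+2] = p.+2 by rewrite size_map size_enum_ord.
  case/lastP: [seq y i | i <- _] => [//|w r]; rewrite size_rcons => -[Hw].
  by rewrite map_rcons cyclic_formE ?size_map // (model_gamma p_gt0 W_model W_flip).
move=> y y'; rewrite -(model_tensor p_gt0 W_model W_flip) -Hq.
apply: eq_bigr => a _; apply: eq_bigr => b _.
by rewrite !model_coord.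
Qed.

(** * Reduction to simple algebras *)

Section Decompositions.
Variable K : fieldType.

Lemma sum_image (X Y : finType) (f : X -> Y) (F : Y -> K) : injective f ->
  (forall y, F y != 0 -> exists x, y = f x) -> \sum_y F y = \sum_x F (f x).
Proof.
move=> f_inj F0; rewrite -(big_imset (h := f) (A := predT) F) /=; last first.
  by move=> ? ? _ _; apply: f_inj.
rewrite [RHS]big_mkcond; apply: eq_bigr => y _; case: ifP => // /negP nf.
apply/eqP; apply: contrapT => /negP /F0[x Ey]; apply: nf.
by rewrite Ey imset_f.
Qed.

Lemma partition_function_ext n (T : finType) (g1 g2 : seq T -> K) (q : T -> T -> K)
    (G : ngonization n) : (forall s, size s = n -> g1 s = g2 s) ->
  partition_function (Weights g1 q) G = partition_function (Weights g2 q) G.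
Proof.
move=> H; apply: eq_bigr => x _; congr (_ * _); apply: eq_bigr => a _.
by apply: H; rewrite size_map size_enum_ord.
Qed.

Lemma ordS_neq n (i : 'I_n) : (2 <= n)%N -> ordS i != i.
Proof.
move=> n2; apply/eqP => /(congr1 val) /=.
have [lt|ge] := ltnP i.+1 n; first by rewrite modn_small //; lia.
have -> : i.+1 = n by apply/eqP; rewrite eqn_leq ge ltn_ord.
by rewrite modnn; have := ltn_ord i; lia.
Qed.

Lemma ordS2_neq n (i : 'I_n) : (3 <= n)%N -> ordS (ordS i) != i.
Proof.
move=> n3; apply/eqP => /(congr1 val) /=.
have [lt|ge] := ltnP i.+1 n.
  rewrite (modn_small lt); have [lt2|ge2] := ltnP i.+2 n; first by rewrite modn_small //; lia.
  have -> : i.+2 = n by apply/eqP; rewrite eqn_leq ge2 lt.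
  by rewrite modnn; lia.
have -> : i.+1 = n by apply/eqP; rewrite eqn_leq ge ltn_ord.
by rewrite modnn modn_small; have := ltn_ord i; lia.
Qed.

(* With J an isotropic ideal, C a complement of its orthogonal and the image of
   iota a complement of J in this orthogonal: an edge joins every side labelled
   in C to one labelled in J, while in a polygon with a nonzero factor a side
   labelled in J is accompanied by n - 1 > 1 sides labelled in C. Hence neither
   occurs. *)
Lemma partition_function_isotropic n (T TB : finType) (g : seq T -> K)
    (q : T -> T -> K) (J C : pred T) (iota : TB -> T) (G : ngonization n) :
  (3 <= n)%N -> injective iota ->
  (forall t, ~~ J t -> ~~ C t -> exists b, t = iota b) ->
  (forall t, J t -> ~~ C t) ->
  (forall (x : 'I_n -> T) i j, i != j -> J (x i) -> ~~ C (x j) ->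
     g [seq x i | i <- enum 'I_n] = 0) ->
  (forall s t, C t -> ~~ J s -> q s t = 0 /\ q t s = 0) ->
  partition_function (Weights g q) G =
  partition_function (Weights (fun s => g (map iota s)) (fun s t => q (iota s) (iota t))) G.
Proof.
move=> n3 iota_inj allB JC g0 q0.
pose f (x : {ffun side G -> TB}) : {ffun side G -> T} := [ffun s => iota (x s)].
rewrite /partition_function (@sum_image _ _ f).
- apply: eq_bigr => x _; congr (_ * _); apply: eq_bigr => a _ /=.
    by congr g; rewrite -map_comp; apply: eq_map => i; rewrite /= ffunE.
  by rewrite !ffunE.
- move=> x y /ffunP E; apply/ffunP => s; apply: iota_inj.
  by have := E s; rewrite !ffunE.
move=> x; rewrite mulf_eq0 negb_or => /andP[/prodf_neq0 /= gx /prodf_neq0 /= qx].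
pose SJ := [set s : side G | J (x s)]; pose SC := [set s : side G | C (x s)].
have CJ (s : side G) : C (x s) -> J (x (glue s : side G)).
  move=> Cs; apply: contrapT => /negP nJ; have [qs0 qs1] := q0 _ _ Cs nJ.
  case: (boolP (s \in edges G)) => [/qx|]; first by rewrite qs1 eqxx.
  by rewrite -edge_glue => /qx; rewrite glueK qs0 eqxx.
have JCx a i j : i != j -> J (x (a, i)) -> C (x (a, j)).
  move=> ij Ji; apply: contrapT => /negP nC.
  by have := gx a isT; rewrite (g0 (fun i => x (a, i)) i j) // eqxx.
have next_inj : injective (@next n G).
  move=> [a i] [b j] /= [-> E]; congr (_, _); apply: ordS_inj; exact: val_inj.
have sub : @next n G @: SJ \subset SC.
  apply/subsetP => _ /imsetP[[a i] sJ ->]; rewrite inE in sJ; rewrite inE.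
  by apply: JCx sJ; rewrite eq_sym ordS_neq //; apply: ltnW.
have cardCJ : (#|SC| <= #|SJ|)%N.
  rewrite -(card_imset (mem SC) (inv_inj (@glueK n G))); apply: subset_leq_card.
  by apply/subsetP => _ /imsetP[s sC ->]; rewrite !inE in sC *; apply: CJ.
(* By this equality of sets, J on the side i puts C on i + 2 and therefore J on i + 1; but i + 1
   carries C as well. *)
have /eqP EC : @next n G @: SJ == SC by rewrite eqEcard sub card_imset.
have noJ s : ~~ J (x s).
  apply/negP; case: s => a i Ji.
  have Ci : C (x (next (next (a, i)))).
    by apply: JCx Ji; rewrite eq_sym ordS2_neq.
  have : next (next (a, i)) \in SC by rewrite inE.
  rewrite -EC => /imsetP[s' sJ /next_inj E]; move: sJ; rewrite -E inE => /JC.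
  by rewrite (JCx a i (ordS i)) // eq_sym ordS_neq //; apply: ltnW.
have noC s : ~~ C (x s) by apply/negP => /CJ; apply/negP/noJ.
have [x' Hx'] : {x' : side G -> TB & forall s, x s = iota (x' s)}.
  by apply: (choice (P := fun s b => x s = iota b)) => s; apply: allB.
by exists [ffun s => x' s]; apply/ffunP => s; rewrite !ffunE.
Qed.

(** In a nonzero term the summand of the label is unchanged by [next], as g vanishes on mixed words,
    and by [glue], as q has no mixed entries; connectedness makes it constant. *)
Lemma partition_function_direct n (T1 T2 : finType) (g : seq (T1 + T2) -> K)
    (q : T1 + T2 -> T1 + T2 -> K) (G : ngonization n) : (0 < n)%N ->
  (forall (x : 'I_n -> T1 + T2) i j t1 t2, x i = inl t1 -> x j = inr t2 ->
     g [seq x i | i <- enum 'I_n] = 0) ->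
  (forall t1 t2, q (inl t1) (inr t2) = 0 /\ q (inr t2) (inl t1) = 0) ->
  partition_function (Weights g q) G =
  partition_function (Weights (fun s => g (map inl s)) (fun s t => q (inl s) (inl t))) G +
  partition_function (Weights (fun s => g (map inr s)) (fun s t => q (inr s) (inr t))) G.
Proof.
move=> n_gt0 g0 q0.
have [a0 _] : exists a : polygon G, true by case/card_gt0P: (polygon_gt0 G) => a; exists a.
pose s0 : side G := (a0, Ordinal n_gt0).
pose f (x : {ffun side G -> T1} + {ffun side G -> T2}) : {ffun side G -> T1 + T2} :=
  match x with inl x => [ffun s => inl (x s)] | inr x => [ffun s => inr (x s)] end.
rewrite /partition_function (@sum_image _ _ f).
- rewrite big_sumType /=; congr (_ + _); apply: eq_bigr => x _; congr (_ * _);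
    apply: eq_bigr => a _ /=; rewrite ?ffunE //;
    by congr g; rewrite -map_comp; apply: eq_map => i; rewrite /= ffunE.
- move=> [x|x] [y|y] /ffunP E; try by (have := E s0; rewrite !ffunE).
    by congr inl; apply/ffunP => s; have := E s; rewrite !ffunE => -[].
  by congr inr; apply/ffunP => s; have := E s; rewrite !ffunE => -[].
move=> x; rewrite mulf_eq0 negb_or => /andP[/prodf_neq0 /= gx /prodf_neq0 /= qx].
pose k s := if x s is inl _ then true else false.
have k_const s t : k s = k t.
  apply: side_const => {s t} s; rewrite /k.
    case: s => a i; rewrite /next /=; have := gx a isT.
    case E1 : (x (a, i)) => [t1|t2]; case E2 : (x (a, ordS i)) => [u1|u2] //.
      by rewrite (g0 (fun i => x (a, i)) i (ordS i) t1 u2) ?eqxx.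
    by rewrite (g0 (fun i => x (a, i)) (ordS i) i u1 t2) ?eqxx.
  case E1 : (x s) => [t1|t2]; case E2 : (x (glue s : side G)) => [u1|u2] //;
    case: (boolP (s \in edges G)) => [/qx|];
    rewrite -?edge_glue ?E1 ?E2 ?(q0 _ _).1 ?(q0 _ _).2 ?eqxx //.
    by move=> /qx; rewrite glueK E1 E2 (q0 _ _).2 eqxx.
  by move=> /qx; rewrite glueK E1 E2 (q0 _ _).1 eqxx.
case E0 : (k s0).
  have [y Hy] : {y : side G -> T1 & forall s, x s = inl (y s)}.
    apply: (choice (P := fun s b => x s = inl b)) => s.
    by have := k_const s s0; rewrite E0 /k; case: (x s) => // t _; exists t.
  by exists (inl [ffun s => y s]); apply/ffunP => s; rewrite !ffunE.
have [y Hy] : {y : side G -> T2 & forall s, x s = inr (y s)}.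
  apply: (choice (P := fun s b => x s = inr b)) => s.
  by have := k_const s s0; rewrite E0 /k; case: (x s) => // t _; exists t.
by exists (inr [ffun s => y s]); apply/ffunP => s; rewrite !ffunE.
Qed.

Lemma loop_weights_model n (T : finType) m (ij : T -> 'I_m * 'I_m) (c : K) :
  injective ij -> (forall t, exists t', ij t' = ((ij t).2, (ij t).1)) -> c != 0 ->
  ngon_model n (loop_weights ij c).
Proof.
move=> ij_inj swap c0; split => /=.
- by move=> s _; rewrite rot_cycle.
- by move=> i j; rewrite mulrAC.
(* q is c^-1 times the permutation matrix that swaps the two indices, so c^2 q is its inverse. *)
suff /mulmx1_unit[] : qmatrix (loop_weights ij c) *m (c ^+ 2 *: qmatrix (loop_weights ij c)) = 1%:M.
  by [].
apply/matrixP => i j; rewrite !mxE.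
rewrite (reindex (@enum_rank T)) /=; last by apply: onW_bij; apply: enum_rank_bij.
set s := enum_val i; set t := enum_val j.
have [s' Hs'] := swap s.
rewrite (bigD1 s') //= !mxE !enum_rankK /= -/s -/t Hs' !eqxx !mulr1 big1 => [|u us].
  rewrite addr0 expr2 -(inj_eq enum_val_inj) -/s -/t.
  have -> : (s == t) = (((ij s).1 == (ij t).1) && ((ij t).2 == (ij s).2)).
    apply/eqP/andP => [->//|[/eqP E1 /eqP E2]]; apply: ij_inj.
    by rewrite [LHS]surjective_pairing E1 -E2 -surjective_pairing.
  rewrite -mulnb natrM !mulrA mulVf // mul1r mulfV // !mul1r.
  by [].
rewrite !mxE !enum_rankK /= -/s.
case: eqP => E1; last by rewrite mulr0 !mul0r.
case: eqP => E2; last by rewrite mulr0 !mul0r.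
by case/eqP: us; apply: ij_inj; rewrite Hs' E1 -E2 -surjective_pairing.
Qed.

End Decompositions.

Section Reduction.
Variables (K : fieldType) (p : nat) (A : flip_algebra K p).
Implicit Types (u v w : A) (P : A -> Prop).

Lemma ideal_orthogonal P : ideal P -> ideal (fun v => forall u, P u -> form u v = 0).
Proof.
move=> [sP iP]; split=> [|s1 v s2 Hs Pv u Pu].
  split=> [u _|a v w Hv Hw u Pu]; first by rewrite form0r.
  by rewrite form_linr Hv // Hw // mulr0 addr0.
rewrite formC br_rot // Pv //; apply: iP => //; lia.
Qed.

Lemma ideal_radical P : ideal P -> ideal (fun v => P v /\ forall u, P u -> form u v = 0).
Proof.
move=> iP; have [sPo iPo] := ideal_orthogonal iP; case: iP => sP iP.
split=> [|s1 v s2 Hs [Pv Pov]]; last by split; [apply: iP|apply: iPo].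
split=> [|a u v [Pu Pou] [Pv Pov]]; first by split; [case: sP|case: sPo].
by split; [case: sP => _; apply|apply: sPo.2].
Qed.

Lemma cyclic_form_two P (T : Type) (h : T -> A) (x : 'I_p.+2 -> T) i j : ideal P ->
  i != j -> P (h (x i)) -> (forall w, P w -> form w (h (x j)) = 0) ->
  cyclic_form (map h [seq x k | k <- enum 'I_p.+2]) = 0.
Proof.
move=> iP ij Pi Pj; rewrite -map_comp; set s := map _ _.
have Hs : size s = p.+2 by rewrite size_map size_enum_ord.
have nths (k : 'I_p.+2) : nth 0 s k = h (x k).
  by rewrite (nth_map ord0) ?size_enum_ord // nth_ord_enum.
have split2 (k l : nat) : (k < l < p.+2)%N ->
    s = take k s ++ nth 0 s k :: drop k.+1 (take l s) ++ nth 0 s l :: drop l.+1 s.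
  move=> /andP[kl lp].
  rewrite -{1}(cat_take_drop l s) -{1}(cat_take_drop k (take l s)) take_takel ?(ltnW kl) //.
  rewrite (drop_nth 0 (n := k)) ?size_takel ?Hs // ?(ltnW lp) // nth_take //.
  by rewrite (drop_nth 0 (n := l)) ?Hs //; cat_right.
have := ltn_ord i; have := ltn_ord j.
case: (ltngtP i j) => [lt|gt|/val_inj E]; last by rewrite E eqxx in ij.
- move=> jp ip; rewrite (@split2 i j) ?lt //.
  apply: (cyclic_form_ideal iP _ _ _).1; rewrite ?nths //.
  by rewrite size_drop !size_takel ?size_drop Hs; lia.
- move=> jp ip; rewrite (@split2 j i) ?gt //.
  apply: (cyclic_form_ideal iP _ _ _).2; rewrite ?nths //.
  by rewrite size_drop !size_takel ?size_drop Hs; lia.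
Qed.

Lemma reduce_isotropic (J : {vspace A}) : ideal (fun v => v \in J) -> J != 0%VS ->
  (forall u v, u \in J -> v \in J -> form u v = 0) ->
  exists W' : weights K, [/\ ngon_model p.+2 W', flip_invariant p.+2 W',
    (#|var W'| < \dim (fullv : {vspace A}))%N &
    exists (T : finType) (h : T -> A) q, tensor_eq h q /\
      forall G : ngonization p.+2,
        partition_function (family_weights h q) G = partition_function W' G].
Proof.
move=> iJ J0 JJ; have [[sD iD]] := (ideal_orthogonal iJ, tt).
have [D HD] := subspace_vspace sD.
(* D is the orthogonal of J, and B represents D / J, which carries the smaller model. *)
pose B := (D :\: J)%VS; pose C := (D^C)%VS.
have JD : (J <= D)%VS by apply/subvP => v vJ; apply/HD => u uJ; apply: JJ.
have JB0 : (J :&: B = 0)%VS by rewrite capvC capv_diff.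
have JBD : (J + B = D)%VS by rewrite addvC addv_diff; apply/addv_idPl.
have JBC0 : ((J + B) :&: C = 0)%VS by rewrite JBD capv_compl.
have JBCf : ((J + B) + C = fullv)%VS by rewrite JBD addv_complf.
have bJB := family_basis_sum (vbasis_family J) (vbasis_family B) JB0.
pose h (t : 'I_(\dim J) + 'I_(\dim B) + 'I_(\dim C)) : A :=
  match t with
  | inl (inl t) => (vbasis J)`_t | inl (inr t) => (vbasis B)`_t
  | inr t => (vbasis C)`_t
  end.
have bh : family_basis h fullv.
  have := family_basis_sum bJB (vbasis_family C) JBC0; rewrite JBCf.
  have -> // : (fun t : 'I_(\dim J) + 'I_(\dim B) + 'I_(\dim C) =>
      match t with inl t => match t with inl t => (vbasis J)`_t | inr t => (vbasis B)`_t end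
      | inr t => (vbasis C)`_t end) = h.
  by apply: funext => -[[]|].
have [w [hw Hw]] := dual_family bh.
have [mJ _ _] := vbasis_family J; have [mB spB _] := vbasis_family B.
have BD : (B <= D)%VS by rewrite -JBD addvSr.
have mJ' (t : 'I_(\dim J)) : (vbasis J)`_t \in J by apply: mJ.
have mBD (t : 'I_(\dim B)) : (vbasis B)`_t \in D by apply: (subvP BD); apply: mB.
(* This dual vector kills J + B = D, so it lies in the biorthogonal of J, which is J. Hence q
   couples C to J only. *)
have wC i : w (inr i) \in J.
  apply: biorthogonal => v Hv; have /HD : forall u, u \in J -> form u v = 0 by [].
  rewrite -JBD formC => vD; have [_ /(_ v vD)[c ->] _] := bJB.
  rewrite form_suml big1 // => t _; rewrite formZl.
  by have := hw (inl t) (inr i); rewrite /= => ->; rewrite mulr0.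
have wB i : w (inl (inr i)) \in D.
  apply/HD => u uJ; have [_ /(_ u uJ)[c ->] _] := vbasis_family J.
  rewrite form_suml big1 // => t _; rewrite formZl.
  by have := hw (inl (inl t)) (inl (inr i)); rewrite /= => ->; rewrite mulr0.
have DJ u v : u \in D -> v \in J -> form u v = 0.
  by move=> /HD H vJ; rewrite formC H.
pose q s t := form (w s) (w t).
pose b (i : 'I_(\dim B)) : A := (vbasis B)`_i.
pose iota (i : 'I_(\dim B)) : 'I_(\dim J) + 'I_(\dim B) + 'I_(\dim C) := inl (inr i).
have [Wm Wf] : ngon_model p.+2 (family_weights b (fun s t => q (iota s) (iota t))) /\
    flip_invariant p.+2 (family_weights b (fun s t => q (iota s) (iota t))).
  apply: (@submodel _ _ A _ b _ (fun v => v \in J)).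
  - by move=> s t; apply: formC.
  - move=> r s; have := hw (iota r) (iota s).
    rewrite [w (iota s) in X in X -> _](Hw (w (iota s))) form_sumr !big_sumType /=.
    rewrite big1 ?add0r => [|t _]; last first.
      by rewrite formZr (DJ _ _ (mBD r) (mJ' t)) mulr0.
    rewrite [X in _ + X]big1 ?addr0 => [|t _]; last first.
      by rewrite (DJ _ _ (wB s) (wC t)) scale0r form0r.
    by move=> <-; apply: eq_bigr => t _; rewrite formZr.
  - by move=> u t uJ; rewrite formC DJ //; apply: mBD.
  - by move=> u v; apply: JJ.
  - move=> s Hs.
    have : br (map b s) \in D.
      case: s Hs => [//|t s] [Hs]; apply/HD => u uJ.
      rewrite formC (br_rot (s1 := [::])) /= ?size_map //.
      rewrite formC DJ //; first exact: mBD.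
      by apply: iJ.2 => //; rewrite size_map addn0.
    rewrite -JBD => /memv_addP[u uJ [v /spB[c ->] ->]].
    by exists c, u; split=> //; rewrite addrC.
eexists; split; [exact: Wm|exact: Wf| |].
  rewrite /= card_ord.
  have := dimvS (subvf D); have : (\dim J + \dim B = \dim D)%N.
    by rewrite -dimv_disjoint_sum // JBD.
  have : (0 < \dim J)%N by rewrite lt0n dimv_eq0.
  by lia.
exists _, h, q; split=> [|G]; first exact: dual_tensor Hw.
rewrite (@partition_function_isotropic _ _ _ _ _ _
  (fun t => if t is inl (inl _) then true else false)
  (fun t => if t is inr _ then true else false) iota) //.
- by apply: partition_function_ext => s _ /=; rewrite -map_comp.
- by rewrite !ltnS; apply: arity_gt0 A.
- by move=> s t [].
- by move=> [[t|t]|t] //= _ _; exists t.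
- by case=> [[]|].
- move=> x i j ij Ji Cj; apply: (cyclic_form_two (P := fun v => v \in J) iJ ij).
    by case: (x i) Ji => [[t|]|] //= _; apply: mJ.
  move=> u uJ; rewrite formC DJ //.
  case: (x j) Cj => [[t|t]|] //= _.
  exact: (subvP JD _ (mJ' t)).
- move=> s [//|t] _ Js; have E : form (w s) (w (inr t)) = 0.
    case: s Js => [[//|s]|s] _; first by rewrite DJ.
    by rewrite JJ.
  by split=> //; rewrite /q formC.
Qed.

Lemma reduce_direct (I I' : {vspace A}) :
  ideal (fun v => v \in I) -> (forall v, v \in I' <-> forall u, u \in I -> form u v = 0) ->
  (I :&: I' = 0)%VS -> I != 0%VS -> I' != 0%VS ->
  exists W1 W2 : weights K, [/\ ngon_model p.+2 W1 /\ flip_invariant p.+2 W1,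
    ngon_model p.+2 W2 /\ flip_invariant p.+2 W2,
    (#|var W1| < \dim (fullv : {vspace A}))%N,
    (#|var W2| < \dim (fullv : {vspace A}))%N &
    exists (T : finType) (h : T -> A) q, tensor_eq h q /\
      forall G : ngonization p.+2, partition_function (family_weights h q) G =
        partition_function W1 G + partition_function W2 G].
Proof.
move=> iI HI' II0 I0 I'0.
have iI' : ideal (fun v => v \in I').
  have [[s0 sl] i'] := ideal_orthogonal iI; split; first split.
  - exact/HI'.
  - by move=> a u v /HI' Hu /HI' Hv; apply/HI'; apply: sl.
  - by move=> s1 v s2 Hs /HI' Hv; apply/HI'; apply: i'.
have II' u v : u \in I -> v \in I' -> form u v = 0 by move=> uI /HI'; apply.
have biI v : (forall w, w \in I' -> form v w = 0) -> v \in I.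
  by move=> H; apply: biorthogonal => w Hw; apply: H; apply/HI'.
(* A vector orthogonal to I + I' lies in I' and in the orthogonal of I', which is I; so it is 0. *)
have full : (I + I' = fullv)%VS.
  apply/eqP; rewrite eqEsubv subvf; apply/subvP => v _; apply: biorthogonal => w Hw.
  suff -> : w = 0 by rewrite form0r.
  apply/eqP; rewrite -memv0 -II0 memv_cap; apply/andP; split.
    by apply: biI => u uI'; rewrite formC Hw // (subvP (addvSr _ _)).
  by apply/HI' => u uI; rewrite Hw // (subvP (addvSl _ _)).
pose h (t : 'I_(\dim I) + 'I_(\dim I')) : A :=
  match t with inl t => (vbasis I)`_t | inr t => (vbasis I')`_t end.
have bh : family_basis h fullv.
  by rewrite -full; apply: family_basis_sum II0; apply: vbasis_family.
have [w [hw Hw]] := dual_family bh.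
have [mI spI _] := vbasis_family I; have [mI' spI' _] := vbasis_family I'.
have w1 i : w (inl i) \in I.
  apply: biI => v /spI'[c ->]; rewrite form_sumr big1 // => t _; rewrite formZr formC.
  by have := hw (inr t) (inl i); rewrite /= => ->; rewrite mulr0.
have w2 i : w (inr i) \in I'.
  apply/HI' => v /spI[c ->]; rewrite form_suml big1 // => t _; rewrite formZl.
  by have := hw (inl t) (inr i); rewrite /= => ->; rewrite mulr0.
pose q s t := form (w s) (w t).
pose b1 (i : 'I_(\dim I)) : A := (vbasis I)`_i.
pose b2 (i : 'I_(\dim I')) : A := (vbasis I')`_i.
have closed (U : {vspace A}) (s : seq A) : ideal (fun v => v \in U) -> size s = p.+1 ->
    (forall v, v \in s -> v \in U) -> br s \in U.
  case: s => [//|v s] [_ iU] [Hs] sU.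
  by apply: (iU [::]) => //; apply: sU; rewrite mem_head.
have M1 : ngon_model p.+2 (family_weights b1 (fun s t => q (inl s) (inl t))) /\
    flip_invariant p.+2 (family_weights b1 (fun s t => q (inl s) (inl t))).
  apply: (@submodel _ _ A _ b1 _ (fun v => v = 0)).
  - by move=> s t; apply: formC.
  - move=> r s; have := hw (inl r) (inl s).
    rewrite [w (inl s) in X in X -> _](Hw (w (inl s))) form_sumr big_sumType /=.
    rewrite [X in _ + X]big1 ?addr0 => [|t _]; last first.
      by rewrite formZr (II' _ _ (mI r) (mI' t)) mulr0.
    by move=> <-; apply: eq_bigr => t _; rewrite formZr.
  - by move=> u t ->; rewrite form0l.
  - by move=> u v ->; rewrite form0l.
  - move=> s Hs; have /spI[c ->] : br (map b1 s) \in I.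
      apply: closed => //; first by rewrite size_map.
      by move=> _ /mapP[t _ ->]; apply: mI.
    by exists c, 0; split=> //; rewrite addr0.
have M2 : ngon_model p.+2 (family_weights b2 (fun s t => q (inr s) (inr t))) /\
    flip_invariant p.+2 (family_weights b2 (fun s t => q (inr s) (inr t))).
  apply: (@submodel _ _ A _ b2 _ (fun v => v = 0)).
  - by move=> s t; apply: formC.
  - move=> r s; have := hw (inr r) (inr s).
    rewrite [w (inr s) in X in X -> _](Hw (w (inr s))) form_sumr big_sumType /=.
    rewrite big1 ?add0r => [|t _]; last first.
      by rewrite formZr [X in _ * X]formC (II' _ _ (mI t) (mI' r)) mulr0.
    by move=> <-; apply: eq_bigr => t _; rewrite formZr.
  - by move=> u t ->; rewrite form0l.
  - by move=> u v ->; rewrite form0l.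
  - move=> s Hs; have /spI'[c ->] : br (map b2 s) \in I'.
      apply: closed => //; first by rewrite size_map.
      by move=> _ /mapP[t _ ->]; apply: mI'.
    by exists c, 0; split=> //; rewrite addr0.
have dims : (\dim I + \dim I' = \dim (fullv : {vspace A}))%N.
  by rewrite -dimv_disjoint_sum // full.
have dI : (0 < \dim I)%N by rewrite lt0n dimv_eq0.
have dI' : (0 < \dim I')%N by rewrite lt0n dimv_eq0.
eexists; eexists; split; [exact: M1|exact: M2| | |].
- by rewrite /= card_ord; lia.
- by rewrite /= card_ord; lia.
exists _, h, q; split=> [|G]; first exact: dual_tensor Hw.
rewrite partition_function_direct //.
- by congr (_ + _); apply: partition_function_ext => s _ /=; rewrite -map_comp.
- move=> x i j t1 t2 Ei Ej; apply: (cyclic_form_two (P := fun v => v \in I) (i := i) (j := j) iI).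
  + by apply/eqP => E; rewrite E Ej in Ei.
  + by rewrite Ei /=; apply: mI.
  + by move=> u uI; rewrite Ej /= II' // mI'.
- by move=> s t; split; last rewrite /q formC; apply: II'.
Qed.

End Reduction.

(** Strong induction on the number of variables, which is the dimension of A: both reductions lower
    it, and each orthogonal splitting contributes the families of its two halves. *)
Lemma decomposition (K : numClosedFieldType) (p : nat) (W : weights K) : (0 < p)%N ->
  ngon_model p.+2 W -> flip_invariant p.+2 W ->
  exists (A : finType) (F : A -> weights K),
    (forall a, ngon_model p.+2 (F a) /\ (is_type1 p.+2 (F a) \/ is_type2 p.+2 (F a))) /\
    (forall G : ngonization p.+2,
       partition_function W G = \sum_(a : A) partition_function (F a) G).
Proof.
move=> p_gt0; have [N] := ubnP #|var W|; elim: N W => // N IH W leN Wm Wf.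
pose A := model_algebra p_gt0 Wm Wf.
have dimA : \dim (fullv : {vspace A}) = #|var W| by rewrite dimvf /= /dim /= muln1.
have ZA := @partition_function_family K p W p_gt0 Wm Wf.
have [[s [Hs nz]]|br0] := EM (exists s : seq A, size s = p.+1 /\ br s <> 0); last first.
  (* With a zero bracket all polygon factors vanish, and there is at least one polygon, so Z is the
     empty sum. *)
  exists void, (fun a : void => match a with end); split=> [[]|G].
  rewrite [RHS]big_pred0 => [|[]]; apply: big1 => x _.
  case/card_gt0P: (polygon_gt0 G) => a _; rewrite (bigD1 a) //=.
  suff -> : gamma [seq x (a, i) | i <- enum 'I_p.+2] = 0 by rewrite !mul0r.
  have : size [seq x (a, i) | i <- enum 'I_p.+2] = p.+2 by rewrite size_map size_enum_ord.
  case/lastP: [seq x (a, i) | i <- _] => [//|r t]; rewrite size_rcons => -[Hr].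
  rewrite (model_gamma p_gt0 Wm Wf) //.
  suff -> : br (map (@ebase K (var W)) r : seq A) = 0 by rewrite form0l.
  by apply: contrapT => nz; apply: br0; eexists; split; [|exact: nz]; rewrite size_map.
have [A_simple|not_simple] := EM (simple A).
  have Hbr : exists s : seq A, size s = p.+1 /\ br s <> 0 by exists s.
  have Zloop (T : finType) m (ij : T -> 'I_m * 'I_m) (c : K) (E : T -> A)
      (G : ngonization p.+2) :
      loop_basis ij c E -> partition_function W G = partition_function (loop_weights ij c) G.
    move=> [ten gam]; rewrite -(ZA _ _ _ G ten).
    apply: partition_function_ext => r Hr.
    case: r Hr => [//|t r]; case/lastP: r => [//|r u] Hr.
    have Hr' : size r = p by move: Hr; rewrite /= size_rcons => -[].
    apply: etrans (gam t u r Hr'); rewrite -[LHS]/(cyclic_form (map E (t :: rcons r u))).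
    by rewrite -rcons_cons map_rcons cyclic_formE // size_map /= Hr'.
  have np : (p.+2 - 2)%N = p by rewrite subSS subSS subn0.
  case: (simple_loop_basis A_simple Hbr) => [[r [c [E [r1 c0 bE]]]]|].
    have p0 : p%:R != 0 :> K by rewrite pnatr_eq0 -lt0n.
    have Ec : (p.+2 - 2)%:R * (c / p%:R) = c by rewrite np mulrC divfK.
    exists unit, (fun _ => type1_weights p.+2 r (c / p%:R)); split=> [_|G].
      split; last first.
        by left; exists r, (c / p%:R); split; rewrite ?mulf_neq0 ?invr_eq0.
      rewrite /type1_weights Ec; apply: loop_weights_model => // t.
      by exists (t.2, t.1).
    by rewrite big_const card_unit /= addr0 /type1_weights Ec; apply: Zloop bE.
  move=> [evp [M [N' [c [E [MN c0 bE]]]]]].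
  have k0 : (p./2)%:R != 0 :> K.
    rewrite pnatr_eq0 -lt0n half_gt0 ltn_neqAle p_gt0 andbT.
    by apply: contraNneq evp => <-.
  have Ec : (p.+2 - 2)./2%:R * (c / (p./2)%:R) = c by rewrite np mulrC divfK.
  exists unit, (fun _ => type2_weights p.+2 M N' (c / (p./2)%:R)); split=> [_|G].
    split; last first.
      by right; exists M, N', (c / (p./2)%:R); split; rewrite ?np ?mulf_neq0 ?invr_eq0.
    rewrite /type2_weights Ec; apply: loop_weights_model => // [|t]; first exact: val_inj.
    have Ht : type2_pair ((val t).2, (val t).1).
      by case: t => -[i j] /=; rewrite !type2_pairE eq_sym.
    by exists (Sub _ Ht); rewrite SubK.
  by rewrite big_const card_unit /= addr0 /type2_weights Ec; apply: Zloop bE.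
have [P [iP [v [v0 Pv]] [u nPu]]] : exists P : A -> Prop,
    [/\ ideal P, exists v, v <> 0 /\ P v & exists u, ~ P u].
  apply: contrapT => H; apply: not_simple => P iP nzP v; apply: contrapT => nPv.
  by apply: H; exists P; split=> //; exists v.
have [[w [w0 Rw]]|noR] := EM (exists w : A, w <> 0 /\ P w /\ forall u, P u -> form u w = 0).
  have iR := ideal_radical iP; have [J HJ] := subspace_vspace iR.1.
  have [|||W' [Wm' Wf' lt [T [h [q [ten Z]]]]]] := @reduce_isotropic K p A J.
  - have [[R0 Rl] Ri] := iR; split; first split.
    + exact/HJ.
    + by move=> a x y /HJ Hx /HJ Hy; apply/HJ; apply: Rl.
    + by move=> s1 x s2 Hs12 /HJ Hx; apply/HJ; apply: Ri.
  - apply/eqP => J0; apply: w0; apply/eqP; rewrite -memv0 -J0; exact/HJ.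
  - by move=> x y /HJ[Px _] /HJ[_ Py]; apply: Py.
  have [|A' [F [HF ZF]]] := IH W' _ Wm' Wf'; first by rewrite dimA in lt; apply: leq_trans lt leN.
  by exists A', F; split=> // G; rewrite -(ZA _ _ _ G ten) Z ZF.
have [I HI] := subspace_vspace iP.1.
have [I' HI'] := subspace_vspace (ideal_orthogonal iP).1.
have II0 : (I :&: I' = 0)%VS.
  apply/eqP; rewrite -subv0; apply/subvP => x; rewrite memv_cap => /andP[/HI Px /HI' Ox].
  by rewrite memv0; apply/eqP; apply: contrapT => x0; apply: noR; exists x.
have [||||| W1 [W2 [[m1 f1] [m2 f2] lt1 lt2 [T [h [q [ten Z]]]]]]] := @reduce_direct K p A I I'.
- have [[R0 Rl] Ri] := iP; split; first split.
  + exact/HI.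
  + by move=> a x y /HI Hx /HI Hy; apply/HI; apply: Rl.
  + by move=> s1 x s2 Hs12 /HI Hx; apply/HI; apply: Ri.
- move=> x; split=> [/HI' H y /HI|H]; first exact: H.
  by apply/HI' => y /HI; apply: H.
- exact: II0.
- by apply/eqP => I0; apply: v0; apply/eqP; rewrite -memv0 -I0; apply/HI.
- apply/eqP => I'0; apply: nPu; apply/HI; apply: biorthogonal => x Hx.
  suff -> : x = 0 by rewrite form0r.
  apply/eqP; rewrite -memv0 -I'0; apply/HI' => y /HI; exact: Hx.
have [|A1 [F1 [H1 Z1]]] := IH W1 _ m1 f1; first by rewrite dimA in lt1; apply: leq_trans lt1 leN.
have [|A2 [F2 [H2 Z2]]] := IH W2 _ m2 f2; first by rewrite dimA in lt2; apply: leq_trans lt2 leN.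
exists (A1 + A2)%type, (fun a => match a with inl a => F1 a | inr a => F2 a end).
split=> [[a|a]|G]; [exact: H1|exact: H2|].
by rewrite -(ZA _ _ _ G ten) Z Z1 Z2 big_sumType.
Qed.

Theorem mainTheorem2 (R : realType) (n : nat) (hn : (3 <= n)%N) :
  (forall W : weights R[i], ngon_model n W -> flip_invariant n W ->
     exists (A : finType) (F : A -> weights R[i]),
       (forall a : A,
          ngon_model n (F a) /\ (is_type1 n (F a) \/ is_type2 n (F a))) /\
       (forall G : ngonization n,
          partition_function W G = \sum_(a : A) partition_function (F a) G))
  /\
  (forall (r : nat) (beta : R[i]), (1 <= r)%N -> beta != 0 ->
     forall G : ngonization n,
       let c := (n - 2)%:R * beta in
       let V := nb_vertices G in
       let E := nb_edges G in
       let P := nb_polygons G in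
       partition_function (type1_weights n r beta) G
         = r%:R ^+ V * c ^ (P%:Z - E%:Z) /\
       r%:R ^+ V * c ^ (P%:Z - E%:Z) = c ^ (euler_char G) * (r%:R / c) ^+ V)
  /\
  (forall (M N : nat) (beta : R[i]),
     ~~ odd (n - 2) -> (1 <= M + N)%N -> beta != 0 ->
     forall G : ngonization n,
       let c := (n - 2)./2%:R * beta in
       let E := nb_edges G in
       let P := nb_polygons G in
       (~ chequered G -> partition_function (type2_weights n M N beta) G = 0) /\
       (forall col, @chequering n G col ->
          let V1 := nb_coloured col true in
          let V2 := nb_coloured col false in
          partition_function (type2_weights n M N beta) G
            = (M%:R ^+ V1 * N%:R ^+ V2 + M%:R ^+ V2 * N%:R ^+ V1)
              * c ^ (P%:Z - E%:Z))).
Proof.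
split; [|split].
- case: n hn => [|[|p]] // hp W; exact: decomposition.
- move=> r beta r1 beta0 G c V E P.
  have c0 : c != 0 by rewrite mulf_neq0 // pnatr_eq0 subn_eq0 -ltnNge.
  by split; [apply: partition_function_type1 | apply: type1_euler].
- move=> M N beta evn MN beta0 G c E P.
  have c0 : c != 0.
    rewrite mulf_neq0 // pnatr_eq0 -lt0n half_gt0 ltn_neqAle subn_gt0 hn andbT.
    by apply: contraNneq evn => <-.
  by apply: partition_function_type2 => //; apply: leq_trans hn.
Qed.
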